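(* Let $m_1,m_2\in\mathbb{N}$, $T>0$, and let $\varphi$ and $\widetilde\varphi$ be the Weyl–Titchmarsh functions on $[0,\infty)$ of two Dirac-type systems with potentials $v,\widetilde v\in\big[C^1([0,\infty))\big]^{m_1\times m_2}$, respectively. Suppose that for some $c\in\mathbb{R}$, along the ray $\{z:\Re z=c\,\Im z,\ \Im z>0\}$, for each $\varepsilon>0$ one has $\|\varphi(z)-\widetilde\varphi(z)\|=O\big(e^{2i(T-\varepsilon)z}\big)$ as $|z|\to\infty$ (for some matrix norm). Then $v(x)=\widetilde v(x)$ for all $x\in[0,T]$.
   Context: Dirac-type system with potential $v$: $y'(x,z)=i(zJ+JV(x))y(x,z)$, $x\ge0$, $m=m_1+m_2$, $J=\begin{bmatrix}I_{m_1}&0\\0&-I_{m_2}\end{bmatrix}$, $V=\begin{bmatrix}0_{m_1}&v\\ v^*&0_{m_2}\end{bmatrix}$. With $u_0(x,z)$ the fundamental solution satisfying $u_0(0,z)=I_m$, the Weyl–Titchmarsh function $\varphi$ is the unique $m_2\times m_1$ matrix function holomorphic in $\mathbb{C}_+$ such that $u_0(\cdot,z)\begin{bmatrix}I_{m_1}\\ \varphi(z)\end{bmatrix}$ has entries in $L^2((0,\infty))$. *)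

(* Defs.v *)
From HB Require Import structures.
From mathcomp Require Import all_boot all_order all_algebra.
From mathcomp Require Import all_classical all_reals all_analysis.
From mathcomp Require Import complex.
Import Order.TTheory GRing.Theory Num.Theory.
Import numFieldNormedType.Exports.

Set Implicit Arguments.
Unset Strict Implicit.
Unset Printing Implicit Defensive.

Local Open Scope ring_scope.
Local Open Scope classical_set_scope.

(* The complex numbers over R, seen as a numClosedFieldType (so that they
   carry their usual normed/topological structure, used for complex
   differentiability). *)
Definition C (R : realType) : numClosedFieldType := R[i].

Definition cabs {R : realType} (z : C R) : R :=
  Num.sqrt (complex.Re z ^+ 2 + complex.Im z ^+ 2).

Definition Jmat {R : realType} (m1 m2 : nat) : 'M[C R]_(m1 + m2) :=
  block_mx 1%:M 0 0 (- 1%:M).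

Definition Vmat {R : realType} (m1 m2 : nat) (v : 'M[C R]_(m1, m2)) :
  'M[C R]_(m1 + m2) :=
  block_mx 0 v (map_mx Num.conj v^T) 0.

Definition has_cderiv {R : realType} (g : R -> C R) (x : R) (d : C R) : Prop :=
  is_derive x 1 (fun t => complex.Re (g t)) (complex.Re d) /\
  is_derive x 1 (fun t => complex.Im (g t)) (complex.Im d).

Definition C1_pos_real {R : realType} (f : R -> R) : Prop :=
  exists g : R -> R,
    (forall x, derivable g x 1) /\ continuous (derive1 g) /\
    (forall x, 0 <= x -> g x = f x).

Definition C1_pos_mx {R : realType} (m1 m2 : nat)
  (v : R -> 'M[C R]_(m1, m2)) : Prop :=
  forall i j, C1_pos_real (fun x => complex.Re (v x i j)) /\
              C1_pos_real (fun x => complex.Im (v x i j)).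

Definition fund_sol {R : realType} (m1 m2 : nat) (v : R -> 'M[C R]_(m1, m2))
  (z : C R) (u : R -> 'M[C R]_(m1 + m2)) : Prop :=
  u 0 = 1%:M /\
  (forall i j, {within `[0, +oo[, continuous (fun t => u t i j)}) /\
  (forall x, 0 < x -> forall i j,
     has_cderiv (fun t => u t i j) x
       ((('i : C R) *: (z *: @Jmat R m1 m2 + @Jmat R m1 m2 *m Vmat (v x)) *m u x) i j)).

Definition L2_pos {R : realType} (h : R -> C R) : Prop :=
  (@lebesgue_measure R).-integrable `]0, +oo[ (fun x => ((cabs (h x)) ^+ 2)%:E).

Definition weyl_function {R : realType} (m1 m2 : nat)
  (v : R -> 'M[C R]_(m1, m2)) (phi : C R -> 'M[C R]_(m2, m1)) : Prop :=
  (forall z : C R, 0 < complex.Im z ->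
     forall i j, derivable (fun w : C R => phi w i j) z 1) /\
  (forall z : C R, 0 < complex.Im z ->
     exists u, fund_sol v z u /\
       forall i j, L2_pos (fun x => (u x *m col_mx 1%:M (phi z)) i j)).

Definition ray_pt {R : realType} (c t : R) : C R := Complex (c * t) t.

(* Main.v *)
(* Let u and ut be the fundamental solutions of the two systems. The transfer
   matrix E(x, z) = ut(x, z) u(x, z)^-1 solves a linear system whose
   coefficients are affine in z, hence is entire in z, of exponential type in
   |Im z| and bounded on the real axis. For Im z > 0 every vector splits into a
   value of the Weyl solution, which decays like exp(i z x), and a value of a
   solution growing like exp(- i z x); E maps the first to the Weyl solution of
   the second system up to a growing solution with initial value phi - phit.
   When x < T the assumed decay of phi - phit compensates that growth, so E is
   bounded on the ray, and by Phragmen-Lindelof on the upper half-plane. The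
   symmetry E(x, conj z) = J E'(x, z)^* J, where E' exchanges the two systems,
   gives the lower half-plane. By Liouville E does not depend on z, hence it
   commutes with J, hence it is the identity, and the potentials agree.

   Phragmen-Lindelof and Liouville are obtained from a maximum principle for
   functions with a second order complex Taylor expansion at every point,
   proved by a second derivative test against a log-superharmonic barrier. *)

Require Import Defs.
From HB Require Import structures.
From mathcomp Require Import all_boot all_order all_algebra.
From mathcomp Require Import all_classical all_reals all_analysis.
From mathcomp Require Import complex.
From mathcomp Require Import ring lra.
Import Order.TTheory GRing.Theory Num.Theory.
Import numFieldNormedType.Exports.
Local Open Scope ring_scope.

Set Implicit Arguments.
Unset Strict Implicit.
Unset Printing Implicit Defensive.
Local Open Scope classical_set_scope.

(** * Complex numbers *)

Section Cplx.
Context {R : realType}.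
Implicit Types z w : C R.

(** Sizes are measured by the squared modulus [nsq], polynomial in the real and imaginary parts, so
    exponents and constants are squares of the usual ones. At depth [x < T] the hypothesis is used
    with [eps = T - x]: entrywise, [nsq (phi - phit)] is then [O(exp(-4 x Im z))], which is exactly
    the ratio between the squared decay [exp(-2 x Im z)] of Weyl solutions and the squared growth
    [exp(2 x Im z)] of the others. The splitting is uniformly transversal only where [Im z]
    dominates the size of the potentials; the remaining bounded piece of the ray is covered by the
    exponential growth bound. The ray cuts the upper half-plane into two sectors of opening less
    than pi, for which growth of order one is subcritical.

    The matrix E is built from potentials frozen outside [[0, T]], whose coefficients are globally
    bounded. The Weyl functions remain those of the original potentials; the two settings meet
    because E relates the original fundamental solutions at depths below [T]. *)

Definition nsq z : R := complex.Re z ^+ 2 + complex.Im z ^+ 2.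

Lemma ReD z w : complex.Re (z + w) = complex.Re z + complex.Re w.
Proof. by case: z; case: w. Qed.
Lemma ImD z w : complex.Im (z + w) = complex.Im z + complex.Im w.
Proof. by case: z; case: w. Qed.
Lemma ReN z : complex.Re (- z) = - complex.Re z.
Proof. by case: z. Qed.
Lemma ImN z : complex.Im (- z) = - complex.Im z.
Proof. by case: z. Qed.
Lemma ReM z w : complex.Re (z * w) =
  complex.Re z * complex.Re w - complex.Im z * complex.Im w.
Proof. by case: z; case: w. Qed.
Lemma ImM z w : complex.Im (z * w) =
  complex.Re z * complex.Im w + complex.Im z * complex.Re w.
Proof. by case: z; case: w. Qed.
Lemma Re_conj z : complex.Re (Num.conj z) = complex.Re z.
Proof. by case: z. Qed.
Lemma Im_conj z : complex.Im (Num.conj z) = - complex.Im z.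
Proof. by case: z. Qed.
Lemma Re_i : complex.Re ('i : C R) = 0. Proof. by []. Qed.
Lemma Im_i : complex.Im ('i : C R) = 1. Proof. by []. Qed.
Lemma Re0 : complex.Re (0 : C R) = 0. Proof. by []. Qed.
Lemma Im0 : complex.Im (0 : C R) = 0. Proof. by []. Qed.
Lemma Re1 : complex.Re (1 : C R) = 1. Proof. by []. Qed.
Lemma Im1 : complex.Im (1 : C R) = 0. Proof. by []. Qed.

Definition ReIm := (ReD, ImD, ReN, ImN, ReM, ImM, Re_conj, Im_conj, Re_i, Im_i,
  Re0, Im0, Re1, Im1).

Lemma ReIm_inj z w : complex.Re z = complex.Re w -> complex.Im z = complex.Im w -> z = w.
Proof. by case: z => a b; case: w => c d /= -> ->. Qed.

Lemma conjD z w : Num.conj (z + w) = Num.conj z + Num.conj w.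
Proof. by apply: ReIm_inj; rewrite !ReIm; ring. Qed.
Lemma conjN z : Num.conj (- z) = - Num.conj z.
Proof. by apply: ReIm_inj; rewrite !ReIm; ring. Qed.
Lemma conjM z w : Num.conj (z * w) = Num.conj z * Num.conj w.
Proof. by apply: ReIm_inj; rewrite !ReIm; ring. Qed.
Lemma conj_sum I (r : seq I) (P : pred I) (F : I -> C R) :
  Num.conj (\sum_(i <- r | P i) F i) = \sum_(i <- r | P i) Num.conj (F i).
Proof. by apply: (big_morph _ conjD); apply: ReIm_inj; rewrite !ReIm; ring. Qed.

Lemma Re_sum I (r : seq I) (P : pred I) (F : I -> C R) :
  complex.Re (\sum_(i <- r | P i) F i) = \sum_(i <- r | P i) complex.Re (F i).
Proof. exact: (big_morph _ ReD Re0). Qed.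
Lemma Im_sum I (r : seq I) (P : pred I) (F : I -> C R) :
  complex.Im (\sum_(i <- r | P i) F i) = \sum_(i <- r | P i) complex.Im (F i).
Proof. exact: (big_morph _ ImD Im0). Qed.

Lemma nsq_ge0 z : 0 <= nsq z. Proof. by rewrite addr_ge0 ?sqr_ge0. Qed.
Lemma nsq0 : nsq 0 = 0. Proof. by rewrite /nsq !ReIm expr0n addr0. Qed.
Lemma nsqM z w : nsq (z * w) = nsq z * nsq w.
Proof. by rewrite /nsq !ReIm; ring. Qed.
Lemma nsqN z : nsq (- z) = nsq z.
Proof. by rewrite /nsq !ReIm; ring. Qed.
Lemma nsqX z n : nsq (z ^+ n) = nsq z ^+ n.
Proof.
elim: n => [|n IH]; last by rewrite !exprS nsqM IH.
by rewrite !expr0 /nsq !ReIm; ring.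
Qed.
Lemma nsq_conj z : nsq (Num.conj z) = nsq z.
Proof. by rewrite /nsq !ReIm; ring. Qed.
Lemma nsqD_le z w : nsq (z + w) <= 2 * nsq z + 2 * nsq w.
Proof.
rewrite /nsq !ReIm.
have := sqr_ge0 (complex.Re z - complex.Re w).
by have := sqr_ge0 (complex.Im z - complex.Im w); nra.
Qed.
Lemma nsqB_le z w : nsq (z - w) <= 2 * nsq z + 2 * nsq w.
Proof. by rewrite -(nsqN w); exact: nsqD_le. Qed.
Lemma nsq_eq0 z : nsq z = 0 -> z = 0.
Proof.
move/eqP; rewrite paddr_eq0 ?sqr_ge0// !sqrf_eq0 => /andP[/eqP a /eqP b].
exact: ReIm_inj.
Qed.
Lemma cabs_sqr z : cabs z ^+ 2 = nsq z.
Proof. by rewrite sqr_sqrtr// nsq_ge0. Qed.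

(** Weighted Young inequality, from squares of the form $(ka\mp c)^2+(kb\pm d)^2$. The free weight
    [k] lets cross terms be split unevenly between two energies. *)
Lemma Re_mulC_le z w (k : R) : 0 < k ->
  2 * `|complex.Re (z * w)| <= k * nsq z + nsq w / k.
Proof.
move=> k0; rewrite -(ler_pM2r k0).
have -> : (k * nsq z + nsq w / k) * k = k ^+ 2 * nsq z + nsq w.
  by field; rewrite gt_eqF.
rewrite /nsq !ReIm.
have [_|_] := ger0P (_ - _);
set a := complex.Re z; set b := complex.Im z; set c := complex.Re w;
set d := complex.Im w.
  have := sqr_ge0 (k * a - c); have := sqr_ge0 (k * b + d); nra.
have := sqr_ge0 (k * a + c); have := sqr_ge0 (k * b - d); nra.
Qed.

(** Cauchy-Schwarz against the constant vector, read off from the nonnegative double sum of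
    $(f_i-f_j)^2$. *)
Lemma nsq_sum (I : finType) (F : I -> C R) :
  nsq (\sum_i F i) <= #|I|%:R * \sum_i nsq (F i).
Proof.
have H (f : I -> R) : (\sum_i f i) ^+ 2 <= #|I|%:R * \sum_i f i ^+ 2.
  have : 0 <= \sum_i \sum_j (f i - f j) ^+ 2.
    by apply: sumr_ge0 => i _; apply: sumr_ge0 => j _; exact: sqr_ge0.
  have -> : \sum_i \sum_j (f i - f j) ^+ 2 =
      2 * (#|I|%:R * \sum_i f i ^+ 2) - 2 * (\sum_i f i) ^+ 2.
    have inner i : \sum_j (f i - f j) ^+ 2 =
        f i ^+ 2 *+ #|I| + \sum_j f j ^+ 2 - 2 * f i * \sum_j f j.
      have e j : (f i - f j) ^+ 2 = f i ^+ 2 + f j ^+ 2 - 2 * f i * f j by ring.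
      by rewrite (eq_bigr _ (fun j _ => e j)) sumrB big_split/= sumr_const mulr_sumr.
    rewrite (eq_bigr _ (fun i _ => inner i)) sumrB big_split/= sumr_const.
    rewrite -mulr_suml -mulr_sumr sumrMnl -[(\sum_i f i ^+ 2) *+ _]mulr_natl.
    by set S := \sum_i f i; set Q := \sum_i _; ring.
  lra.
rewrite /nsq Re_sum Im_sum big_split/= mulrDr.
exact: lerD (H _) (H _).
Qed.

End Cplx.

(** * The Picard-Lindelof theorem *)

Section RealODE.
Context {R : realType}.
Implicit Types (f g : R -> R) (s t x : R).

Lemma is_derive_continuous f (x d : R) : is_derive x 1 f d -> {for x, continuous f}.
Proof.
by move=> [df _]; apply: differentiable_continuous; apply/derivable1_diffP.
Qed.

(** Derivatives are asked for in the open interval only, since [fund_sol] supplies mere continuity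
    at 0. *)
Lemma derive_ge0_le f (df : R -> R) (a b : R) : a <= b ->
  {within `[a, b], continuous f} ->
  (forall x, a < x -> x < b -> is_derive x 1 f (df x)) ->
  (forall x, a < x -> x < b -> 0 <= df x) -> f a <= f b.
Proof.
rewrite le_eqVlt => /predU1P[->//|ab] cf Df pos; rewrite -subr_ge0.
have Df' x : x \in `]a, b[%R -> is_derive x 1 f (df x).
  by rewrite in_itv/= => /andP[? ?]; exact: Df.
have [c + ->] := MVT ab Df' cf.
by rewrite in_itv/= => /andP[ac cb]; rewrite mulr_ge0 ?subr_ge0 ?(ltW ab)// pos.
Qed.

Lemma continuous_within_pos f : (forall t, 0 <= t -> {for t, continuous f}) ->
  forall a b, 0 <= a -> {within `[a, b], continuous f}.
Proof.
move=> cf a b a0; apply: continuous_in_subspaceT => x.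
by rewrite inE/= in_itv/= => /andP[ax _]; apply: cf; exact: le_trans ax.
Qed.

(** Both [H - G] and [H + G] are nondecreasing. This comparison stands in for estimates of integrals
    in the Picard iteration. *)
Lemma derive_norm_le (G H g h : R -> R) :
  (forall t, 0 <= t -> is_derive t 1 G (g t)) ->
  (forall t, 0 <= t -> is_derive t 1 H (h t)) ->
  (forall t, 0 <= t -> `|g t| <= h t) ->
  forall x, 0 <= x -> `|G x - G 0| <= H x - H 0.
Proof.
move=> DG DH gh x x0; rewrite ler_norml opprB.
have D1 t : 0 <= t -> is_derive t 1 (H - G) (h t - g t).
  by move=> t0; have := DG _ t0; have := DH _ t0 => ? ?; exact: is_deriveB.
have D2 t : 0 <= t -> is_derive t 1 (H + G) (h t + g t).
  by move=> t0; have := DG _ t0; have := DH _ t0 => ? ?; exact: is_deriveD.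
have cD (f df : R -> R) : (forall t, 0 <= t -> is_derive t 1 f (df t)) ->
    {within `[0, x], continuous f}.
  move=> Df; apply: continuous_within_pos => // t t0.
  exact: is_derive_continuous (Df _ t0).
have h1 : (H - G) 0 <= (H - G) x.
  have := @derive_ge0_le _ _ 0 x x0 (cD _ _ D1) (fun t ht _ => D1 t (ltW ht)).
  apply=> t t0 _ /=.
  by rewrite subr_ge0; exact: le_trans (ler_norm _) (gh _ (ltW t0)).
have h2 : (H + G) 0 <= (H + G) x.
  have := @derive_ge0_le _ _ 0 x x0 (cD _ _ D2) (fun t ht _ => D2 t (ltW ht)).
  apply=> t t0 _ /=.
  have := gh _ (ltW t0); rewrite ler_norml => /andP[+ _].
  by rewrite -subr_ge0 opprK addrC.
by move: h1 h2; rewrite !fctE => h1 h2; apply/andP; split; lra.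
Qed.

(* Integrating from [-1] makes the derivative at [0] two-sided. *)
Definition primitive f (x : R) : R :=
  (\int[lebesgue_measure]_(t in `[(-1)%R, x]) f t)%R -
  (\int[lebesgue_measure]_(t in `[(-1)%R, 0%R]) f t)%R.

Lemma primitive0 f : primitive f 0 = 0.
Proof. exact: subrr. Qed.

Lemma is_derive_primitive f (x : R) : continuous f -> 0 <= x ->
  is_derive x 1 (primitive f) (f x).
Proof.
move=> cf x0.
have [||//|dF eF] := @continuous_FTC1_closed R f (-1) x (x + 1) _ _ _ (cf x).
- by rewrite ltrDl.
- apply: continuous_compact_integrable; first exact: segment_compact.
  exact: continuous_subspaceT.
- lra.
rewrite -[f x]subr0 -eF derive1E.
pose k : R := (\int[lebesgue_measure]_(t in `[(-1)%R, 0%R]) f t)%R.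
have -> : primitive f = (fun x => \int[lebesgue_measure]_(t in `[(-1)%R, x]) f t)%R - cst k.
  by apply/funext => y; rewrite fctE.
by apply: is_deriveB; exact/derivableP.
Qed.

(** The intervals of radius [2 * A / 2 ^+ n] around [u n] are nested, because the radius drops by
    exactly the permitted step [A / 2 ^+ n]; the limit is the supremum of their left ends. *)
Lemma geometric_limit (u : nat -> R) (A : R) :
  (forall n, `|u n.+1 - u n| <= A / 2 ^+ n) ->
  exists l, forall n, `|u n - l| <= 2 * A / 2 ^+ n.
Proof.
move=> hu.
have h2 n : (2 : R) ^+ n != 0 by rewrite expf_neq0.
have eS n : A / 2 ^+ n = 2 * (A / 2 ^+ n.+1).
  by rewrite exprS; field.
pose lo n := u n - 2 * (A / 2 ^+ n); pose up n := u n + 2 * (A / 2 ^+ n).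
have loS n : lo n <= lo n.+1.
  by have := hu n; rewrite /lo ler_norml => /andP[? ?]; have := eS n; lra.
have upS n : up n.+1 <= up n.
  by have := hu n; rewrite /up ler_norml => /andP[? ?]; have := eS n; lra.
have A0 n : 0 <= A / 2 ^+ n by exact: le_trans (hu n).
have loup n m : lo n <= up m.
  have lom : lo n <= lo (n + m)%N.
    by elim: m => [|m IH]; rewrite ?addn0// addnS; exact: le_trans (loS _).
  have upm : up (n + m)%N <= up m.
    by elim: n {lom} => [|n IH]//; rewrite addSn; exact: le_trans (upS _) _.
  have : lo (n + m)%N <= up (n + m)%N by rewrite /lo /up; have := A0 (n + m)%N; lra.
  lra.
pose S := [set r | exists n, r = lo n].
have hs : has_sup S.
  by split; [exists (lo 0%N); exists 0%N | exists (up 0%N) => r [n ->]].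
exists (sup S) => n.
have l1 : lo n <= sup S by apply: ub_le_sup; [exact: hs.2 | exists n].
have l2 : sup S <= up n by apply: ge_sup; [exact: hs.1 | move=> r [m ->]].
by rewrite ler_norml -mulrA; move: l1 l2; rewrite /lo /up => l1 l2; apply/andP; split; lra.
Qed.

Lemma continuous_max0 f : (forall t, 0 <= t -> {for t, continuous f}) ->
  continuous (fun t => f (Num.max 0 t)).
Proof.
move=> cf t; apply: (@continuous_comp _ _ _ (fun t => Num.max 0 t) f).
  by apply: continuous_max; [exact: cst_continuous | move=> ?; exact: cvg_id].
by apply: cf; rewrite le_max lexx.
Qed.

Lemma is_derive_expRM (k x : R) : is_derive x 1 (fun t => expR (k * t)) (k * expR (k * x)).
Proof.
have h : is_derive x 1 (fun t : R => k * t) k.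
  have -> : (fun t : R => k * t) = k \*: (id : R -> R) by apply/funext.
  by apply: is_derive_eq; rewrite [LHS]mulr1.
have := @is_derive1_comp _ expR (fun t => k * t) x _ _ (is_derive_expR (k * x)) h.
by rewrite mulrC.
Qed.

Section Picard.
Variables (J : Type) (F : R -> (J -> R) -> J -> R) (y0 : J -> R) (K C0 : R).
Hypothesis K0 : 0 < K.
Hypothesis lipF : forall t (y y' : J -> R) (d : R), 0 <= t ->
  (forall q, `|y q - y' q| <= d) -> forall p, `|F t y p - F t y' p| <= K * d.
Hypothesis bndF : forall t p, 0 <= t -> `|F t y0 p| <= C0.
Hypothesis contF : forall y : J -> R -> R, (forall q, continuous (y q)) ->
  forall p, continuous (fun t => F t (y ^~ t) p).

(** The iterates are controlled for nonnegative times only. Freezing them at their value at 0 for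
    negative times gives an integrand continuous on the whole line, as [contF] and [primitive]
    require. *)
Let rhs (y : J -> R -> R) p : R -> R :=
  fun t => F t (fun q => y q (Num.max 0 t)) p.

Let step (y : J -> R -> R) : J -> R -> R :=
  fun p t => y0 p + primitive (rhs y p) t.

Let iter_ n : J -> R -> R := iter n step (fun q _ => y0 q).

Let cont_rhs (y : J -> R -> R) p :
  (forall q t, 0 <= t -> {for t, continuous (y q)}) -> continuous (rhs y p).
Proof. by move=> cy; apply: contF => q; apply: continuous_max0; exact: cy. Qed.

Let rhsE (y : J -> R -> R) p t : 0 <= t -> rhs y p t = F t (y ^~ t) p.
Proof. by move=> t0; rewrite /rhs (max_idPr t0). Qed.

Let D_step (y : J -> R -> R) p t :
  (forall q t, 0 <= t -> {for t, continuous (y q)}) -> 0 <= t ->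
  is_derive t 1 (step y p) (F t (y ^~ t) p).
Proof.
move=> cy t0; rewrite -rhsE//.
have := is_derive_primitive (cont_rhs (p := p) cy) t0 => ?.
have -> : step y p = cst (y0 p) + primitive (rhs y p) by apply/funext.
by apply: is_derive_eq; rewrite add0r.
Qed.

Let cont_iter n q t : 0 <= t -> {for t, continuous (iter_ n q)}.
Proof.
elim: n q t => [|n IH] q t t0; first exact: cst_continuous.
exact: is_derive_continuous (D_step q IH t0).
Qed.

Let D_iter n p t : 0 <= t -> is_derive t 1 (iter_ n.+1 p) (F t (iter_ n ^~ t) p).
Proof. by move=> t0; apply: D_step t0 => q s; exact: cont_iter. Qed.

Let iter0 n p : iter_ n p 0 = y0 p.
Proof. by case: n => //= n; rewrite /step primitive0 addr0. Qed.

(** Chosen so that [C * expR (2 * K * t)] has derivative [C0 * expR (2 * K * t)], which dominates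
    the first increment. *)
Let C := C0 / (2 * K).

Let C_ge0 (p : J) : 0 <= C.
Proof.
by rewrite /C divr_ge0 ?mulr_ge0 ?(ltW K0)//; exact: le_trans (bndF p (lexx 0)).
Qed.

Let Cexp_ge0 (p : J) n t : 0 <= C / 2 ^+ n * expR t.
Proof. by apply: mulr_ge0; [apply: divr_ge0 (C_ge0 p) _; exact: exprn_ge0 | exact: expR_ge0]. Qed.

Let D_exp (a t : R) : 0 <= t ->
  is_derive t 1 (fun t => a * expR (2 * K * t)) (2 * K * a * expR (2 * K * t)).
Proof.
move=> _; have := is_derive_expRM (2 * K) t => ?.
have -> : (fun t => a * expR (2 * K * t)) = a \*: (fun t => expR (2 * K * t)) by apply/funext.
by apply: is_derive_eq; rewrite -[LHS]/(a * (2 * K * expR (2 * K * t))); ring.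
Qed.

(** The weight [expR (2 * K * t)] makes every iteration contract by one half on the entire
    half-line, since $K e^{2Kt}$ has primitive $e^{2Kt}/2$. The solution is thus global at once. *)
Let iter_step n p t : 0 <= t ->
  `|iter_ n.+1 p t - iter_ n p t| <= C * expR (2 * K * t) / 2 ^+ n.
Proof.
elim: n p t => [|n IH] p t t0.
  have := @derive_norm_le (iter_ 1 p) (fun t => C * expR (2 * K * t)) _ _
    (D_iter 0 p) (D_exp C).
  rewrite expr0 divr1 -[iter_ 0 p t](iter0 1) => h; apply: (le_trans (h _ _ t0)).
    move=> s s0; apply: (le_trans (bndF p s0)); rewrite /C mulrCA divff ?mulr1; last first.
      by rewrite mulf_neq0 ?pnatr_eq0 ?gt_eqF.
    rewrite ler_peMr ?(le_trans _ (bndF p s0))// -expR0 ler_expR !mulr_ge0 ?(ltW K0)//.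
  by rewrite lerBlDr lerDl; apply: mulr_ge0 (C_ge0 p) _; exact: expR_ge0.
pose G : R -> R := iter_ n.+2 p - iter_ n.+1 p.
pose g s := F s (iter_ n.+1 ^~ s) p - F s (iter_ n ^~ s) p.
have DG s : 0 <= s -> is_derive s 1 G (g s).
  by move=> s0; have := D_iter n p s0; have := D_iter n.+1 p s0 => ? ?; exact: is_deriveB.
have gh s : 0 <= s -> `|g s| <= 2 * K * (C / 2 ^+ n.+1) * expR (2 * K * s).
  move=> s0; have := lipF s0 (fun q => IH q s s0) p.
  move=> h; apply: (le_trans h); rewrite le_eqVlt; apply/orP; left; apply/eqP.
  by rewrite exprS; field; rewrite expf_neq0// pnatr_eq0.
have := derive_norm_le DG (D_exp _) gh t0.
have -> : G 0 = 0 by rewrite /G !fctE !iter0 subrr.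
rewrite subr0 /G !fctE => h; apply: (le_trans h).
have e0 : C / 2 ^+ n.+1 * expR (2 * K * t) = C * expR (2 * K * t) / 2 ^+ n.+1 by rewrite mulrAC.
by rewrite e0 lerBlDr lerDl Cexp_ge0.
Qed.

(** The index type [J] may be infinite, the Lipschitz condition being in the sup norm; the system of
    all Taylor coefficients in the spectral parameter relies on this. *)
Theorem picard : exists y : J -> R -> R, (forall p, y p 0 = y0 p) /\
  forall p t, 0 <= t -> is_derive t 1 (y p) (F t (y ^~ t) p).
Proof.
have lim_ p t : exists l, 0 <= t ->
    forall n, `|iter_ n p t - l| <= 2 * (C * expR (2 * K * t)) / 2 ^+ n.
  have [t0|t0] := leP 0 t; last by exists 0.
  by have [l hl] := geometric_limit (fun n => iter_step n p t0); exists l.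
have [y hy] : exists y : J -> R -> R, forall p t, 0 <= t ->
    forall n, `|iter_ n p t - y p t| <= 2 * (C * expR (2 * K * t)) / 2 ^+ n.
  exists (fun p t => projT1 (cid (lim_ p t))) => p t; exact: (projT2 (cid (lim_ p t))).
have small (A e : R) : 0 <= A -> 0 < e -> exists n, A / 2 ^+ n < e.
  move=> A0 e0; exists (Num.bound (A / e)).
  rewrite ltr_pdivrMr ?exprn_gt0// -ltr_pdivrMl// mulrC.
  apply: (lt_le_trans (archi_boundP _)); first by rewrite divr_ge0 ?(ltW e0).
  by rewrite -natrX ler_nat; apply/ltnW/ltn_expl.
(* The error bound at time [t + 1] controls an iterate on a whole neighbourhood of [t], so the limit
   is continuous by the usual three-term split. *)
have cy p t : 0 <= t -> {for t, continuous (fun t => y p (Num.max 0 t))}.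
  move=> t0; apply/cvgrPdist_lt => e e0 /=.
  pose A := 2 * (C * expR (2 * K * (t + 1))).
  have A0 : 0 <= A by rewrite mulr_ge0//; apply: mulr_ge0 (C_ge0 p) _; exact: expR_ge0.
  have [n hn] := small A (e / 3) A0 (divr_gt0 e0 (ltr0n _ 3)).
  have hA s : 0 <= s -> s <= t + 1 -> `|iter_ n p s - y p s| < e / 3.
    move=> s0 st; apply: le_lt_trans hn; apply: (le_trans (hy p s s0 n)).
    rewrite ler_pM2r ?invr_gt0 ?exprn_gt0// /A ler_pM2l//.
    by rewrite ler_wpM2l ?(C_ge0 p)// ler_expR ler_pM2l// mulr_gt0.
  have cn := continuous_max0 (@cont_iter n p).
  have /cvgrPdist_lt/(_ (e / 3) (divr_gt0 e0 (ltr0n _ 3))) := cn t.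
  move=> hc; near=> s.
  have s1 : s < t + 1 by near: s; exists (1 : R) => //= u; rewrite /ball /= ltr_norml => /andP[? ?]; lra.
  have h1 : `|iter_ n p (Num.max 0 t) - iter_ n p (Num.max 0 s)| < e / 3 by near: s.
  have h2 := hA (Num.max 0 t).
  have h3 := hA (Num.max 0 s).
  have {}h2 : `|iter_ n p (Num.max 0 t) - y p (Num.max 0 t)| < e / 3.
    by apply: h2; rewrite ?le_max ?lexx// ge_max; apply/andP; split; lra.
  have {}h3 : `|iter_ n p (Num.max 0 s) - y p (Num.max 0 s)| < e / 3.
    by apply: h3; rewrite ?le_max ?lexx// ge_max; apply/andP; split; lra.
  move: h1 h2 h3; rewrite !ltr_norml => /andP[? ?] /andP[? ?] /andP[? ?].
  by apply/andP; split; lra.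
have cyT p : continuous (fun t => y p (Num.max 0 t)).
  have h := continuous_max0 (cy p).
  suff -> : (fun t => y p (Num.max 0 t)) = (fun t => y p (Num.max 0 (Num.max 0 t))) by [].
  by apply/funext => t; rewrite maxA maxxx.
pose ym p t := y p (Num.max 0 t).
have cym q t : 0 <= t -> {for t, continuous (ym q)} by move=> _; exact: cyT.
have ymE q t : 0 <= t -> ym q t = y q t by move=> t0; rewrite /ym (max_idPr t0).
have fix_ p t : 0 <= t -> step ym p t = y p t.
  move=> t0; apply/eqP; rewrite -subr_eq0 -normr_le0; apply/ler_addgt0Pr => e e0.
  (* The distances from [step ym] to iterate [n.+1] and from that iterate to [y] are each at most a
     quarter of [A / 2 ^+ n]. *)
  pose A := 4 * (C * expR (2 * K * t)).
  have A0 : 0 <= A by rewrite mulr_ge0//; apply: mulr_ge0 (C_ge0 p) _; exact: expR_ge0.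
  have [n hn] := small A e A0 e0.
  pose G : R -> R := step ym p - iter_ n.+1 p.
  pose g s := F s (ym ^~ s) p - F s (iter_ n ^~ s) p.
  have DG s : 0 <= s -> is_derive s 1 G (g s).
    move=> s0; have := D_iter n p s0; have := D_step p cym s0 => ? ?.
    exact: is_deriveB.
  have gh s : 0 <= s -> `|g s| <= 2 * K * (C / 2 ^+ n) * expR (2 * K * s).
    move=> s0; have := @lipF s (ym ^~ s) (iter_ n ^~ s) (2 * (C * expR (2 * K * s)) / 2 ^+ n) s0.
    move=> h; apply: (le_trans (h _ p)).
      by move=> q; rewrite ymE// distrC hy.
    rewrite le_eqVlt; apply/orP; left; apply/eqP.
    by field; rewrite expf_neq0// pnatr_eq0.
  have := derive_norm_le DG (D_exp _) gh t0.
  have -> : G 0 = 0 by rewrite /G !fctE iter0 /step primitive0 addr0 subrr.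
  rewrite subr0 /G !fctE => h.
  have h2 := hy p t t0 n.+1.
  rewrite add0r.
  have eA : A / 2 ^+ n = 4 * (C / 2 ^+ n * expR (2 * K * t)) by rewrite /A; field; rewrite expf_neq0// pnatr_eq0.
  have e2 : 2 * (C * expR (2 * K * t)) / 2 ^+ n.+1 = C / 2 ^+ n * expR (2 * K * t).
    by rewrite exprS; field; rewrite expf_neq0// pnatr_eq0.
  have h0 : 0 <= C / 2 ^+ n * expR (2 * K * 0).
    exact: Cexp_ge0.
  have h00 : 0 <= C / 2 ^+ n * expR (2 * K * t).
    exact: Cexp_ge0.
  rewrite e2 in h2; rewrite eA in hn.
  move: h h2; rewrite !ler_norml => /andP[? ?] /andP[? ?].
  by apply/andP; split; lra.
(* For negative times [y] is arbitrary. The witness [step ym] agrees with it for nonnegative times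
   and has a two-sided derivative at 0. *)
exists (step ym); split; first by move=> p; rewrite /step primitive0 addr0.
move=> p t t0; have := D_step p cym t0.
suff -> : ym ^~ t = (step ym)^~ t by [].
by apply/funext => q; rewrite fix_// ymE.
Unshelve. all: by end_near.
Qed.

End Picard.
End RealODE.

(** * Second order expansions *)

Section Expand2.
Context {R : realType}.
Implicit Types (f g : R -> R) (a b c d e r s t : R).

(** Peano form of the second order expansion at 0, so [c] is half the second derivative. It asks for
    no derivative away from 0 and is stable under sums, products and composition. *)
Definition expand2 f a b c := forall e, 0 < e ->
  exists2 d, 0 < d & forall t, `|t| < d -> `|f t - (a + b * t + c * t ^+ 2)| <= e * t ^+ 2.

Lemma expand2_eq f g a b c : (forall t, f t = g t) -> expand2 g a b c -> expand2 f a b c.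
Proof. by move=> fg; have -> : f = g by exact/funext. Qed.

Lemma expand2_cst a : expand2 (fun=> a) a 0 0.
Proof.
move=> e e0; exists 1 => // t _; rewrite !mul0r !addr0 subrr normr0.
by rewrite mulr_ge0 ?sqr_ge0 ?ltW.
Qed.

Lemma expand2_affine a b : expand2 (fun t => a + b * t) a b 0.
Proof.
move=> e e0; exists 1 => // t _; rewrite mul0r addr0 subrr normr0.
by rewrite mulr_ge0 ?sqr_ge0 ?ltW.
Qed.

Lemma expand2D f g a b c a' b' c' : expand2 f a b c -> expand2 g a' b' c' ->
  expand2 (fun t => f t + g t) (a + a') (b + b') (c + c').
Proof.
move=> hf hg e e0; have e2 : 0 < e / 2 by rewrite divr_gt0.
have [d1 d10 h1] := hf _ e2; have [d2 d20 h2] := hg _ e2.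
exists (Num.min d1 d2) => [|t]; first by rewrite lt_min d10 d20.
rewrite lt_min => /andP[/h1 {}h1 /h2 {}h2].
rewrite [X in `|X|](_ : _ = (f t - (a + b * t + c * t ^+ 2)) +
  (g t - (a' + b' * t + c' * t ^+ 2))); last by ring.
by apply: (le_trans (ler_normD _ _)); lra.
Qed.

Lemma expand2_bound f a b c : expand2 f a b c ->
  exists2 M, 0 < M & exists2 d, 0 < d & forall t, `|t| < d -> `|f t - a| <= M * `|t|.
Proof.
move=> hf; have [d d0 h] := hf 1 ltr01.
exists (`|b| + `|c| + 1); first by have := normr_ge0 b; have := normr_ge0 c; lra.
exists (Num.min d 1) => [|t]; first by rewrite lt_min d0 ltr01.
rewrite lt_min => /andP[/h {}h t1].
have -> : f t - a = (f t - (a + b * t + c * t ^+ 2)) + (b * t + c * t ^+ 2) by ring.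
apply: (le_trans (ler_normD _ _)); apply: (le_trans (lerD h (ler_normD _ _))).
rewrite (normrM b) (normrM c) normrX -(@real_normK _ t) ?num_real//.
have := normr_ge0 t; have := normr_ge0 b; have := normr_ge0 c => c0 b0 t0.
have tt : `|t| ^+ 2 <= `|t| by rewrite expr2 ler_piMr// ltW.
by nra.
Qed.

Lemma expand2M f g a b c a' b' c' : expand2 f a b c -> expand2 g a' b' c' ->
  expand2 (fun t => f t * g t) (a * a') (a * b' + b * a') (a * c' + b * b' + c * a').
Proof.
move=> hf hg e e0.
have [M M0 [d0 d00 hM]] := expand2_bound hf.
pose B := `|a| + M + 1.
have B0 : 0 < B by rewrite /B; have := normr_ge0 a; lra.
pose B' := `|a'| + `|b'| + `|c'| + 1.
have B'0 : 0 < B'.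
  by rewrite /B'; have := normr_ge0 a'; have := normr_ge0 b'; have := normr_ge0 c'; lra.
pose K := `|b * c'| + `|c * b'| + `|c * c'| + 1.
have K0 : 0 < K.
  by rewrite /K; have := normr_ge0 (b * c'); have := normr_ge0 (c * b');
    have := normr_ge0 (c * c'); lra.
have e1 : 0 < e / (4 * B') by rewrite divr_gt0 ?mulr_gt0.
have e2 : 0 < e / (4 * B) by rewrite divr_gt0 ?mulr_gt0.
have [d1 d10 h1] := hf _ e1; have [d2 d20 h2] := hg _ e2.
exists (Num.min (Num.min d0 1) (Num.min (Num.min d1 d2) (e / (4 * K)))) => [|t].
  by rewrite !lt_min d00 d10 d20 ltr01 divr_gt0 ?mulr_gt0.
rewrite !lt_min => /andP[/andP[/hM {}hM t1] /andP[/andP[/h1 {}h1 /h2 {}h2] tK]].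
set pf := a + b * t + c * t ^+ 2; set pg := a' + b' * t + c' * t ^+ 2.
(* Each remainder is multiplied by a bounded factor, and the product of the two polynomials differs
   from the claimed one by a multiple of [t ^+ 3]. Each of the three pieces is kept below a quarter
   of [e * t ^+ 2]. *)
rewrite [X in `|X|](_ : _ = f t * (g t - pg) + (f t - pf) * pg +
  t * ((b * c' + c * b') + c * c' * t) * t ^+ 2); last by rewrite /pf /pg; ring.
have t0 := normr_ge0 t.
have nf : `|f t| <= B.
  have -> : f t = (f t - a) + a by ring.
  by apply: (le_trans (ler_normD _ _)); rewrite /B; nra.
have npg : `|pg| <= B'.
  apply: (le_trans (ler_normD _ _)); apply: (le_trans (lerD (ler_normD _ _) (lexx _))).
  rewrite (normrM b') (normrM c') normrX /B' expr2.
  have := normr_ge0 b'; have := normr_ge0 c' => c0 b0.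
  have : `|t| * `|t| <= 1 by nra.
  nra.
have t2 : 0 <= t ^+ 2 by exact: sqr_ge0.
have T1 : `|f t * (g t - pg)| <= e / 4 * t ^+ 2.
  rewrite normrM; apply: (le_trans (ler_pM (normr_ge0 _) (normr_ge0 _) nf h2)).
  by rewrite le_eqVlt; apply/orP; left; apply/eqP; field; rewrite gt_eqF.
have T2 : `|(f t - pf) * pg| <= e / 4 * t ^+ 2.
  rewrite normrM; apply: (le_trans (ler_pM (normr_ge0 _) (normr_ge0 _) h1 npg)).
  by rewrite le_eqVlt; apply/orP; left; apply/eqP; field; rewrite gt_eqF.
have T3 : `|t * ((b * c' + c * b') + c * c' * t) * t ^+ 2| <= e / 4 * t ^+ 2.
  rewrite normrM [`|t ^+ 2|]ger0_norm// ler_wpM2r// normrM.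
  have nK : `|(b * c' + c * b') + c * c' * t| <= K.
    apply: (le_trans (ler_normD _ _)); apply: (le_trans (lerD (ler_normD _ _) (lexx _))).
    by rewrite [`|_ * t|]normrM /K; have := normr_ge0 (c * c'); nra.
  apply: (le_trans (ler_pM (normr_ge0 _) (normr_ge0 _) (ltW tK) nK)).
  by rewrite le_eqVlt; apply/orP; left; apply/eqP; field; rewrite gt_eqF.
apply: (le_trans (ler_normD _ _)); apply: (le_trans (lerD (ler_normD _ _) (lexx _))).
by have : 0 <= e * t ^+ 2 by [rewrite mulr_ge0// ltW]; lra.
Qed.

Lemma expand2Z f k a b c : expand2 f a b c ->
  expand2 (fun t => k * f t) (k * a) (k * b) (k * c).
Proof.
move=> hf; have := expand2M (expand2_cst k) hf.
by rewrite !mul0r !addr0.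
Qed.

(** The quadratic polynomial in the increment [g t - a] is treated by the sum and product rules; the
    remainder of [F] stays negligible because that increment is [O(t)]. *)
Lemma expand2_comp (F : R -> R) g a b c F0 F1 F2 : expand2 g a b c ->
  expand2 (fun s => F (a + s)) F0 F1 F2 ->
  expand2 (fun t => F (g t)) F0 (F1 * b) (F1 * c + F2 * b ^+ 2).
Proof.
move=> hg hF.
have hs : expand2 (fun t => g t - a) 0 b c.
  have := expand2D hg (expand2_cst (- a)).
  by rewrite subrr !addr0.
have hss := expand2M hs hs.
have hp := expand2D (expand2D (expand2_cst F0) (expand2Z F1 hs)) (expand2Z F2 hss).
move=> e e0.
have [M M0 [d0 d00 hM]] := expand2_bound hg.
have eM : 0 < e / (2 * M ^+ 2) by rewrite divr_gt0// mulr_gt0// exprn_gt0.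
have [d1 d10 h1] := hF _ eM.
have [d2 d20 h2] := hp _ (divr_gt0 e0 (ltr0n _ 2)).
exists (Num.min d0 (Num.min d2 (d1 / M))) => [|t].
  by rewrite !lt_min d00 d20 divr_gt0.
rewrite !lt_min => /andP[/hM {}hM /andP[/h2 {}h2 td]].
have sd : `|g t - a| < d1.
  by apply: (le_lt_trans hM); rewrite mulrC -ltr_pdivlMr.
have := h1 _ sd; rewrite subrKC => {}h1.
set A := F (g t) - _ in h1; set B := _ - _ in h2.
rewrite [X in `|X|](_ : _ = A + B); last by rewrite /A /B; ring.
apply: (le_trans (ler_normD _ _)); apply: (le_trans (lerD h1 h2)).
have sM : (g t - a) ^+ 2 <= M ^+ 2 * t ^+ 2.
  rewrite -(@real_normK _ (g t - a)) ?num_real// -(@real_normK _ t) ?num_real// -exprMn.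
  by rewrite ler_pXn2r ?nnegrE ?mulr_ge0 ?normr_ge0 ?(ltW M0).
have : e / (2 * M ^+ 2) * (g t - a) ^+ 2 <= e / (2 * M ^+ 2) * (M ^+ 2 * t ^+ 2).
  by rewrite ler_pM2l.
have -> : e / (2 * M ^+ 2) * (M ^+ 2 * t ^+ 2) = e / 2 * t ^+ 2 by field; rewrite gt_eqF.
lra.
Qed.

(** The error [G] has derivative bounded by [e * |t|] between 0 and [t], so the mean value theorem
    bounds it by [e * t ^+ 2]. *)
Lemma expand2_derive f (df : R -> R) c r : 0 < r ->
  (forall t, `|t| < r -> is_derive t 1 f (df t)) -> is_derive (0 : R) 1 df c ->
  expand2 f (f 0) (df 0) (c / 2).
Proof.
move=> r0 Df D2 e e0.
have [d d0 hd] : exists2 d, 0 < d & forall t, `|t| < d -> `|df t - df 0 - c * t| <= e * `|t|.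
  have [D2a D2b] := D2.
  have /cvgrPdist_le := D2a.
  move=> /(_ e e0) /=; rewrite -[lim _]/('D_1 df 0) D2b => -[d /= d0 hd].
  exists d => // t td; have [->|tn0] := eqVneq t 0.
    by rewrite subrr sub0r mulr0 oppr0 normr0 mulr0.
  have := hd t; rewrite /ball/= sub0r normrN => /(_ td tn0).
  rewrite addr0 -[t%:A]/(t * 1) mulr1 -[_ *: _]/(t^-1 * (df (t) - df 0)).
  have -> : df t - df 0 - c * t = - (c - t^-1 * (df t - df 0)) * t by field.
  by rewrite normrM normrN => h; rewrite ler_wpM2r.
exists (Num.min d r) => [|t]; first by rewrite lt_min d0 r0.
rewrite lt_min => /andP[td tr].
pose G s := f s - (f 0 + df 0 * s + c / 2 * s ^+ 2).
have G0 : G 0 = 0 by rewrite /G expr0n/= !mulr0 !addr0 subrr.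
have DG s : `|s| < r -> is_derive s 1 G (df s - df 0 - c * s).
  move=> sr; have := Df s sr => ?.
  have -> : G = f - (cst (f 0) + (df 0 \*: (id : R -> R)) + (c / 2 \*: ((id : R -> R) ^+ 2))).
    by apply/funext => u; rewrite !fctE.
  apply: is_derive_eq.
  rewrite -[_ *: (1 : R)]/(_ * _) /=.
  rewrite -[X in _ - (_ + _ + X)]/(c / 2 * (2%:R * s ^+ 1 * 1)) expr1; lra.
have Gb s : `|s| <= `|t| -> `|df s - df 0 - c * s| <= e * `|t|.
  move=> st; apply: (le_trans (hd _ (le_lt_trans st td))).
  by rewrite ler_wpM2l ?(ltW e0).
have cG (u v : R) : `|u| <= `|t| -> `|v| <= `|t| -> {within `[u, v], continuous G}.
  move=> ut vt; apply: continuous_in_subspaceT => s; rewrite inE/= in_itv/= => /andP[us sv].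
  have sr : `|s| < r.
    apply: le_lt_trans tr; move: ut vt; rewrite !ler_norml => /andP[? ?] /andP[? ?].
    by apply/andP; split; lra.
  have [dG _] := DG s sr.
  by apply: differentiable_continuous; apply/derivable1_diffP.
suff : `|G t| <= e * `|t| * `|t| by rewrite -mulrA -expr2 real_normK ?num_real.
have [t0|t0] := leP 0 t.
  have [||s + E] := @MVT_segment _ G (fun s => df s - df 0 - c * s) 0 t t0.
  - move=> s; rewrite in_itv/= => /andP[s0 st]; apply: DG.
    by apply: le_lt_trans tr; rewrite (ger0_norm t0) (gtr0_norm s0) ltW.
  - by apply: cG => //; rewrite normr0.
  rewrite in_itv/= => /andP[s0 st].
  rewrite G0 !subr0 in E; rewrite E normrM ler_wpM2r// Gb//.
  by rewrite (ger0_norm t0) (ger0_norm s0).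
have [||s + E] := @MVT_segment _ G (fun s => df s - df 0 - c * s) t 0 (ltW t0).
- move=> s; rewrite in_itv/= => /andP[s0 st]; apply: DG.
  by apply: le_lt_trans tr; rewrite (ltr0_norm t0) (ltr0_norm st) lerN2 ltW.
- by apply: cG => //; rewrite normr0.
rewrite in_itv/= => /andP[s0 st].
rewrite G0 !sub0r in E; rewrite -normrN E normrM normrN ler_wpM2r// Gb//.
by rewrite (ltr0_norm t0) (ler0_norm st) lerN2.
Qed.

Lemma expand2_exp a : expand2 (fun s => expR (a + s)) (expR a) (expR a) (expR a / 2).
Proof.
have D x : is_derive x (1 : R) (fun s : R => expR (a + s)) (expR (a + x)).
  have h : is_derive x (1 : R) (fun s : R => a + s) (1 : R).
    have -> : (fun s : R => a + s) = cst a + (id : R -> R) by apply/funext.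
    by apply: is_derive_eq; rewrite add0r.
  have := @is_derive1_comp _ expR (fun s => a + s) x _ _ (is_derive_expR (a + x)) h.
  by rewrite mulr1.
have := @expand2_derive (fun s => expR (a + s)) (fun s => expR (a + s)) (expR (a + 0)) 1 ltr01 (fun t _ => D t) (D 0).
by rewrite addr0.
Qed.

Lemma expand2_ln a : 0 < a ->
  expand2 (fun s => ln (a + s)) (ln a) a^-1 (- a^-1 ^+ 2 / 2).
Proof.
move=> a0.
have h (x : R) : is_derive x (1 : R) (fun s : R => a + s) (1 : R).
  have -> : (fun s : R => a + s) = cst a + (id : R -> R) by apply/funext.
  by apply: is_derive_eq; rewrite add0r.
have D x : `|x| < a -> is_derive x (1 : R) (fun s : R => ln (a + s)) (a + x)^-1.
  rewrite ltr_norml => /andP[? ?]; have ax : 0 < a + x by lra.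
  have := @is_derive1_comp _ (@ln R) (fun s => a + s) x _ _ (is_derive1_ln ax) (h x).
  by rewrite mulr1.
have D2 : is_derive (0 : R) (1 : R) (fun s : R => (a + s)^-1) (- a^-1 ^+ 2).
  have a00 : a + 0 != 0 by rewrite addr0 gt_eqF.
  have := @is_deriveV _ (fun s => a + s) 0 1 _ a00 (h 0).
  rewrite addr0 => H; apply: (is_derive_eq H).
  by rewrite -[_ *: _]/(_ * _) mulr1 exprVn.
have := @expand2_derive _ _ _ a a0 D D2.
by rewrite addr0.
Qed.

(** Adding the inequalities at [t] and [- t] cancels the linear term and gives the sign of [c]. Then
    a short enough step in either direction forces the slope to vanish. *)
Lemma expand2_max f a b c : expand2 f a b c ->
  (exists2 d, 0 < d & forall t, `|t| < d -> f t <= a) -> b = 0 /\ c <= 0.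
Proof.
move=> hf [d0 d00 hmax].
have small e : 0 < e -> exists2 d, 0 < d & forall t, `|t| < d ->
    b * t + c * t ^+ 2 <= e * t ^+ 2.
  move=> e0; have [d d1 h] := hf _ e0; exists (Num.min d d0) => [|t].
    by rewrite lt_min d1.
  rewrite lt_min => /andP[/h + /hmax]; rewrite ler_norml => /andP[? ?] ?; lra.
have c0 : c <= 0.
  apply/ler_addgt0Pr => e e0; rewrite add0r.
  have [d d1 h] := small _ e0; pose t := d / 2.
  have t0 : 0 < t by rewrite divr_gt0.
  have td : `|t| < d by rewrite gtr0_norm// /t; lra.
  have := h _ td; have := h (- t); rewrite normrN => /(_ td); rewrite sqrrN => h1 h2.
  by rewrite -(ler_pM2r (exprn_gt0 2 t0)); lra.
have [d d1 h] := small _ ltr01.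
have key s : s * s = 1 -> s * b <= 0.
  move=> ss; apply/ler_addgt0Pr => e e0; rewrite add0r.
  pose K := 1 - c; have K0 : 0 < K by rewrite /K; lra.
  pose t := Num.min (d / 2) (e / K).
  have t0 : 0 < t by rewrite lt_min !divr_gt0.
  have td : t <= d / 2 by rewrite ge_min lexx.
  have te : t * K <= e by rewrite -ler_pdivlMr// ge_min lexx orbT.
  have ns : `|s| = 1.
    have : `|s| ^+ 2 = 1 by rewrite real_normK ?num_real.
    by move/eqP; rewrite sqrf_eq1 => /orP[/eqP//|/eqP]; have := normr_ge0 s; lra.
  have std : `|s * t| < d by rewrite normrM ns mul1r gtr0_norm//; lra.
  have := h _ std; rewrite exprMn expr2 ss mul1r => h1.
  have : s * b * t <= t * K * t by rewrite /K; lra.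
  by rewrite ler_pM2r// => ?; lra.
split=> //; have := key 1; have := key (-1).
by rewrite mulrNN mulr1 mulN1r mul1r => /(_ erefl) ? /(_ erefl) ?; lra.
Qed.

(** The hypothesis is a cubic remainder estimate in squared form, the shape in which [holo2]
    provides it. *)
Lemma expand2_cubic f a b c K :
  (forall t, `|t| <= 1 -> (f t - (a + b * t + c * t ^+ 2)) ^+ 2 <= K * (t ^+ 2) ^+ 3) ->
  expand2 f a b c.
Proof.
move=> h e e0; pose M := `|K| + 1.
have M0 : 0 < M by rewrite /M; have := normr_ge0 K; lra.
exists (Num.min 1 (e / M)) => [|t]; first by rewrite lt_min ltr01 divr_gt0.
rewrite lt_min => /andP[t1 te].
have et : 0 <= e * t ^+ 2 by exact: mulr_ge0 (ltW e0) (sqr_ge0 _).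
rewrite -(@ler_pXn2r _ 2)// ?nnegrE//.
rewrite real_normK ?num_real//; apply: (le_trans (h _ (ltW t1))).
rewrite [(e * _) ^+ 2]exprMn [(t ^+ 2) ^+ 3]exprS mulrA ler_wpM2r ?(exprn_ge0 _ (sqr_ge0 _))//.
rewrite -(@real_normK _ t) ?num_real//.
have tM : `|t| * M <= e by rewrite -ler_pdivlMr// ltW.
have KM : K <= M ^+ 2.
  have : K <= `|K| by exact: ler_norm.
  have := normr_ge0 K; rewrite /M; nra.
apply: (@le_trans _ _ (M ^+ 2 * `|t| ^+ 2)); first by rewrite ler_wpM2r ?sqr_ge0.
by rewrite mulrC -exprMn ler_pXn2r ?nnegrE ?mulr_ge0 ?normr_ge0 ?(ltW M0) ?(ltW e0).
Qed.

End Expand2.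

(** * The maximum principle *)

Section MaxPrinciple.
Context {R : realType}.
Implicit Types (f : C R -> C R) (P : R -> R -> R) (D : set (R * R)).

(** The bound [K * nsq w ^+ 3] is a remainder [O(|w|^3)] in squared form. This serves as the notion
    of an entire function: it is what Gronwall estimates give for a linear system depending on [z],
    and it suffices for the maximum principle. *)
Definition holo2 f := forall z, exists a1 a2 (K : R), forall w, nsq w <= 1 ->
  nsq (f (z + w) - (f z + a1 * w + a2 * w ^+ 2)) <= K * nsq w ^+ 3.

Lemma holo2_lip f z : holo2 f ->
  exists2 K : R, 0 < K & forall w, nsq w <= 1 -> nsq (f (z + w) - f z) <= K * nsq w.
Proof.
move=> /(_ z)[a1 [a2 [K h]]].
pose L := 2 * `|K| + 4 * nsq a1 + 4 * nsq a2 + 1.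
have L0 : 0 < L.
  by rewrite /L; have := normr_ge0 K; have := nsq_ge0 a1; have := nsq_ge0 a2; lra.
exists L => // w w1.
have -> : f (z + w) - f z = (f (z + w) - (f z + a1 * w + a2 * w ^+ 2)) +
    (a1 * w + a2 * w ^+ 2) by ring.
apply: (le_trans (nsqD_le _ _)).
have h1 := h _ w1; have h2 := nsqD_le (a1 * w) (a2 * w ^+ 2).
rewrite (nsqM a1) (nsqM a2) nsqX in h2; have w0 := nsq_ge0 w.
have w2 : nsq w ^+ 2 <= nsq w by rewrite expr2 ler_piMr.
have w3 : nsq w ^+ 3 <= nsq w by rewrite exprS ler_piMr// expr2; nra.
have w30 : 0 <= nsq w ^+ 3 by rewrite exprn_ge0.
have hK : K * nsq w ^+ 3 <= `|K| * nsq w.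
  by have := ler_norm K; have := normr_ge0 K; nra.
have := nsq_ge0 a1; have := nsq_ge0 a2; rewrite /L; nra.
Qed.

Lemma holo2_continuous f (p : R * R) : holo2 f ->
  {for p, continuous (fun q : R * R => nsq (f (Complex q.1 q.2)))}.
Proof.
move=> hf.
have key (g : C R -> R) : (forall z w, (g z - g w) ^+ 2 <= nsq (z - w)) ->
    {for p, continuous (fun q : R * R => g (f (Complex q.1 q.2)))}.
  move=> hg; apply/cvgrPdist_lt => e e0.
  have [K K0 h] := holo2_lip (Complex p.1 p.2) hf.
  pose d := Num.min (1 / 2) (e ^+ 2 / (4 * K)).
  have d0 : 0 < d by rewrite lt_min !divr_gt0 ?exprn_gt0 ?mulr_gt0.
  near=> q.
  pose w : C R := Complex (q.1 - p.1) (q.2 - p.2).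
  have qE : (Complex q.1 q.2 : C R) = Complex p.1 p.2 + w.
    by apply: ReIm_inj; rewrite !ReIm /=; ring.
  have d1 : `|p.1 - q.1| < d.
    near: q; apply: (@cvg_fst _ _ (nbhs p.1) (nbhs p.2) _ (fun x => `|p.1 - x| < d)).
    by exists d.
  have d2 : `|p.2 - q.2| < d.
    near: q; apply: (@cvg_snd _ _ (nbhs p.1) (nbhs p.2) _ (fun x => `|p.2 - x| < d)).
    by exists d.
  have dle1 : d <= 1 / 2 by rewrite ge_min lexx.
  have dle2 : d <= e ^+ 2 / (4 * K) by rewrite ge_min lexx orbT.
  have wd : nsq w <= 2 * d ^+ 2.
    rewrite /nsq /w /= -(sqrrN (q.1 - _)) -(sqrrN (q.2 - _)) !opprB.
    rewrite -(@real_normK _ (p.1 - q.1)) ?num_real// -(@real_normK _ (p.2 - q.2)) ?num_real//.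
    by have := normr_ge0 (p.1 - q.1); have := normr_ge0 (p.2 - q.2); nra.
  have w1 : nsq w <= 1 by nra.
  have h1 := h _ w1.
  rewrite -(@ltr_pXn2r _ 2)// ?nnegrE ?(ltW e0)// real_normK ?num_real//.
  rewrite qE -sqrrN opprB; apply: (le_lt_trans (hg _ _)); apply: (le_lt_trans h1).
  have dK : d * (4 * K) <= e ^+ 2 by rewrite -ler_pdivlMr// mulr_gt0.
  have dd : K * (2 * d ^+ 2) <= K * d by rewrite ler_pM2l//; nra.
  have Kd : 0 < K * d by rewrite mulr_gt0.
  have : K * nsq w <= K * (2 * d ^+ 2) by rewrite ler_pM2l.
  lra.
have cR := key (@complex.Re R); have cI := key (@complex.Im R).
have {}cR : {for p, continuous (fun q : R * R => complex.Re (f (Complex q.1 q.2)))}.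
  apply: cR => z w; rewrite -ReN -ReD /nsq lerDl; exact: sqr_ge0.
have {}cI : {for p, continuous (fun q : R * R => complex.Im (f (Complex q.1 q.2)))}.
  apply: cI => z w; rewrite -ImN -ImD /nsq lerDr; exact: sqr_ge0.
by apply: cvgD; rewrite expr2; exact: cvgM.
Unshelve. all: by end_near.
Qed.

(** Since [pxx] and [pyy] are halves of second derivatives, the inequality reads $P\,\Delta
    P<|\nabla P|^2$, that is $\Delta\log P<0$ where [P] is positive. *)
Definition log_superharmonic_at P (x y : R) := exists px pxx py pyy : R,
  [/\ expand2 (fun t => P (x + t) y) (P x y) px pxx,
      expand2 (fun t => P x (y + t)) (P x y) py pyy &
      P x y * (2 * (pxx + pyy)) < px ^+ 2 + py ^+ 2].

(** Expansion of $|f|^2$ along the direction [w0]. Only [w0 = 1] and [w0 = 'i] are used: their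
    squares are opposite, so the [a2] terms cancel in the sum, leaving $\Delta|f|^2=4|a_1|^2$. *)
Lemma nsq_expand f z : holo2 f ->
  exists a1 a2 : C R, forall w0, nsq w0 = 1 ->
  expand2 (fun t : R => nsq (f (z + Complex t 0 * w0))) (nsq (f z))
    (2 * complex.Re (Num.conj (f z) * (a1 * w0)))
    (nsq a1 + 2 * complex.Re (Num.conj (f z) * (a2 * w0 ^+ 2))).
Proof.
move=> /(_ z)[a1 [a2 [K h]]]; exists a1, a2 => w0 w01.
have E (t : R) : `|t| <= 1 ->
    nsq (f (z + Complex t 0 * w0) - (f z + a1 * w0 * Complex t 0 + a2 * w0 ^+ 2 * Complex (t ^+ 2) 0))
    <= K * (t ^+ 2) ^+ 3.
  move=> t1; pose w : C R := Complex t 0 * w0.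
  have wE : nsq w = t ^+ 2.
    by rewrite /w nsqM w01 mulr1 /nsq /= expr0n addr0.
  have w1 : nsq w <= 1.
    rewrite wE -(@real_normK _ t) ?num_real//.
    by have := normr_ge0 t; nra.
  have := h w w1; rewrite wE; congr (nsq (_ - _) <= _).
  rewrite /w; apply: ReIm_inj; rewrite !(ReIm, expr2) /=; ring.
have hR : expand2 (fun t : R => complex.Re (f (z + Complex t 0 * w0)))
    (complex.Re (f z)) (complex.Re (a1 * w0)) (complex.Re (a2 * w0 ^+ 2)).
  apply: (@expand2_cubic _ _ _ _ _ K) => t /E; apply: le_trans.
  set u := f _; rewrite /nsq [X in _ <= X + _](_ : _ = (complex.Re u -
    (complex.Re (f z) + complex.Re (a1 * w0) * t + complex.Re (a2 * w0 ^+ 2) * t ^+ 2)) ^+ 2).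
    by rewrite lerDl sqr_ge0.
  by rewrite !(ReIm, expr2)/=; ring.
have hI : expand2 (fun t : R => complex.Im (f (z + Complex t 0 * w0)))
    (complex.Im (f z)) (complex.Im (a1 * w0)) (complex.Im (a2 * w0 ^+ 2)).
  apply: (@expand2_cubic _ _ _ _ _ K) => t /E; apply: le_trans.
  set u := f _; rewrite /nsq [X in _ <= _ + X](_ : _ = (complex.Im u -
    (complex.Im (f z) + complex.Im (a1 * w0) * t + complex.Im (a2 * w0 ^+ 2) * t ^+ 2)) ^+ 2).
    by rewrite lerDr sqr_ge0.
  by rewrite !(ReIm, expr2)/=; ring.
have := expand2D (expand2M hR hR) (expand2M hI hI).
have -> : complex.Re (f z) * complex.Re (f z) + complex.Im (f z) * complex.Im (f z) = nsq (f z).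
  by rewrite /nsq !expr2.
set b := (X in expand2 _ _ X _); set c := (X in expand2 _ _ _ X) => H.
have -> : 2 * complex.Re (Num.conj (f z) * (a1 * w0)) = b by rewrite /b !ReIm; ring.
have -> : nsq a1 + 2 * complex.Re (Num.conj (f z) * (a2 * w0 ^+ 2)) = c.
  have -> : nsq a1 = nsq (a1 * w0) by rewrite nsqM w01 mulr1.
  rewrite /c /nsq; move: (a1 * w0) (a2 * w0 ^+ 2) => u v.
  by rewrite !ReIm; ring.
by apply: expand2_eq H => t; rewrite /nsq !expr2.
Qed.

(* At an interior maximum of [(|f|^2 + d) / P], with value [A], both second
   derivatives of [|f|^2 + d - A P] are nonpositive; as [|f|^2 + d] is
   log-subharmonic this contradicts the strict log-superharmonicity of [P]. *)
Lemma max_principle f P D (d : R) : holo2 f -> 0 < d -> compact D ->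
  (forall p, D p -> {for p, continuous (fun q : R * R => P q.1 q.2)}) ->
  (forall p, D p -> 0 < P p.1 p.2) ->
  (forall p, D p -> nsq (f (Complex p.1 p.2)) + d <= P p.1 p.2 \/
     (log_superharmonic_at P p.1 p.2 /\
      exists2 e : R, 0 < e & forall t : R, `|t| < e ->
        D (p.1 + t, p.2) /\ D (p.1, p.2 + t))) ->
  forall p, D p -> nsq (f (Complex p.1 p.2)) + d <= P p.1 p.2.
Proof.
move=> hf d0 cD cP P0 hD p Dp.
pose G (q : R * R) := (nsq (f (Complex q.1 q.2)) + d) / P q.1 q.2.
have cG : {within D, continuous G}.
  apply: continuous_in_subspaceT => q; rewrite inE => Dq; apply: cvgM.
    by apply: cvgD; [exact: holo2_continuous | exact: cvg_cst].
  by apply: cvgV; [rewrite gt_eqF// P0 | exact: cP].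
have [|p0 + pmax] := compact_EVT_max _ cD cG; first by exists p.
rewrite inE => Dp0.
have {}pmax q : D q -> G q <= G p0 by move=> Dq; apply: pmax; rewrite inE.
suff G1 : G p0 <= 1.
  by have := le_trans (pmax _ Dp) G1; rewrite ler_pdivrMr ?P0// mul1r.
case: (hD _ Dp0) => [?|[[px [pxx [py [pyy [hx hy hP]]]]] [e e0 he]]].
  by rewrite ler_pdivrMr ?P0// mul1r.
rewrite leNgt; apply/negP => A1.
set A := G p0 in A1.
have Pp0 := P0 _ Dp0.
pose z : C R := Complex p0.1 p0.2.
have AP : A * P p0.1 p0.2 = nsq (f z) + d by rewrite /A divfK ?gt_eqF.
have n1 : nsq (1 : C R) = 1 by rewrite /nsq !ReIm; ring.
have ni : nsq ('i : C R) = 1 by rewrite /nsq !ReIm; ring.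
have [a1 [a2 hN]] := nsq_expand z hf.
have h1 := hN _ n1; have h2 := hN _ ni.
have Dle q : D q -> nsq (f (Complex q.1 q.2)) + d - A * P q.1 q.2 <= 0.
  by move=> Dq; have := pmax _ Dq; rewrite -/A /G ler_pdivrMr ?P0// => ?; lra.
have [ex ex2] : 2 * complex.Re (Num.conj (f z) * (a1 * 1)) + (- A) * px = 0 /\
    nsq a1 + 2 * complex.Re (Num.conj (f z) * (a2 * 1 ^+ 2)) + (- A) * pxx <= 0.
  apply: (expand2_max (expand2D h1 (expand2Z (- A) hx))).
  exists e => // t /he[Dt _]; have := Dle _ Dt => /=.
  have -> : (Complex (p0.1 + t) p0.2 : C R) = z + Complex t 0 * 1.
    by apply: ReIm_inj; rewrite !ReIm /=; ring.
  by lra.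
have [ey ey2] : 2 * complex.Re (Num.conj (f z) * (a1 * 'i)) + (- A) * py = 0 /\
    nsq a1 + 2 * complex.Re (Num.conj (f z) * (a2 * 'i ^+ 2)) + (- A) * pyy <= 0.
  apply: (expand2_max (expand2D h2 (expand2Z (- A) hy))).
  exists e => // t /he[_ Dt]; have := Dle _ Dt => /=.
  have -> : (Complex p0.1 (p0.2 + t) : C R) = z + Complex t 0 * 'i.
    by apply: ReIm_inj; rewrite !ReIm /=; ring.
  by lra.
have A0 : 0 < A by lra.
(* Sum of the two second order conditions; the [a2] contributions cancel because ['i ^+ 2 = -1]. *)
have S2 : 2 * nsq a1 <= A * (pxx + pyy).
  by move: ex2 ey2; rewrite !(ReIm, expr2); lra.
have S1 : A ^+ 2 * (px ^+ 2 + py ^+ 2) = 4 * nsq (f z) * nsq a1.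
  have E1 : A * px = 2 * complex.Re (Num.conj (f z) * (a1 * 1)) by lra.
  have E2 : A * py = 2 * complex.Re (Num.conj (f z) * (a1 * 'i)) by lra.
  by rewrite mulrDr -!exprMn E1 E2 /nsq !ReIm; ring.
(* Strict log-superharmonicity scaled by [A ^+ 2]. With [S1] its right side becomes
   [4 * nsq (f z) * nsq a1], while [S2] makes its left side at least [4 * (nsq (f z) + d) * nsq a1]:
   a contradiction. *)
have : A ^+ 2 * (P p0.1 p0.2 * (2 * (pxx + pyy))) < A ^+ 2 * (px ^+ 2 + py ^+ 2).
  by rewrite ltr_pM2l ?exprn_gt0.
rewrite S1 expr2.
have -> : A * A * (P p0.1 p0.2 * (2 * (pxx + pyy))) =
    2 * (A * P p0.1 p0.2) * (A * (pxx + pyy)) by ring.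
rewrite AP => F1.
have N0 := nsq_ge0 (f z); have a10 := nsq_ge0 a1.
by have : 2 * (nsq (f z) + d) * (2 * nsq a1) <= 2 * (nsq (f z) + d) * (A * (pxx + pyy));
  [rewrite ler_wpM2l//; lra | nra].
Qed.

End MaxPrinciple.

(** * The Phragmen-Lindelof and Liouville theorems *)

Section PhragmenLindelof.
Context {R : realType}.
Implicit Types (f : C R -> C R).

Lemma compact_box_subset (D : set (R * R)) (B : R) : closed D ->
  (forall p, D p -> `|p.1| <= B /\ `|p.2| <= B) -> compact D.
Proof.
move=> clD hD.
have cB : compact (`[- B, B]%classic `*` `[- B, B]%classic : set (R * R)).
  by apply: compact_setX; exact: segment_compact.
apply: subclosed_compact clD cB _ => p /hD[].
by rewrite !ler_norml => ? ?; split; rewrite /= in_itv.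
Qed.

Lemma closed_le0 (g : R * R -> R) : continuous g -> closed [set p | 0 <= g p].
Proof.
move=> cg.
have -> : [set p | 0 <= g p] = g @^-1` [set x | 0 <= x] by [].
by apply: closed_comp => [p _|]; [exact: cg | exact: closed_ge].
Qed.

Lemma continuous_affine2 (a b c : R) : continuous (fun p : R * R => a * p.1 + b * p.2 + c).
Proof.
move=> p; apply: cvgD; last exact: cvg_cst.
by apply: cvgD; apply: cvgM; try exact: cvg_cst; [exact: cvg_fst | exact: cvg_snd].
Qed.

Section Barrier.
Variables (A0 eps s : R).

(** The barrier along a coordinate line, on which its two linear forms have slopes [al] and [be];
    [l1] and [l2] are the first and second order coefficients of the sum of their logarithms. The
    pairs needed are [(0, sg)] and [(1, - c')]. *)
Lemma barrier_expand (y k al be : R) : 0 < y -> 0 < k ->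
  let H := expR (s * (ln y + ln k)) in let Q := A0 * expR (eps * H) in
  let l1 := al / y + be / k in let l2 := - ((al / y) ^+ 2 + (be / k) ^+ 2) / 2 in
  expand2 (fun t => A0 * expR (eps * expR (s * (ln (y + al * t) + ln (k + be * t)))))
    Q (Q * (eps * H * s * l1))
    (Q * (eps * H * (s * l2 + s ^+ 2 * l1 ^+ 2 / 2) + (eps * H * s * l1) ^+ 2 / 2)).
Proof.
move=> y0 k0 H Q l1 l2.
have hy := expand2_comp (expand2_affine y al) (expand2_ln y0).
have hk := expand2_comp (expand2_affine k be) (expand2_ln k0).
have hL := expand2Z s (expand2D hy hk).
have hH := expand2_comp hL (expand2_exp _).
have hE := expand2Z A0 (expand2_comp (expand2Z eps hH) (expand2_exp _)).
move: hE; rewrite -/H -/Q.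
set b := (X in expand2 _ _ X _); set c := (X in expand2 _ _ _ X) => hE.
have -> : Q * (eps * H * s * l1) = b.
  by rewrite /b /Q /l1; field; rewrite !gt_eqF.
have -> : Q * (eps * H * (s * l2 + s ^+ 2 * l1 ^+ 2 / 2) + (eps * H * s * l1) ^+ 2 / 2) = c.
  by rewrite /c /Q /l1 /l2; field; rewrite !gt_eqF.
exact: hE.
Qed.

End Barrier.

(** With [a] and [b] the inverses of the two linear forms, this is $\Delta h<0$ for $h=e^{sL}$: the
    left side is $s|\nabla L|^2$ and the right side is $-\Delta L$. At [s = 1 / 2] the form is still
    definite, with room for the small excess [tau]. *)
Lemma sector_quadratic_form (c a b : R) : 0 < a -> 0 < b ->
  let s := 1 / 2 + (8 * (1 + c ^+ 2))^-1 in
  s * (b ^+ 2 + (a - c * b) ^+ 2) < b ^+ 2 + a ^+ 2 + c ^+ 2 * b ^+ 2.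
Proof.
move=> a0 b0 /=; set tau := (8 * (1 + c ^+ 2))^-1.
have c2 : 0 <= c ^+ 2 := sqr_ge0 c.
have k0 : 0 < 8 * (1 + c ^+ 2) by lra.
have t0 : 0 < tau by rewrite invr_gt0.
have tE : tau * (8 * (1 + c ^+ 2)) = 1 by rewrite mulVf// gt_eqF.
have t8 : tau <= 8^-1 by rewrite lef_pV2 ?posrE//; lra.
have u0 : 0 < 1 / 2 - tau by lra.
(* Multiplying by [1 / 2 - tau], the coefficient of [a ^+ 2], completes the square; the value of
   [tau] makes the leftover coefficient of [b ^+ 2] equal to [tau + tau ^+ 2]. *)
rewrite -subr_gt0 -(pmulr_rgt0 _ u0).
set L := (X in 0 < X).
have -> : L = ((1 / 2 - tau) * a + (1 / 2 + tau) * c * b) ^+ 2 + b ^+ 2 * (tau + tau ^+ 2) +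
    b ^+ 2 * (1 - tau * (8 * (1 + c ^+ 2))) / 4.
  by rewrite /L; field.
rewrite tE subrr mulr0 mul0r addr0.
apply: ltr_wpDl; first exact: sqr_ge0.
by rewrite mulr_gt0 ?exprn_gt0// addr_gt0 ?exprn_gt0.
Qed.

(* The barrier is [exp (eps h)] with [h = ((Y + 1) (q + 1))^s] and
   [q = sg X - (c - 1) Y], on the triangle [0 <= Y <= q <= k - 1]. The exponent
   [s > 1 / 2] is close enough to [1 / 2] for [h] to be superharmonic
   (sector_quadratic_form), while its order [2 s > 1] makes [eps h] dominate
   [a Y] on the side [q = k - 1]. *)
Lemma phragmen_lindelof f (c sg a M : R) : sg * sg = 1 -> holo2 f -> 0 <= a ->
  (forall X Y, 0 <= Y -> nsq (f (Complex X Y)) <= M * expR (a * Y)) ->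
  (forall Y, 0 <= Y -> nsq (f (Complex (sg * (c * Y)) Y)) <= M) ->
  forall X Y, 0 <= Y -> c * Y <= sg * X -> nsq (f (Complex X Y)) <= M.
Proof.
move=> sg2 hf a0 hM hray X Y Y0 XY.
have M0 : 0 <= M.
  by have := hM 0 0 (lexx 0); rewrite mulr0 expR0 mulr1; exact: le_trans (nsq_ge0 _).
(* Lowering the slope by 1 turns the ray into the line [q = Y]. Hence [0 <= Y <= q] in the sector,
   and cutting at a level of [q] alone yields a bounded region. *)
pose c' := c - 1; pose s := 1 / 2 + (8 * (1 + c' ^+ 2))^-1.
have c2 : 0 <= c' ^+ 2 := sqr_ge0 c'.
have s12 : 1 / 2 < s by rewrite ltrDl invr_gt0; lra.
have s1 : s <= 1.
  have : (8 * (1 + c' ^+ 2))^-1 <= 8^-1 by rewrite lef_pV2 ?posrE//; lra.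
  by rewrite /s; lra.
pose q (p : R * R) := sg * p.1 - c' * p.2.
pose L (p : R * R) := ln (p.2 + 1) + ln (q p + 1).
suff main (d eps : R) : 0 < d -> 0 < eps ->
    nsq (f (Complex X Y)) + d <= (M + d) * expR (eps * expR (s * L (X, Y))).
  apply/ler_addgt0Pr => d d0.
  suff H : nsq (f (Complex X Y)) + d <= M + d by lra.
  have Md : 0 < M + d by lra.
  apply/ler_addgt0Pr => r r0; pose E := expR (s * L (X, Y)).
  have E0 : 0 < E by exact: expR_gt0.
  have r1 : 1 < 1 + r / (M + d) by rewrite ltrDl divr_gt0.
  (* This choice of [eps] makes the barrier at [(X, Y)] equal to [M + d + r]. *)
  have := main d (ln (1 + r / (M + d)) / E) d0 (divr_gt0 (ln_gt0 r1) E0).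
  rewrite divfK ?gt_eqF// lnK ?posrE; last by lra.
  by rewrite mulrDr mulr1 mulrCA divff ?mulr1 ?gt_eqF.
move=> d0 eps0.
pose P x y := (M + d) * expR (eps * expR (s * L (x, y))).
(* The first entry keeps [(X, Y)] inside the triangle. The second gives $k^{2s-1}\ge
   a/\varepsilon+1$, so that the barrier beats [expR (a * Y)] on the far side. *)
pose k := Num.max (q (X, Y) + 1) (expR (ln (a / eps + 1) / (2 * s - 1))).
have qY p : q p - p.2 = sg * p.1 - c * p.2 by rewrite /q /c'; ring.
have q0 : 0 <= q (X, Y) by have := qY (X, Y) => /=; lra.
have k1 : q (X, Y) + 1 <= k by rewrite le_max lexx.
pose D := [set p : R * R | 0 <= p.2] `&` [set p | 0 <= q p - p.2] `&`
  [set p | 0 <= (k - 1) - q p].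
have cq : continuous q.
  have -> : q = (fun p => sg * p.1 + (- c') * p.2 + 0) by apply/funext => p; rewrite /q; ring.
  exact: continuous_affine2.
have clD : closed D.
  apply: closedI; [apply: closedI|]; apply: closed_le0.
  - by move=> p; exact: cvg_snd.
  - by move=> p; apply: cvgB; [exact: cq | exact: cvg_snd].
  - by move=> p; apply: cvgB; [exact: cvg_cst | exact: cq].
have cD : compact D.
  apply: (@compact_box_subset _ ((k - 1) * (1 + `|c'|))) => // p [[/= h1 h2] h3].
  have k10 : 0 <= k - 1 by lra.
  have nc := normr_ge0 c'.
  split; last by rewrite ger0_norm//; nra.
  have : `|sg| = 1.
    have : `|sg| ^+ 2 = 1 by rewrite real_normK ?num_real// expr2.
    by move/eqP; rewrite sqrf_eq1 => /orP[/eqP//|/eqP]; have := normr_ge0 sg; lra.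
  move=> nsg; rewrite -[`|p.1|]mul1r -nsg -normrM.
  have -> : sg * p.1 = q p + c' * p.2 by rewrite /q; ring.
  have q0p : 0 <= q p by lra.
  apply: (le_trans (ler_normD _ _)); rewrite normrM (ger0_norm q0p) (ger0_norm h1).
  by nra.
have Dpos p : D p -> 0 < p.2 + 1 /\ 0 < q p + 1.
  by move=> [[/= h1 h2] h3]; split; lra.
have Md : 0 < M + d by lra.
have Pge x y : M + d <= P x y.
  rewrite /P ler_peMr ?(ltW Md)// -expR0 ler_expR mulr_ge0 ?(ltW eps0)//; exact: expR_ge0.
have DXY : D (X, Y).
  have /= h := qY (X, Y).
  split; [split => //|].
    by rewrite /= h; lra.
  by rewrite /=; lra.
apply: (@max_principle _ f P D d hf d0 cD _ _ _ (X, Y) DXY).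
- move=> p Dp; have [p1 p2] := Dpos _ Dp.
  have cl (g : R * R -> R) : {for p, continuous g} -> 0 < g p ->
      {for p, continuous (fun p => ln (g p))}.
    by move=> cg gp; apply: continuous_comp => //; exact: continuous_ln.
  have ce (g : R * R -> R) : {for p, continuous g} -> {for p, continuous (fun p => expR (g p))}.
    by move=> cg; apply: continuous_comp => //; exact: continuous_expR.
  have cL : {for p, continuous L}.
    apply: cvgD; apply: cl => //.
      by apply: cvgD; [exact: cvg_snd | exact: cvg_cst].
    by apply: cvgD; [exact: cq | exact: cvg_cst].
  apply: cvgM; first exact: cvg_cst.
  apply: (ce); apply: cvgM; first exact: cvg_cst.
  apply: (ce); apply: cvgM; first exact: cvg_cst.
  by have -> : (fun q0 : R * R => L (q0.1, q0.2)) = L by apply/funext => -[].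
- by move=> p _; apply: lt_le_trans (Pge _ _).
move=> p Dp; have [p1 p2] := Dpos _ Dp; case: (Dp) => -[/= h1 h2] h3.
have [y0|y0] := eqVneq p.2 0.
  left; rewrite (le_trans _ (Pge _ _))// lerD2r.
  by have := hM p.1 p.2 h1; rewrite y0 mulr0 expR0 mulr1.
have [qy|qy] := eqVneq (q p - p.2) 0.
  left; rewrite (le_trans _ (Pge _ _))// lerD2r.
  suff -> : p.1 = sg * (c * p.2) by exact: hray.
  have : sg * p.1 = c * p.2 by have := qY p; lra.
  by move=> <-; rewrite mulrA sg2 mul1r.
have [qk|qk] := eqVneq ((k - 1) - q p) 0.
  left; apply: (@le_trans _ _ ((M + d) * expR (a * p.2))).
    rewrite mulrDl; apply: lerD; first exact: hM.
    by rewrite ler_peMr ?(ltW d0)// -expR0 ler_expR mulr_ge0.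
  rewrite /P ler_pM2l// ler_expR /L /=.
  have -> : q (p.1, p.2) = q p by case: (p).
  have kE : q p + 1 = k by lra.
  rewrite kE.
  have kge : expR (ln (a / eps + 1) / (2 * s - 1)) <= k by rewrite le_max lexx orbT.
  have k0 : 0 < k by rewrite -kE.
  have ae : 0 < a / eps + 1 by rewrite ltr_wpDl// divr_ge0 ?(ltW eps0).
  have s20 : 0 < 2 * s - 1 by lra.
  have lk : ln (a / eps + 1) <= (2 * s - 1) * ln k.
    by rewrite [_ * ln k]mulrC -(ler_pdivrMr _ _ s20) -[X in X <= _]expRK ler_ln ?posrE ?expR_gt0.
  have yk : ln (p.2 + 1) <= ln k by rewrite ler_ln ?posrE//; lra.
  (* By [lk] the right side exceeds the left by at least [(1 - s) * (ln k - ln (p.2 + 1))], which is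
     nonnegative because [s <= 1] and [p.2 + 1 <= k]. *)
  have ex : ln (a / eps + 1) + ln (p.2 + 1) <= s * (ln (p.2 + 1) + ln k).
    by nra.
  have : (a / eps + 1) * (p.2 + 1) <= expR (s * (ln (p.2 + 1) + ln k)).
    by rewrite -[X in X * _]lnK ?posrE// -[X in _ * X]lnK ?posrE// -expRD ler_expR.
  move=> h; apply: (@le_trans _ _ (eps * ((a / eps + 1) * (p.2 + 1)))); last by rewrite ler_pM2l.
  have -> : eps * ((a / eps + 1) * (p.2 + 1)) = (a + eps) * (p.2 + 1).
    by field; rewrite gt_eqF.
  by nra.
have y0' : 0 < p.2 by rewrite lt_def y0.
have qy' : 0 < q p - p.2 by rewrite lt_def qy.
have qk' : 0 < k - 1 - q p by rewrite lt_def qk.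
right; split.
  have hx := @barrier_expand (M + d) eps s _ _ 0 sg p1 p2.
  have hy := @barrier_expand (M + d) eps s _ _ 1 (- c') p1 p2.
  move: hx hy => /=; set H := expR (s * _); set Q := (M + d) * _.
  have PE : P p.1 p.2 = Q by rewrite /P /L /Q /H /=; case: (p).
  set px := Q * (_ * (0 / _ + _)); set pxx := (X in expand2 _ _ _ X).
  move=> hx; set py := Q * (_ * (1 / _ + _)); set pyy := (X in expand2 _ _ _ X) => hy.
  exists px, pxx, py, pyy; split.
  - rewrite PE; apply: expand2_eq hx => t; rewrite /P /L [snd _]/=.
    have -> : q (p.1 + t, p.2) + 1 = q p + 1 + sg * t by rewrite /q /=; ring.
    by rewrite mul0r addr0.
  - rewrite PE; apply: expand2_eq hy => t; rewrite /P /L [snd _]/=.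
    have -> : q (p.1, p.2 + t) + 1 = q p + 1 + - c' * t by rewrite /q /=; ring.
    by rewrite mul1r addrAC.
  have := @sector_quadratic_form c' (p.2 + 1)^-1 (q p + 1)^-1.
  rewrite !invr_gt0 => /(_ p1 p2) /=; rewrite -/s; set u := (p.2 + 1)^-1; set w := (q p + 1)^-1.
  move=> F; rewrite PE.
  have Q0 : 0 < Q by rewrite -PE; exact: lt_le_trans (Pge _ _).
  have H0 : 0 < H by exact: expR_gt0.
  have s0 : 0 < s by lra.
  rewrite -subr_gt0.
  (* The identity holds for arbitrary [sg], so the multiple of [sg * sg - 1] is split off as a
     separate term and then vanishes. *)
  have -> : px ^+ 2 + py ^+ 2 - Q * (2 * (pxx + pyy)) = Q ^+ 2 * (eps * H * s) *
      (w ^+ 2 + u ^+ 2 + c' ^+ 2 * w ^+ 2 - s * (w ^+ 2 + (u - c' * w) ^+ 2)) +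
      (sg * sg - 1) * (Q ^+ 2 * (eps * H * s) * (w ^+ 2 - s * w ^+ 2)).
    by rewrite /px /py /pxx /pyy -/u -/w; field.
  rewrite sg2 subrr mul0r addr0; apply: mulr_gt0; last by rewrite subr_gt0.
  by apply: mulr_gt0 (exprn_gt0 2 Q0) _; apply: mulr_gt0 s0; exact: mulr_gt0.
(* Slack to the three sides of the triangle. A coordinate step of length [|t|] changes each slack by
   at most [(2 + |c'|) * |t|]. *)
pose m := Num.min p.2 (Num.min (q p - p.2) (k - 1 - q p)).
have m0 : 0 < m by rewrite !lt_min y0' qy' qk'.
have m1 : m <= p.2 by rewrite !ge_min lexx.
have m2 : m <= q p - p.2 by rewrite !ge_min lexx orbT.
have m3 : m <= k - 1 - q p by rewrite !ge_min lexx !orbT.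
have nc := normr_ge0 c'.
exists (m / (2 + `|c'|)) => [|t]; first by rewrite divr_gt0//; lra.
rewrite ltr_pdivlMr => [tm|]; last by lra.
have t0 := normr_ge0 t.
have qx : q (p.1 + t, p.2) = q p + sg * t by rewrite /q /=; ring.
have qy2 : q (p.1, p.2 + t) = q p - c' * t by rewrite /q /=; ring.
have [ta tb] : - `|t| <= t /\ t <= `|t| by have := lexx `|t|; rewrite ler_norml => /andP[].
have nsg : `|sg * t| = `|t|.
  rewrite normrM; suff -> : `|sg| = 1 by rewrite mul1r.
  have : `|sg| ^+ 2 = 1 by rewrite real_normK ?num_real// expr2.
  by move/eqP; rewrite sqrf_eq1 => /orP[/eqP//|/eqP]; have := normr_ge0 sg; lra.
have [sa sb] : - `|t| <= sg * t /\ sg * t <= `|t|.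
  by have := lexx `|sg * t|; rewrite {2}nsg ler_norml => /andP[].
have [ca cb] : - (`|c'| * `|t|) <= c' * t /\ c' * t <= `|c'| * `|t|.
  by rewrite -normrM; have := lexx `|c' * t|; rewrite ler_norml => /andP[].
have ct : 0 <= `|c'| * `|t| by rewrite mulr_ge0.
by split; (split; [split|]); rewrite /= ?qx ?qy2; lra.
Qed.

(* Barrier [1 + eps ln (r^2 / rho^2)] on an annulus; let [eps] and then [rho] tend to [0]. *)
Lemma liouville f (M : R) : holo2 f -> (forall z, nsq (f z) <= M) -> forall z, f z = f 0.
Proof.
move=> hf hM z0; pose g z := f z - f 0.
have hg : holo2 g.
  move=> z; have [a1 [a2 [K h]]] := hf z; exists a1, a2, K => w /h.
  by congr (nsq _ <= _); rewrite /g; ring.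
have gM z : nsq (g z) <= 4 * M.
  by apply: (le_trans (nsqB_le _ _)); have := hM z; have := hM 0; lra.
suff H z : nsq (g z) <= 0.
  by apply/eqP; rewrite -subr_eq0; apply/eqP/nsq_eq0/eqP; rewrite -/(g z0) eq_le H nsq_ge0.
have g0 : g 0 = 0 by rewrite /g subrr.
apply/ler_addgt0Pr => d d0; rewrite add0r.
have [K K0 hK] := holo2_lip 0 hg.
(* As [g] vanishes at 0, its Lipschitz estimate there bounds [nsq (g w)] by [d] on this disc, whose
   boundary is the inner circle of the annulus. *)
pose rho2 := Num.min 1 (d / K).
have r0 : 0 < rho2 by rewrite lt_min ltr01 divr_gt0.
have inner w : nsq w <= rho2 -> nsq (g w) <= d.
  rewrite le_min => /andP[w1 wK]; have := hK _ w1; rewrite add0r g0 subr0 => h.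
  by apply: (le_trans h); rewrite mulrC -ler_pdivlMr.
have [zr|zr] := leP (nsq z) rho2; first exact: inner.
pose r2 x y : R := x ^+ 2 + y ^+ 2.
have zE : nsq z = r2 (complex.Re z) (complex.Im z) by [].
suff main eps : 0 < eps ->
    nsq (g z) + d <= 2 * d * (1 + eps * (ln (nsq z) - ln rho2)).
  suff : nsq (g z) + d <= 2 * d by lra.
  apply/ler_addgt0Pr => e e0.
  have l0 : 0 < ln (nsq z) - ln rho2 by rewrite subr_gt0 ltr_ln ?posrE// (lt_trans r0).
  have := main (e / (2 * d * (ln (nsq z) - ln rho2))).
  move=> /(_ (divr_gt0 e0 (mulr_gt0 (mulr_gt0 (ltr0n _ 2) d0) l0))).
  set l := ln _ - _; rewrite -/l in l0.
  by have -> : 2 * d * (1 + e / (2 * d * l) * l) = 2 * d + e by field; rewrite !gt_eqF.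
move=> eps0.
pose P x y := 2 * d * (1 + eps * (ln (r2 x y) - ln rho2)).
(* Square of the outer radius: large enough to enclose [z] and for the barrier to reach [4 * M + d],
   since [nsq (g z)] never exceeds [4 * M]. *)
pose S := Num.max (nsq z) (expR (ln rho2 + (4 * M + d) / (2 * d * eps))).
have zS : nsq z <= S by rewrite le_max lexx.
have S0 : 0 < S by apply: lt_le_trans zS; exact: lt_trans zr.
pose D := [set p : R * R | 0 <= r2 p.1 p.2 - rho2] `&` [set p | 0 <= S - r2 p.1 p.2].
have cr : continuous (fun p : R * R => r2 p.1 p.2).
  move=> p; apply: cvgD; rewrite expr2; apply: cvgM; try exact: cvg_fst; exact: cvg_snd.
have clD : closed D.
  apply: closedI; apply: closed_le0 => p; apply: cvgB; try exact: cr; exact: cvg_cst.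
have cD : compact D.
  apply: (@compact_box_subset _ (S + 1)) => // p [/= _ h].
  have b (x : R) : x ^+ 2 <= S -> `|x| <= S + 1.
    rewrite -(@real_normK _ x) ?num_real// => hx.
    by have := sqr_ge0 (`|x| - 1 / 2); have := normr_ge0 x; nra.
  rewrite /r2 in h.
  by split; apply: b; have := sqr_ge0 p.1; have := sqr_ge0 p.2; lra.
have rp p : D p -> 0 < r2 p.1 p.2 by move=> [/= h _]; lra.
have Dz : D (complex.Re z, complex.Im z) by split => /=; rewrite -zE; lra.
have P1 p : D p -> 2 * d <= P p.1 p.2.
  move=> Dp; rewrite /P ler_peMr ?mulr_ge0 ?(ltW d0)// lerDl mulr_ge0 ?(ltW eps0)//.
  by rewrite subr_ge0 ler_ln ?posrE ?rp//; case: Dp => /= h _; lra.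
have := @max_principle _ g P D d hg d0 cD _ _ _ _ Dz.
rewrite /P /= -zE.
have -> : (Complex (complex.Re z) (complex.Im z) : C R) = z by case: (z).
apply.
- move=> p Dp; apply: cvgM; first exact: cvg_cst.
  apply: cvgD; first exact: cvg_cst.
  apply: cvgM; first exact: cvg_cst.
  apply: cvgB; last exact: cvg_cst.
  apply: (@continuous_comp _ _ _ (fun p : R * R => r2 p.1 p.2) (@ln R)); first exact: cr.
  by apply: continuous_ln; exact: rp.
- by move=> p /P1; apply: lt_le_trans; rewrite mulr_gt0.
move=> p Dp; have r20 := rp _ Dp; have [/= h1 h2] := Dp.
have [e1|e1] := eqVneq (r2 p.1 p.2 - rho2) 0.
  left; apply: le_trans (P1 _ Dp).
  have : nsq (g (Complex p.1 p.2)) <= d by apply: inner; rewrite /nsq /= -/(r2 _ _); lra.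
  by lra.
have [e2|e2] := eqVneq (S - r2 p.1 p.2) 0.
  left; have := gM (Complex p.1 p.2).
  have -> : r2 p.1 p.2 = S by lra.
  have lS : ln rho2 + (4 * M + d) / (2 * d * eps) <= ln S.
    by rewrite -ler_expR lnK ?posrE// le_max lexx orbT.
  have : 2 * d * eps * ((4 * M + d) / (2 * d * eps)) <= 2 * d * eps * (ln S - ln rho2).
    by rewrite ler_pM2l ?mulr_gt0//; lra.
  have -> : 2 * d * eps * ((4 * M + d) / (2 * d * eps)) = 4 * M + d by field; rewrite !gt_eqF.
  by lra.
have e1' : 0 < r2 p.1 p.2 - rho2 by rewrite lt_def e1.
have e2' : 0 < S - r2 p.1 p.2 by rewrite lt_def e2.
right; split.
  have hr (x y : R) : 0 < r2 x y ->
      expand2 (fun t => 2 * d * (1 + eps * (ln (r2 (x + t) y) - ln rho2)))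
        (2 * d * (1 + eps * (ln (r2 x y) - ln rho2))) (2 * d * eps * (2 * x / r2 x y))
        (2 * d * eps * ((r2 x y)^-1 - 2 * x ^+ 2 / (r2 x y) ^+ 2)).
    move=> rxy; have ha := expand2_affine x 1.
    have hq := expand2D (expand2M ha ha) (expand2_cst (y ^+ 2)).
    have rE : x * x + y ^+ 2 = r2 x y by rewrite /r2 [x ^+ 2]expr2.
    rewrite rE in hq.
    have hl := expand2_comp hq (expand2_ln rxy).
    have := expand2Z (2 * d) (expand2D (expand2_cst 1) (expand2Z eps (expand2D hl (expand2_cst (- ln rho2))))).
    set b := (X in expand2 _ _ X _); set c := (X in expand2 _ _ _ X) => h.
    have -> : 2 * d * eps * (2 * x / r2 x y) = b by rewrite /b; field; rewrite gt_eqF.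
    have -> : 2 * d * eps * ((r2 x y)^-1 - 2 * x ^+ 2 / (r2 x y) ^+ 2) = c.
      by rewrite /c; field; rewrite gt_eqF.
    apply: expand2_eq h => t.
    by have -> : r2 (x + t) y = (x + 1 * t) * (x + 1 * t) + y ^+ 2 by rewrite /r2; ring.
  have rC x y : r2 x y = r2 y x by rewrite /r2 addrC.
  have hx := hr p.1 p.2 r20; have hy := hr p.2 p.1; rewrite rC in hy; have {}hy := hy r20.
  exists (2 * d * eps * (2 * p.1 / r2 p.1 p.2)).
  exists (2 * d * eps * ((r2 p.1 p.2)^-1 - 2 * p.1 ^+ 2 / (r2 p.1 p.2) ^+ 2)).
  exists (2 * d * eps * (2 * p.2 / r2 p.1 p.2)).
  exists (2 * d * eps * ((r2 p.1 p.2)^-1 - 2 * p.2 ^+ 2 / (r2 p.1 p.2) ^+ 2)).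
  split=> //; first by apply: expand2_eq hy => t; rewrite (rC p.1).
  set r := r2 p.1 p.2.
  have rr : p.1 ^+ 2 + p.2 ^+ 2 = r by [].
  have r00 : 0 < r by [].
  set Q := (X in X * _ < _).
  (* The logarithm of the squared radius is harmonic, so this side is a multiple of
     [r - (p.1 ^+ 2 + p.2 ^+ 2) = 0]. Strictness comes from its gradient, which does not vanish on
     the annulus. *)
  have -> : Q * (2 * (2 * d * eps * (r^-1 - 2 * p.1 ^+ 2 / r ^+ 2) +
      2 * d * eps * (r^-1 - 2 * p.2 ^+ 2 / r ^+ 2))) = Q * 8 * d * eps / r ^+ 2 * (r - (p.1 ^+ 2 + p.2 ^+ 2)).
    by field; rewrite gt_eqF.
  have -> : (2 * d * eps * (2 * p.1 / r)) ^+ 2 + (2 * d * eps * (2 * p.2 / r)) ^+ 2 =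
      16 * (d * eps) ^+ 2 / r ^+ 2 * (p.1 ^+ 2 + p.2 ^+ 2) by field; rewrite gt_eqF.
  by rewrite rr subrr mulr0 !mulr_gt0 ?invr_gt0 ?exprn_gt0 ?mulr_gt0.
pose m := Num.min (r2 p.1 p.2 - rho2) (S - r2 p.1 p.2).
have m0 : 0 < m by rewrite lt_min e1' e2'.
have m1 : m <= r2 p.1 p.2 - rho2 by rewrite ge_min lexx.
have m2 : m <= S - r2 p.1 p.2 by rewrite ge_min lexx orbT.
have n1 := normr_ge0 p.1; have n2 := normr_ge0 p.2.
pose B := 2 * `|p.1| + 2 * `|p.2| + 1.
have B0 : 0 < B by rewrite /B; lra.
exists (Num.min 1 (m / B)) => [|t]; first by rewrite lt_min ltr01 divr_gt0.
rewrite lt_min ltr_pdivlMr// => /andP[t1 tB]; have t0 := normr_ge0 t.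
have b (x : R) : 2 * `|x| + 1 <= B -> `|2 * x * t + t ^+ 2| < m.
  move=> xB; apply: le_lt_trans tB; apply: (le_trans (ler_normD _ _)).
  rewrite normrX normrM [`|2 * x|]normrM (ger0_norm (ler0n R 2)).
  by have := normr_ge0 x; nra.
have b1 : `|2 * p.1 * t + t ^+ 2| < m by apply: b; rewrite /B; lra.
have b2 : `|2 * p.2 * t + t ^+ 2| < m by apply: b; rewrite /B; lra.
move: b1 b2; rewrite !ltr_norml => /andP[? ?] /andP[? ?].
have E1 : r2 (p.1 + t) p.2 = r2 p.1 p.2 + (2 * p.1 * t + t ^+ 2) by rewrite /r2; ring.
have E2 : r2 p.1 (p.2 + t) = r2 p.1 p.2 + (2 * p.2 * t + t ^+ 2) by rewrite /r2; ring.
by split; split; rewrite /= ?E1 ?E2; lra.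
Qed.

End PhragmenLindelof.

(** * Gronwall estimates *)

Section ComplexCalculus.
Context {R : realType}.
Implicit Types (g h : R -> C R) (t x : R).

Lemma has_cderiv_eq g t d d' : d = d' -> has_cderiv g t d -> has_cderiv g t d'.
Proof. by move=> ->. Qed.

Lemma has_cderivD g h t dg dh : has_cderiv g t dg -> has_cderiv h t dh ->
  has_cderiv (fun s => g s + h s) t (dg + dh).
Proof.
move=> [g1 g2] [h1 h2]; split.
  have -> : (fun s => complex.Re (g s + h s)) =
    (fun s => complex.Re (g s)) + (fun s => complex.Re (h s)).
    by apply/funext => s; rewrite ReD.
  by rewrite ReD; exact: is_deriveD.
have -> : (fun s => complex.Im (g s + h s)) =
  (fun s => complex.Im (g s)) + (fun s => complex.Im (h s)).
  by apply/funext => s; rewrite ImD.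
by rewrite ImD; exact: is_deriveD.
Qed.

Lemma has_cderiv_cst (c : C R) t : has_cderiv (fun=> c) t 0.
Proof. by split; exact: is_derive_cst. Qed.

Lemma has_cderivM g h t dg dh : has_cderiv g t dg -> has_cderiv h t dh ->
  has_cderiv (fun s => g s * h s) t (dg * h t + g t * dh).
Proof.
move=> [g1 g2] [h1 h2]; split.
  have -> : (fun s => complex.Re (g s * h s)) =
    (fun s => complex.Re (g s)) * (fun s => complex.Re (h s)) -
    (fun s => complex.Im (g s)) * (fun s => complex.Im (h s)).
    by apply/funext => s; rewrite ReM.
  by apply: is_derive_eq; rewrite !ReIm -![_ *: _]/(_ * _); ring.
have -> : (fun s => complex.Im (g s * h s)) =
  (fun s => complex.Re (g s)) * (fun s => complex.Im (h s)) +
  (fun s => complex.Im (g s)) * (fun s => complex.Re (h s)).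
  by apply/funext => s; rewrite ImM.
by apply: is_derive_eq; rewrite !ReIm -![_ *: _]/(_ * _); ring.
Qed.

Lemma has_cderivZ (c : C R) g t d : has_cderiv g t d -> has_cderiv (fun s => c * g s) t (c * d).
Proof.
move=> h; have := has_cderivM (has_cderiv_cst c t) h.
by rewrite mul0r add0r.
Qed.

Lemma has_cderivB g h t dg dh : has_cderiv g t dg -> has_cderiv h t dh ->
  has_cderiv (fun s => g s - h s) t (dg - dh).
Proof.
move=> hg hh; have := has_cderivD hg (has_cderivZ (-1) hh); rewrite mulN1r.
by under eq_fun do rewrite mulN1r.
Qed.

Lemma has_cderiv_conj g t d : has_cderiv g t d ->
  has_cderiv (fun s => Num.conj (g s)) t (Num.conj d).
Proof.
move=> [g1 g2]; split; rewrite ?Re_conj ?Im_conj.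
  by under eq_fun do rewrite Re_conj.
under eq_fun do rewrite Im_conj.
exact: is_deriveN.
Qed.

Lemma has_cderiv_sum (I : Type) (r : seq I) (F : I -> R -> C R) (dF : I -> C R) t :
  (forall i, has_cderiv (F i) t (dF i)) ->
  has_cderiv (fun s => \sum_(i <- r) F i s) t (\sum_(i <- r) dF i).
Proof.
move=> h; elim: r => [|i r IH].
  rewrite big_nil; under eq_fun do rewrite big_nil.
  exact: has_cderiv_cst.
rewrite big_cons; under eq_fun do rewrite big_cons.
exact: has_cderivD.
Qed.

Lemma is_derive_nsq g t d : has_cderiv g t d ->
  is_derive t 1 (fun s => nsq (g s)) (2 * complex.Re (Num.conj (g t) * d)).
Proof.
move=> [g1 g2].
have -> : (fun s => nsq (g s)) =
    (fun s => complex.Re (g s)) * (fun s => complex.Re (g s)) +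
    (fun s => complex.Im (g s)) * (fun s => complex.Im (g s)).
  by apply/funext => s; rewrite /nsq !expr2.
by apply: is_derive_eq; rewrite !ReIm -![_ *: _]/(_ * _); ring.
Qed.

Lemma is_derive_bigsum (I : Type) (r : seq I) (F : I -> R -> R) (dF : I -> R) t :
  (forall i, is_derive t 1 (F i) (dF i)) ->
  is_derive t 1 (fun s => \sum_(i <- r) F i s) (\sum_(i <- r) dF i).
Proof.
move=> h; elim: r => [|i r IH].
  rewrite big_nil; under eq_fun do rewrite big_nil.
  exact: is_derive_cst.
rewrite big_cons; under eq_fun do rewrite big_cons.
exact: is_deriveD.
Qed.

Lemma is_derive_nsq_sum (I : finType) (u : I -> R -> C R) (du : I -> C R) t :
  (forall p, has_cderiv (u p) t (du p)) ->
  is_derive t 1 (fun s => \sum_p nsq (u p s))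
    (\sum_p 2 * complex.Re (Num.conj (u p t) * du p)).
Proof. by move=> h; apply: is_derive_bigsum => p; exact: is_derive_nsq. Qed.

Definition ccontinuous g :=
  continuous (fun s => complex.Re (g s)) /\ continuous (fun s => complex.Im (g s)).

Lemma ccontinuous_cst (c : C R) : ccontinuous (fun=> c).
Proof. by split; exact: cst_continuous. Qed.

Lemma ccontinuousD g h : ccontinuous g -> ccontinuous h -> ccontinuous (fun s => g s + h s).
Proof.
move=> [g1 g2] [h1 h2]; split.
  by under eq_fun do rewrite ReD; move=> s; apply: cvgD; [exact: g1|exact: h1].
by under eq_fun do rewrite ImD; move=> s; apply: cvgD; [exact: g2|exact: h2].
Qed.

Lemma ccontinuousM g h : ccontinuous g -> ccontinuous h -> ccontinuous (fun s => g s * h s).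
Proof.
move=> [g1 g2] [h1 h2]; split.
  under eq_fun do rewrite ReM; move=> s; apply: cvgB; apply: cvgM;
    [exact: g1|exact: h1|exact: g2|exact: h2].
under eq_fun do rewrite ImM; move=> s; apply: cvgD; apply: cvgM;
  [exact: g1|exact: h2|exact: g2|exact: h1].
Qed.

Lemma ccontinuous_conj g : ccontinuous g -> ccontinuous (fun s => Num.conj (g s)).
Proof.
move=> [g1 g2]; split.
  by under eq_fun do rewrite Re_conj.
by under eq_fun do rewrite Im_conj; move=> s; apply: cvgN; exact: g2.
Qed.

Lemma ccontinuous_sum (I : Type) (r : seq I) (F : I -> R -> C R) :
  (forall i, ccontinuous (F i)) -> ccontinuous (fun s => \sum_(i <- r) F i s).
Proof.
move=> h; elim: r => [|i r IH].
  under eq_fun do rewrite big_nil.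
  exact: ccontinuous_cst.
under eq_fun do rewrite big_cons.
exact: ccontinuousD.
Qed.

Definition cwithin (x : R) g :=
  {within `[0, x], continuous (fun s => complex.Re (g s))} /\
  {within `[0, x], continuous (fun s => complex.Im (g s))}.

Lemma has_cderiv_cwithin g (dg : R -> C R) x :
  (forall t, 0 <= t -> has_cderiv g t (dg t)) -> cwithin x g.
Proof.
by move=> h; split; apply: continuous_within_pos => // t t0;
  have [h1 h2] := h _ t0; [exact: is_derive_continuous h1 | exact: is_derive_continuous h2].
Qed.

Lemma within_bigsum (I : Type) (r : seq I) (F : I -> R -> R) (A : set R) :
  (forall i, {within A, continuous (F i)}) ->
  {within A, continuous (fun s => \sum_(i <- r) F i s)}.
Proof.
move=> h; elim: r => [|i r IH].
  under eq_fun do rewrite big_nil.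
  by move=> s; exact: cvg_cst.
under eq_fun do rewrite big_cons.
by move=> s; apply: cvgD; [exact: h | exact: IH].
Qed.

Lemma within_nsq_sum (I : finType) (u : I -> R -> C R) x :
  (forall p, cwithin x (u p)) ->
  {within `[0, x], continuous (fun s => \sum_p nsq (u p s))}.
Proof.
move=> h; apply: within_bigsum => p; have [h1 h2] := h p.
have -> : (fun s => nsq (u p s)) = (fun s => complex.Re (u p s) * complex.Re (u p s) +
  complex.Im (u p s) * complex.Im (u p s)) by apply/funext => s; rewrite /nsq !expr2.
by move=> s; apply: cvgD; apply: cvgM; [exact: h1|exact: h1|exact: h2|exact: h2].
Qed.

(* Compare [N] with the solution of [N' = k N + G] by differentiating
   [exp (- k t) N - G t]. *)
Lemma gronwall (N dN : R -> R) (k G x : R) : 0 <= k -> 0 <= G -> 0 <= x ->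
  {within `[0, x], continuous N} ->
  (forall t, 0 < t -> t < x -> is_derive t 1 N (dN t)) ->
  (forall t, 0 < t -> t < x -> dN t <= k * N t + G) ->
  N x <= (N 0 + G * x) * expR (k * x).
Proof.
move=> k0 G0 x0 cN DN hN.
pose F t := G * t - N t * expR (- k * t).
have DF t : 0 < t -> t < x -> is_derive t 1 F (G - (dN t - k * N t) * expR (- k * t)).
  move=> t0 tx; have := DN t t0 tx; have := is_derive_expRM (- k) t => ? ?.
  have -> : F = (G \*: (id : R -> R)) - N * (fun t => expR (- k * t)) by apply/funext.
  by apply: is_derive_eq; rewrite -![_ *: _]/(_ * _); ring.
have := @derive_ge0_le R F _ 0 x x0 _ DF.
have cF : {within `[0, x], continuous F}.
  move=> t; apply: cvgB.
    apply: cvgM; first exact: cvg_cst.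
    by apply: continuous_subspaceT => ?; exact: cvg_id.
  apply: cvgM; first exact: cN.
  apply: continuous_subspaceT => s.
  exact: is_derive_continuous (is_derive_expRM (- k) s).
move=> /(_ cF) h; have {}h : F 0 <= F x.
  apply: h => t t0 tx; rewrite subr_ge0; have := hN t t0 tx => {}h.
  have e0 := expR_gt0 (- k * t).
  have e1 : expR (- k * t) <= 1.
    by rewrite -expR0 ler_expR mulNr oppr_le0 mulr_ge0// ltW.
  apply: (@le_trans _ _ (G * expR (- k * t))); last by rewrite ler_piMr.
  by rewrite ler_pM2r//; lra.
move: h; rewrite /F !mulr0 expR0 mulr1 sub0r => h.
have ek : expR (- k * x) * expR (k * x) = 1 by rewrite -expRD mulNr addNr expR0.
rewrite -[N x]mulr1 -ek mulrA ler_pM2r ?expR_gt0//; lra.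
Qed.

End ComplexCalculus.

(** * Linear systems depending on a parameter *)

Section LinearSystem.
Context {R : realType} (I : finType).
Variables (lam : I -> C R) (b : I -> I -> R -> C R) (be : R).
Hypothesis Re_lam : forall p, complex.Re (lam p) = 0.
Hypothesis lam_le : forall p, nsq (lam p) <= 4.
Hypothesis be0 : 0 < be.
Hypothesis b_le : forall p q t, nsq (b p q t) <= be ^+ 2.
Implicit Types (u : I -> R -> C R) (t x : R) (z w : C R).

(** Common shape of the Dirac system ([lam] equal to plus or minus ['i]) and of the transfer
    equation, indexed by pairs ([lam] equal to 0 or plus or minus [2 'i]); the latter explains the
    bound 4 on [nsq (lam p)]. *)
Definition rhs z t (y : I -> C R) p : C R := z * lam p * y p + \sum_q b p q t * y q.

(** As [lam p] is purely imaginary, [z] enters the energy through [Im z] alone. The coupling is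
    split by the Young inequality with weight [be]. *)
Lemma rhs_energy z t (y : I -> C R) :
  \sum_p 2 * complex.Re (Num.conj (y p) * rhs z t y p) <=
  (4 * `|complex.Im z| + 2 * be * #|I|%:R) * \sum_p nsq (y p).
Proof.
have Im_lam p : - 2 <= complex.Im (lam p) /\ complex.Im (lam p) <= 2.
  have := lam_le p; rewrite /nsq Re_lam expr0n add0r => h.
  by split; nra.
have t1 p : 2 * complex.Re (Num.conj (y p) * rhs z t y p) <=
    4 * `|complex.Im z| * nsq (y p) + \sum_q (be * nsq (y p) + be * nsq (y q)).
  rewrite /rhs mulrDr ReD mulrDr; apply: lerD.
    rewrite [X in 2 * complex.Re X](_ : _ = (z * lam p) * (Num.conj (y p) * y p)); last by ring.
    have -> : 2 * complex.Re (z * lam p * (Num.conj (y p) * y p)) =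
        - 2 * complex.Im (lam p) * complex.Im z * nsq (y p).
      by rewrite /nsq !ReIm Re_lam; ring.
    rewrite ler_wpM2r ?nsq_ge0//.
    have := ler_norm (complex.Im z); have := ler_norm (- complex.Im z); rewrite normrN.
    have [] := Im_lam p; have := normr_ge0 (complex.Im z).
    set m := complex.Im (lam p); set i := complex.Im z => ? ? ? ? ?.
    have : - (m * i) <= `|m| * `|i| by rewrite -normrM -normrN ler_norm.
    have : `|m| <= 2 by rewrite ler_norml; apply/andP; split.
    by nra.
  rewrite mulr_sumr Re_sum mulr_sumr; apply: ler_sum => q _.
  apply: (le_trans (ler_wpM2l (ler0n _ 2) (ler_norm _))).
  apply: (le_trans (Re_mulC_le _ _ be0)); rewrite nsq_conj lerD2l nsqM.
  rewrite ler_pdivrMr// [X in _ <= X](_ : _ = be ^+ 2 * nsq (y q)); last by ring.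
  by rewrite ler_wpM2r ?nsq_ge0.
apply: (@le_trans _ _ (\sum_p (4 * `|complex.Im z| * nsq (y p) +
    \sum_q (be * nsq (y p) + be * nsq (y q))))); first by apply: ler_sum => p _; exact: t1.
have gen (n : I -> R) (c : R) : \sum_p (c * n p + \sum_q (be * n p + be * n q)) =
    (c + 2 * be * #|I|%:R) * \sum_p n p.
  have e p : \sum_q (be * n p + be * n q) = #|I|%:R * (be * n p) + be * \sum_q n q.
    by rewrite big_split/= sumr_const mulr_natl -mulr_sumr.
  under eq_bigr => p _ do rewrite e.
  rewrite !big_split/= sumr_const -!mulr_sumr.
  rewrite -[X in _ + (_ + X)]mulr_natl; set S := \sum_i n i.
  by ring.
by rewrite (gen (fun p => nsq (y p))).
Qed.

Definition rate z : R := 4 * `|complex.Im z| + 2 * be * #|I|%:R.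

Lemma rate_ge0 z : 0 <= rate z.
Proof. by rewrite addr_ge0 ?mulr_ge0 ?ler0n ?(ltW be0). Qed.

Lemma system_growth z u x : 0 <= x -> (forall p, cwithin x (u p)) ->
  (forall p t, 0 < t -> t < x -> has_cderiv (u p) t (rhs z t (u ^~ t) p)) ->
  \sum_p nsq (u p x) <= (\sum_p nsq (u p 0)) * expR (rate z * x).
Proof.
move=> x0 cu Du; rewrite -[X in X * _]addr0 -[X in _ + X](mul0r x).
pose N t := \sum_p nsq (u p t).
apply: (@gronwall _ N _ (rate z) 0 x (rate_ge0 z) (lexx 0) x0 (within_nsq_sum cu)).
  by move=> t t0 tx; apply: is_derive_nsq_sum => p; exact: Du.
by move=> t t0 tx; rewrite addr0; exact: rhs_energy.
Qed.

(** From zero data, the forcing contributes [2 Re (conj u * g) <= nsq u + nsq g]; the first term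
    raises the rate by 1 and the second is the Gronwall source. *)
Lemma system_forced z u (g : I -> R -> C R) (G x : R) : 0 <= x -> 0 <= G ->
  (forall p, u p 0 = 0) ->
  (forall p t, 0 <= t -> has_cderiv (u p) t (rhs z t (u ^~ t) p + g p t)) ->
  (forall t, 0 <= t -> t <= x -> \sum_p nsq (g p t) <= G) ->
  forall t, 0 <= t -> t <= x ->
  \sum_p nsq (u p t) <= G * (x * expR ((rate z + 1) * x)).
Proof.
move=> x0 G0 u0 Du hg t t0 tx.
pose N s := \sum_p nsq (u p s).
have r1 : 0 <= rate z + 1 by rewrite addr_ge0 ?rate_ge0.
have cu p : cwithin t (u p) by apply: has_cderiv_cwithin (Du p).
have := @gronwall _ N _ (rate z + 1) G t r1 G0 t0 (within_nsq_sum cu)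
  (fun s s0 st => is_derive_nsq_sum (fun p => Du p s (ltW s0))).
have -> : N 0 = 0 by rewrite /N big1// => p _; rewrite u0 nsq0.
rewrite add0r => h; apply: (le_trans (h _)); last first.
  rewrite -mulrA ler_wpM2l// ler_pM ?expR_ge0// ler_expR.
  by rewrite ler_wpM2l.
move=> s s0 st.
have -> : \sum_p 2 * complex.Re (Num.conj (u p s) * (rhs z s (u ^~ s) p + g p s)) =
    \sum_p 2 * complex.Re (Num.conj (u p s) * rhs z s (u ^~ s) p) +
    \sum_p 2 * complex.Re (Num.conj (u p s) * g p s).
  by rewrite -big_split/=; apply: eq_bigr => p _; rewrite mulrDr ReD mulrDr.
have e1 := rhs_energy z s (u ^~ s).
have e2 : \sum_p 2 * complex.Re (Num.conj (u p s) * g p s) <= N s + G.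
  apply: (@le_trans _ _ (\sum_p (nsq (u p s) + nsq (g p s)))); last first.
    by rewrite big_split/= lerD2l hg ?(ltW s0)// (le_trans (ltW st)).
  apply: ler_sum => p _; apply: (le_trans (ler_wpM2l (ler0n _ 2) (ler_norm _))).
  by apply: (le_trans (Re_mulC_le _ _ ltr01)); rewrite nsq_conj divr1 mul1r.
by rewrite mulrDl mul1r; move: e1 e2; rewrite -/(rate z) -/(N s); lra.
Qed.

Lemma system_unique z u u' x : 0 <= x -> (forall p, cwithin x (u p)) ->
  (forall p, cwithin x (u' p)) -> (forall p, u p 0 = u' p 0) ->
  (forall p t, 0 < t -> t < x -> has_cderiv (u p) t (rhs z t (u ^~ t) p)) ->
  (forall p t, 0 < t -> t < x -> has_cderiv (u' p) t (rhs z t (u' ^~ t) p)) ->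
  forall p, u p x = u' p x.
Proof.
move=> x0 cu cu' e0 Du Du' p.
have := @system_growth z (fun p t => u p t - u' p t) x x0.
rewrite [X in _ -> _ -> _ <= X * _]big1; last by move=> q _; rewrite e0 subrr nsq0.
rewrite mul0r => h.
have {}h : \sum_p nsq (u p x - u' p x) <= 0.
  apply: h => q; [|move=> t t0 tx].
    have [a1 a2] := cu q; have [b1 b2] := cu' q; split; rewrite /=.
      have -> : (fun s => complex.Re (u q s - u' q s)) =
          (fun s => complex.Re (u q s) - complex.Re (u' q s)).
        by apply/funext => s; rewrite ReD ReN.
      by move=> s; apply: cvgB; [exact: a1|exact: b1].
    have -> : (fun s => complex.Im (u q s - u' q s)) =
        (fun s => complex.Im (u q s) - complex.Im (u' q s)).
      by apply/funext => s; rewrite ImD ImN.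
    by move=> s; apply: cvgB; [exact: a2|exact: b2].
  apply: has_cderiv_eq (has_cderivB (Du q t t0 tx) (Du' q t t0 tx)).
  rewrite /rhs mulrBr.
  have -> : \sum_q0 b q q0 t * (u q0 t - u' q0 t) =
      \sum_q0 b q q0 t * u q0 t - \sum_q0 b q q0 t * u' q0 t.
    by rewrite -sumrB; apply: eq_bigr => ? _; rewrite mulrBr.
  by ring.
have pos q : 0 <= nsq (u q x - u' q x) by exact: nsq_ge0.
have : \sum_p nsq (u p x - u' p x) = 0 by apply/eqP; rewrite eq_le h sumr_ge0.
move/eqP; rewrite psumr_eq0// => /allP/(_ p); rewrite mem_index_enum => /(_ isT) /eqP.
by move/nsq_eq0/eqP; rewrite subr_eq0 => /eqP.
Qed.

Section Existence.
Hypothesis b_cont : forall p q, ccontinuous (b p q).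
Variable y0 : I -> C R.

Let m1 (z : C R) : R := `|complex.Re z| + `|complex.Im z|.
Let m1_ge0 z : 0 <= m1 z. Proof. by rewrite addr_ge0. Qed.
Let m1D z w : m1 (z + w) <= m1 z + m1 w.
Proof.
rewrite /m1 !ReIm.
have := ler_normD (complex.Re z) (complex.Re w).
by have := ler_normD (complex.Im z) (complex.Im w); lra.
Qed.
Let m1M z w : m1 (z * w) <= m1 z * m1 w.
Proof.
rewrite /m1 !ReIm.
apply: (le_trans (lerD (ler_normB _ _) (ler_normD _ _))); rewrite !normrM.
by rewrite le_eqVlt; apply/orP; left; apply/eqP; ring.
Qed.
Let m1_sum (F : I -> C R) : m1 (\sum_q F q) <= \sum_q m1 (F q).
Proof.
elim/big_ind2: _ => [|z r w s hz hw|//]; first by rewrite /m1 !ReIm normr0 addr0.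
by apply: (le_trans (m1D _ _)); exact: lerD.
Qed.
Let m1_b p q t : m1 (b p q t) <= 2 * be.
Proof.
have h := b_le p q t; rewrite /nsq in h.
have sq (a : R) : a ^+ 2 <= be ^+ 2 -> `|a| <= be.
  move=> ha; rewrite -(@ler_pXn2r _ 2) ?nnegrE ?(ltW be0)//.
  by rewrite real_normK ?num_real.
have := sqr_ge0 (complex.Re (b p q t)); have := sqr_ge0 (complex.Im (b p q t)) => i0 r0.
have := sq (complex.Re (b p q t)); have := sq (complex.Im (b p q t)).
by rewrite /m1; move=> /(_ ltac:(lra)) ? /(_ ltac:(lra)) ?; lra.
Qed.

(* Solving simultaneously for all Taylor coefficients [y k] of the solution
   with respect to the parameter [z]. *)
Lemma taylor_system z : exists y : nat -> I -> R -> C R,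
  [/\ forall p, y 0%N p 0 = y0 p, forall k p, y k.+1 p 0 = 0 &
      forall k p t, 0 <= t -> has_cderiv (y k p) t (rhs z t (y k ^~ t) p +
        (if k is k'.+1 then lam p * y k' p t else 0))].
Proof.
pose J := (nat * I * bool)%type.
pose cx (Y : J -> R) k p : C R := Complex (Y (k, p, true)) (Y (k, p, false)).
pose F0 t (Y : J -> R) k p : C R := rhs z t (cx Y k) p +
  (if k is k'.+1 then lam p * cx Y k' p else 0).
pose F t (Y : J -> R) (j : J) : R :=
  if j.2 then complex.Re (F0 t Y j.1.1 j.1.2) else complex.Im (F0 t Y j.1.1 j.1.2).
pose Y0 (j : J) : R := if j.1.1 is _.+1 then 0 else
  if j.2 then complex.Re (y0 j.1.2) else complex.Im (y0 j.1.2).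
(* Level [k] is coupled to itself and to level [k - 1] only, with coefficients independent of [k],
   so one constant serves the infinite system. The factor 2 is the loss from the sup norm of real
   coordinates to [m1]. *)
pose K := 2 * (\sum_p m1 (z * lam p) + \sum_p m1 (lam p) + #|I|%:R * (2 * be)) + 1.
have sum_ge (F1 : I -> R) p : (forall q, 0 <= F1 q) -> F1 p <= \sum_q F1 q.
  by move=> h; rewrite (bigD1 p)//= lerDl sumr_ge0.
have S0 : 0 <= \sum_p m1 (z * lam p) by exact: sumr_ge0.
have S1 : 0 <= \sum_p m1 (lam p) by exact: sumr_ge0.
have S2 : 0 <= #|I|%:R * (2 * be) by rewrite !mulr_ge0 ?(ltW be0).
have K0 : 0 < K by rewrite /K; lra.
have lipF t (Y Y' : J -> R) (d : R) : 0 <= t ->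
    (forall q, `|Y q - Y' q| <= d) -> forall j, `|F t Y j - F t Y' j| <= K * d.
  move=> _ hd [[k p] bb].
  have d0 : 0 <= d by exact: le_trans (hd (k, p, bb)).
  pose D k p : C R := cx Y k p - cx Y' k p.
  have hD k1 p1 : m1 (D k1 p1) <= 2 * d.
    rewrite /m1 /D !ReIm /=.
    by have := hd (k1, p1, true); have := hd (k1, p1, false); lra.
  suff H : m1 (F0 t Y k p - F0 t Y' k p) <= K * d.
    have eR (u v : C R) : complex.Re (u - v) = complex.Re u - complex.Re v by rewrite ReD ReN.
    have eI (u v : C R) : complex.Im (u - v) = complex.Im u - complex.Im v by rewrite ImD ImN.
    move: H; rewrite /m1 eR eI /F /= => H.
    by case: bb; apply: le_trans H; rewrite ?lerDl ?lerDr.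
  have -> : F0 t Y k p - F0 t Y' k p = z * lam p * D k p + \sum_q b p q t * D k q +
      (if k is k'.+1 then lam p * D k' p else 0).
    rewrite /F0 /rhs.
    have -> : \sum_q b p q t * D k q =
        \sum_q b p q t * cx Y k q - \sum_q b p q t * cx Y' k q.
      by rewrite -sumrB; apply: eq_bigr => q _; rewrite mulrBr.
    by rewrite /D; case: (k) => [|k']; ring.
  apply: (le_trans (m1D _ _)); apply: (le_trans (lerD (m1D _ _) (lexx _))).
  have b1 : m1 (z * lam p * D k p) <= (\sum_p m1 (z * lam p)) * (2 * d).
    apply: (le_trans (m1M _ _)); rewrite ler_pM//.
    exact: (sum_ge (fun p => m1 (z * lam p))).
  have b2 : m1 (\sum_q b p q t * D k q) <= #|I|%:R * (2 * be) * (2 * d).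
    apply: (le_trans (m1_sum _)); apply: (@le_trans _ _ (\sum_(q : I) (2 * be) * (2 * d))).
      by apply: ler_sum => q _; apply: (le_trans (m1M _ _)); apply: ler_pM.
    by rewrite sumr_const -[X in X <= _]mulr_natl mulrA.
  have b3 : m1 (if k is k'.+1 then lam p * D k' p else 0) <= (\sum_p m1 (lam p)) * (2 * d).
    case: (k) => [|k']; first by rewrite /m1 !ReIm normr0 addr0 mulr_ge0// mulr_ge0.
    apply: (le_trans (m1M _ _)); rewrite ler_pM//.
    exact: (sum_ge (fun p => m1 (lam p))).
  by rewrite /K; lra.
pose d0 := \sum_p m1 (y0 p).
have hd0 j : `|Y0 j - 0| <= d0.
  have d00 : 0 <= d0 by exact: sumr_ge0.
  rewrite subr0 /Y0; case: j => [[[|k] p] bb] /=; last by rewrite normr0.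
  apply: (@le_trans _ _ (m1 (y0 p))); last exact: (sum_ge (fun p => m1 (y0 p))).
  by case: bb; rewrite /m1 ?lerDl ?lerDr.
have F00 t j : F t (fun=> 0) j = 0.
  have e0 k p : cx (fun=> 0) k p = 0 by [].
  have : F0 t (fun=> 0) j.1.1 j.1.2 = 0.
    rewrite /F0 /rhs big1 => [|q _]; rewrite ?e0 ?mulr0 ?addr0//.
    by case: j.1.1 => [|k']; rewrite ?e0 ?mulr0 ?addr0.
  by rewrite /F => ->; rewrite !ReIm; case: (j.2).
have bndF t j : 0 <= t -> `|F t Y0 j| <= K * d0.
  move=> t0; have := lipF t Y0 (fun=> 0) d0 t0 hd0 j.
  by rewrite F00 subr0.
have contF (Y : J -> R -> R) : (forall q, continuous (Y q)) ->
    forall j, continuous (fun t => F t (Y ^~ t) j).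
  move=> cY [[k p] bb].
  have ccx k1 p1 : ccontinuous (fun t => cx (Y ^~ t) k1 p1) by split; exact: cY.
  suff [h1 h2] : ccontinuous (fun t => F0 t (Y ^~ t) k p) by case: bb.
  apply: ccontinuousD; last first.
    case: (k) => [|k']; first exact: ccontinuous_cst.
    by apply: ccontinuousM; [exact: ccontinuous_cst | exact: ccx].
  apply: ccontinuousD.
    by apply: ccontinuousM; [exact: ccontinuous_cst | exact: ccx].
  by apply: ccontinuous_sum => q; apply: ccontinuousM; [exact: b_cont | exact: ccx].
have [Y [Y00 DY]] := picard K0 lipF bndF contF.
exists (fun k p t => cx (Y ^~ t) k p); split.
- by move=> p; rewrite /cx !Y00 /Y0 /=; case: (y0 p).
- by move=> k p; rewrite /cx !Y00 /Y0.
- by move=> k p t t0; split; [exact: (DY (k, p, true)) | exact: (DY (k, p, false))].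
Qed.

(** Taylor terms are subtracted one at a time. Each remainder [U1], [U2], [U3] starts at 0 and
    solves the system at [z] forced by [w * lam] times the previous one, so each [system_forced]
    gains a factor [nsq w]. *)
Theorem entire_system : exists E : C R -> I -> R -> C R,
  [/\ forall z p, E z p 0 = y0 p,
      forall z p t, 0 <= t -> has_cderiv (E z p) t (rhs z t (E z ^~ t) p) &
      forall p x, 0 <= x -> holo2 (fun z => E z p x)].
Proof.
pose y z := projT1 (cid (taylor_system z)).
have yi z : forall p, y z 0%N p 0 = y0 p by have [] := projT2 (cid (taylor_system z)).
have yi' z : forall k p, y z k.+1 p 0 = 0 by have [] := projT2 (cid (taylor_system z)).
have Dy z : forall k p t, 0 <= t -> has_cderiv (y z k p) t (rhs z t (y z k ^~ t) p +
    (if k is k'.+1 then lam p * y z k' p t else 0)).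
  by have [] := projT2 (cid (taylor_system z)).
exists (fun z => y z 0%N); split => //.
  by move=> z p t t0; have := Dy z 0%N p t t0; rewrite addr0.
move=> p x x0 z; exists (y z 1%N p x), (y z 2%N p x).
pose N0 := \sum_p nsq (y0 p).
have N00 : 0 <= N0 by apply: sumr_ge0 => q _; exact: nsq_ge0.
(* The extra 4 in the rate covers the shift from [z] to [z + w], as [|Im w| <= 1]. *)
pose B0 := N0 * expR ((rate z + 4) * x).
pose k := x * expR ((rate z + 1) * x).
have k0 : 0 <= k by rewrite mulr_ge0 ?expR_ge0.
have B00 : 0 <= B0 by rewrite mulr_ge0 ?expR_ge0.
exists (4 * (4 * (4 * B0 * k) * k) * k) => w w1.
have w0 := nsq_ge0 w.
have rhsB t (u u' : I -> C R) q : rhs z t u q - rhs z t u' q = rhs z t (fun q => u q - u' q) q.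
  rewrite /rhs mulrBr.
  have -> : \sum_q0 b q q0 t * (u q0 - u' q0) =
      \sum_q0 b q q0 t * u q0 - \sum_q0 b q q0 t * u' q0.
    by rewrite -sumrB; apply: eq_bigr => ? _; rewrite mulrBr.
  by ring.
have rhsZ t c (u : I -> C R) q : c * rhs z t u q = rhs z t (fun q => c * u q) q.
  rewrite /rhs mulrDr mulr_sumr; congr (_ + _); first by ring.
  by apply: eq_bigr => ? _; ring.
pose U0 q t := y (z + w) 0%N q t.
pose U1 q t := U0 q t - y z 0%N q t.
pose U2 q t := U1 q t - w * y z 1%N q t.
pose U3 q t := U2 q t - w ^+ 2 * y z 2%N q t.
have DU1 q t : 0 <= t -> has_cderiv (U1 q) t (rhs z t (U1 ^~ t) q + w * lam q * U0 q t).
  move=> t0; have := has_cderivB (Dy (z + w) 0%N q t t0) (Dy z 0%N q t t0).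
  rewrite !addr0; apply: has_cderiv_eq; rewrite -rhsB /rhs /U0; ring.
have DU2 q t : 0 <= t -> has_cderiv (U2 q) t (rhs z t (U2 ^~ t) q + w * lam q * U1 q t).
  move=> t0; have := has_cderivB (DU1 q t t0) (has_cderivZ w (Dy z 1%N q t t0)).
  apply: has_cderiv_eq.
  have -> : rhs z t (U2 ^~ t) q = rhs z t (U1 ^~ t) q - w * rhs z t (y z 1%N ^~ t) q.
    by rewrite rhsZ rhsB.
  have -> : U1 q t = U0 q t - y z 0%N q t by [].
  ring.
have DU3 q t : 0 <= t -> has_cderiv (U3 q) t (rhs z t (U3 ^~ t) q + w * lam q * U2 q t).
  move=> t0; have := has_cderivB (DU2 q t t0) (has_cderivZ (w ^+ 2) (Dy z 2%N q t t0)).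
  apply: has_cderiv_eq.
  have -> : rhs z t (U3 ^~ t) q = rhs z t (U2 ^~ t) q - w ^+ 2 * rhs z t (y z 2%N ^~ t) q.
    by rewrite rhsZ rhsB.
  have -> : U2 q t = U1 q t - w * y z 1%N q t by [].
  ring.
have gb (u : I -> R -> C R) (G : R) : 
    (forall t, 0 <= t -> t <= x -> \sum_q nsq (u q t) <= G) ->
    forall t, 0 <= t -> t <= x -> \sum_q nsq (w * lam q * u q t) <= 4 * nsq w * G.
  move=> hu t t0 tx; apply: (@le_trans _ _ (\sum_q 4 * nsq w * nsq (u q t))).
    apply: ler_sum => q _; rewrite !nsqM [4 * nsq w]mulrC.
    by rewrite ler_wpM2r ?nsq_ge0// ler_wpM2l.
  by rewrite -mulr_sumr ler_wpM2l ?hu// mulr_ge0.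
have b0 t : 0 <= t -> t <= x -> \sum_q nsq (U0 q t) <= B0.
  move=> t0 tx.
  have := @system_growth (z + w) U0 t t0 _ _.
  rewrite [X in _ -> _ -> _ <= X * _](_ : _ = N0); last first.
    by apply: eq_bigr => q _; rewrite /U0 yi.
  have DU0 q s : 0 <= s -> has_cderiv (U0 q) s (rhs (z + w) s (U0 ^~ s) q).
    by move=> s0; have := Dy (z + w) 0%N q s s0; rewrite addr0.
  move=> h; apply: (le_trans (h _ _)).
  - by move=> q; exact: has_cderiv_cwithin (DU0 q).
  - by move=> q s s0 _; exact: DU0 (ltW s0).
  rewrite ler_wpM2l// ler_expR ler_pM ?rate_ge0//.
  rewrite /rate ImD -addrA [2 * _ * _ + 4]addrC addrA lerD2r.
  have := ler_normD (complex.Im z) (complex.Im w).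
  suff : `|complex.Im w| <= 1 by lra.
  rewrite -(@ler_pXn2r _ 2)// ?nnegrE// real_normK ?num_real// expr1n.
  by apply: le_trans w1; rewrite /nsq lerDr sqr_ge0.
have b1 := @system_forced z U1 (fun q t => w * lam q * U0 q t) _ x x0 _ _ DU1 (gb U0 _ b0).
have {}b1 : forall t, 0 <= t -> t <= x -> \sum_q nsq (U1 q t) <= 4 * B0 * k * nsq w.
  move=> t t0 tx; have := b1 _ _ t t0 tx; rewrite -/k => h.
  apply: (le_trans (h _ _)); first by rewrite !mulr_ge0.
  - by move=> q; rewrite /U1 /U0 !yi subrr.
  by rewrite le_eqVlt; apply/orP; left; apply/eqP; ring.
have c1 : 0 <= 4 * B0 * k by rewrite !mulr_ge0.
have b2 := @system_forced z U2 (fun q t => w * lam q * U1 q t) _ x x0 _ _ DU2 (gb U1 _ b1).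
have {}b2 : forall t, 0 <= t -> t <= x ->
    \sum_q nsq (U2 q t) <= 4 * (4 * B0 * k) * k * nsq w ^+ 2.
  move=> t t0 tx; have := b2 _ _ t t0 tx; rewrite -/k => h.
  apply: (le_trans (h _ _)).
  - by apply: mulr_ge0; [rewrite mulr_ge0 | apply: mulr_ge0].
  - by move=> q; rewrite /U2 /U1 /U0 !yi yi' subrr mulr0 subrr.
  by rewrite le_eqVlt; apply/orP; left; apply/eqP; ring.
have c2 : 0 <= 4 * (4 * B0 * k) * k by apply: mulr_ge0 => //; apply: mulr_ge0.
have b3 := @system_forced z U3 (fun q t => w * lam q * U2 q t) _ x x0 _ _ DU3 (gb U2 _ b2).
have {}b3 : \sum_q nsq (U3 q x) <= 4 * (4 * (4 * B0 * k) * k) * k * nsq w ^+ 3.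
  have := b3 _ _ x x0 (lexx x); rewrite -/k => h.
  apply: (le_trans (h _ _)).
  - by apply: mulr_ge0; [rewrite mulr_ge0 | apply: mulr_ge0; rewrite ?exprn_ge0].
  - by move=> q; rewrite /U3 /U2 /U1 /U0 !yi !yi' subrr !mulr0 !subrr.
  by rewrite le_eqVlt; apply/orP; left; apply/eqP; ring.
apply: le_trans b3; rewrite (bigD1 p)//=.
have -> : y (z + w) 0%N p x - (y z 0%N p x + y z 1%N p x * w + y z 2%N p x * w ^+ 2) = U3 p x.
  by rewrite /U3 /U2 /U1 /U0; ring.
by rewrite lerDl; apply: sumr_ge0 => q _; exact: nsq_ge0.
Qed.

End Existence.
End LinearSystem.

(** * Energy estimates for the Dirac system *)

Section ScalarComparison.
Context {R : realType}.
Implicit Types (N dN : R -> R) (k t x : R).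

(** In contrast with [gronwall], the rate [k] may be negative, as decaying solutions require. *)
Lemma expR_upper N dN k x : 0 <= x -> {within `[0, x], continuous N} ->
  (forall t, 0 < t -> t < x -> is_derive t 1 N (dN t)) ->
  (forall t, 0 < t -> t < x -> dN t <= k * N t) -> N x <= N 0 * expR (k * x).
Proof.
move=> x0 cN DN hN.
pose F t := - (N t * expR (- k * t)).
have DF t : 0 < t -> t < x -> is_derive t 1 F (- ((dN t - k * N t) * expR (- k * t))).
  move=> t0 tx; have := DN t t0 tx; have := is_derive_expRM (- k) t => ? ?.
  have -> : F = - (N * (fun t => expR (- k * t))) by apply/funext.
  by apply: is_derive_eq; rewrite -![_ *: _]/(_ * _); ring.
have cF : {within `[0, x], continuous F}.
  move=> t; apply: cvgN; apply: cvgM; first exact: cN.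
  apply: continuous_subspaceT => s.
  exact: is_derive_continuous (is_derive_expRM (- k) s).
have : F 0 <= F x.
  apply: (derive_ge0_le x0 cF DF) => t t0 tx; have := hN t t0 tx => h.
  by rewrite -mulNr mulr_ge0 ?expR_ge0//; lra.
rewrite /F mulr0 expR0 mulr1 lerN2 => h.
have ek : expR (- k * x) * expR (k * x) = 1 by rewrite -expRD mulNr addNr expR0.
by rewrite -[N x]mulr1 -ek mulrA ler_pM2r ?expR_gt0.
Qed.

Lemma expR_lower N dN k x : 0 <= x -> {within `[0, x], continuous N} ->
  (forall t, 0 < t -> t < x -> is_derive t 1 N (dN t)) ->
  (forall t, 0 < t -> t < x -> k * N t <= dN t) -> N 0 * expR (k * x) <= N x.
Proof.
move=> x0 cN DN hN.
have := @expR_upper (- N) (- dN) k x x0.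
rewrite !fctE mulNr lerN2; apply.
- by move=> t; apply: cvgN; exact: cN.
- by move=> t t0 tx; have := DN t t0 tx => ?; exact: is_deriveN.
- by move=> t t0 tx; rewrite mulrN lerN2; exact: hN.
Qed.

Section Energy.
Variables (N1 N2 c : R -> R) (eta M X : R).
Hypotheses (eta0 : 0 < eta) (M0 : 0 <= M) (X0 : 0 <= X).
Hypothesis cN1 : {within `[0, X], continuous N1}.
Hypothesis cN2 : {within `[0, X], continuous N2}.
Hypothesis N1_ge0 : forall t, 0 <= N1 t.
Hypothesis N2_ge0 : forall t, 0 <= N2 t.
Hypothesis DN1 : forall t, 0 < t -> t < X -> is_derive t 1 N1 (- (2 * eta) * N1 t + c t).
Hypothesis DN2 : forall t, 0 < t -> t < X -> is_derive t 1 N2 (2 * eta * N2 t + c t).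
Hypothesis c_le : forall t, 0 < t -> t < X -> forall k, 0 < k ->
  `|c t| <= M * (k * N1 t + N2 t / k).

Let c_le1 t : 0 < t -> t < X -> - (M * (N1 t + N2 t)) <= c t <= M * (N1 t + N2 t).
Proof. by move=> t0 tX; have := c_le t0 tX ltr01; rewrite divr1 mul1r ler_norml. Qed.

(** A crude bound valid without any cone condition; it makes the fundamental matrix injective. *)
Lemma energy_lower : (N1 0 + N2 0) * expR (- (2 * eta + 2 * M) * X) <= N1 X + N2 X.
Proof.
have := @expR_lower (N1 + N2) _ (- (2 * eta + 2 * M)) X X0; rewrite !fctE; apply.
- by move=> t; apply: cvgD; [exact: cN1 | exact: cN2].
- move=> t t0 tX; have := DN1 t0 tX; have := DN2 t0 tX => ? ?; exact: is_deriveD.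
move=> t t0 tX /=; have /andP[a b] := c_le1 t0 tX.
have e1 : 0 <= eta * N1 t by rewrite mulr_ge0 ?(ltW eta0).
have e2 : 0 <= eta * N2 t by rewrite mulr_ge0 ?(ltW eta0).
have e3 : 0 <= M * N1 t by rewrite mulr_ge0.
have e4 : 0 <= M * N2 t by rewrite mulr_ge0.
lra.
Qed.

(** The comparison [N2 <= N1] comes from the contractivity of Weyl solutions. It bounds the cross
    term by [2 * M * N1], a mere perturbation of the rate. *)
Lemma decaying_energy : (forall t, 0 <= t -> N2 t <= N1 t) ->
  N1 0 * expR (- (2 * eta + 2 * M) * X) <= N1 X /\
  N1 X <= N1 0 * expR ((- (2 * eta) + 2 * M) * X).
Proof.
move=> N21; split.
  apply: (expR_lower X0 cN1 DN1) => t t0 tX; have /andP[a b] := c_le1 t0 tX.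
  by have : M * N2 t <= M * N1 t by [rewrite ler_wpM2l// N21// ltW]; lra.
apply: (expR_upper X0 cN1 DN1) => t t0 tX; have /andP[a b] := c_le1 t0 tX.
by have : M * N2 t <= M * N1 t by [rewrite ler_wpM2l// N21// ltW]; lra.
Qed.

(** The cone is invariant: with weight [kap^-1] the cross term is at most
    [(M / kap) * N1 + M * kap * N2], which the two diagonal terms absorb when [M <= 2 * eta * kap],
    so [N1 - kap ^+ 2 * N2] cannot increase. *)
Lemma growing_cone kap : 0 < kap -> kap <= 1 -> M <= 2 * eta * kap -> N1 0 = 0 ->
  forall x, 0 <= x -> x <= X -> N1 x <= kap ^+ 2 * N2 x.
Proof.
move=> k0 k1 Mk N10 x x0 xX.
have sub : `[0, x]%classic `<=` `[0, X]%classic by apply: subset_itv; rewrite bnd_simp.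
have := @expR_upper (N1 - kap ^+ 2 \*: N2) (fun t => (- (2 * eta) * N1 t + c t) -
  kap ^+ 2 * (2 * eta * N2 t + c t)) 0 x x0.
rewrite !fctE mul0r expR0 mulr1 N10 sub0r => h.
suff H : N1 x - kap ^+ 2 * N2 x <= - (kap ^+ 2 * N2 0).
  have : 0 <= kap ^+ 2 * N2 0 by rewrite mulr_ge0 ?sqr_ge0.
  by lra.
apply: h.
- move=> t; apply: cvgB; first exact: (continuous_subspaceW sub cN1).
  by apply: cvgM; [exact: cvg_cst | exact: (continuous_subspaceW sub cN2)].
- move=> t t0 tx; have tX := lt_le_trans tx xX.
  have := DN1 t0 tX; have := DN2 t0 tX => ? ?.
  exact: is_deriveB.
move=> t t0 tx; have tX := lt_le_trans tx xX; rewrite mul0r.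
have := c_le t0 tX k0; have := @c_le t t0 tX kap^-1; rewrite invr_gt0 invrK => /(_ k0).
rewrite ler_norml => /andP[_ a] _.
have k2 : 0 <= 1 - kap ^+ 2 by rewrite subr_ge0 expr_le1// ltW.
have k21 : 1 - kap ^+ 2 <= 1 by have := sqr_ge0 kap; lra.
set A := M * (kap^-1 * N1 t + N2 t * kap) in a.
have A0 : 0 <= A by rewrite mulr_ge0// addr_ge0 ?mulr_ge0 ?invr_ge0 ?(ltW k0).
have cA : (1 - kap ^+ 2) * c t <= A.
  apply: (@le_trans _ _ ((1 - kap ^+ 2) * A)); first by rewrite ler_wpM2l.
  by rewrite ler_piMl.
have AE : A = (M / kap) * N1 t + M * kap * N2 t by rewrite /A; ring.
have Mk2 : M / kap <= 2 * eta by rewrite ler_pdivrMr.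
have i1 : (M / kap) * N1 t <= 2 * eta * N1 t by rewrite ler_wpM2r.
have i2 : M * kap * N2 t <= 2 * eta * kap * kap * N2 t.
  by rewrite ler_wpM2r// ler_wpM2r// ltW.
rewrite expr2 in cA *; lra.
Qed.

Lemma growing_energy : M <= 2 * eta -> N1 0 = 0 ->
  N2 0 * expR ((2 * eta - 2 * M) * X) <= N2 X /\
  N2 X <= N2 0 * expR ((2 * eta + 2 * M) * X).
Proof.
move=> Me N10.
have N12 t : 0 <= t -> t <= X -> N1 t <= N2 t.
  move=> t0 tX; have := @growing_cone 1 ltr01 (lexx 1) _ N10 t t0 tX.
  by rewrite mulr1 expr1n mul1r; apply.
split.
  apply: (expR_lower X0 cN2 DN2) => t t0 tX; have /andP[a b] := c_le1 t0 tX.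
  have : M * N1 t <= M * N2 t by rewrite ler_wpM2l// N12// ltW.
  by lra.
apply: (expR_upper X0 cN2 DN2) => t t0 tX; have /andP[a b] := c_le1 t0 tX.
have : M * N1 t <= M * N2 t by rewrite ler_wpM2l// N12// ltW.
by lra.
Qed.

End Energy.
End ScalarComparison.

Section DiracSystem.
Context {R : realType} (m1 m2 : nat).
Implicit Types (v : R -> 'M[C R]_(m1, m2)) (z : C R) (u : R -> 'M[C R]_(m1 + m2)).

Lemma continuous_Re : continuous (@complex.Re R : C R -> R).
Proof.
move=> z A [e /= e0 hA]; exists (e%:C)%C; first by rewrite /= ltcR.
move=> w h; apply: hA; rewrite /= -ltcR -ReN -ReD; apply: le_lt_trans h.
exact: normc_ge_Re.
Qed.

Lemma continuous_Im : continuous (@complex.Im R : C R -> R).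
Proof.
move=> z A [e /= e0 hA]; exists (e%:C)%C; first by rewrite /= ltcR.
move=> w h; apply: hA; rewrite /= -ltcR -ImN -ImD; apply: le_lt_trans h.
have -> : complex.Im (z - w) = complex.Re (- 'i * (z - w)) by rewrite !ReIm; ring.
apply: (le_trans (normc_ge_Re _)).
by rewrite -[X in X <= _]/(`|(- 'i * (z - w) : C R)|) normrM normrN normCi mul1r.
Qed.

Lemma coef_block z (V : 'M[C R]_(m1, m2)) :
  ('i : C R) *: (z *: @Jmat R m1 m2 + @Jmat R m1 m2 *m Vmat V) =
  block_mx ('i * z)%:M ('i *: V) (- ('i *: map_mx Num.conj V^T)) (- ('i * z)%:M).
Proof.
rewrite /Jmat /Vmat mulmx_block !mul1mx !mul0mx !mulNmx !mul1mx !addr0 !add0r oppr0.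
rewrite scale_block_mx add_block_mx scale_block_mx !scaler0 !addr0 !add0r.
by rewrite !scalerN !scale_scalar_mx !mulr1.
Qed.

Definition top (y : 'cV[C R]_(m1 + m2)) i := y (lshift m2 i) 0.
Definition bot (y : 'cV[C R]_(m1 + m2)) j := y (rshift m1 j) 0.

Lemma coef_top z V (y : 'cV[C R]_(m1 + m2)) i :
  top (('i : C R) *: (z *: @Jmat R m1 m2 + @Jmat R m1 m2 *m Vmat V) *m y) i =
  'i * z * top y i + \sum_j 'i * V i j * bot y j.
Proof.
rewrite coef_block /top -{1}(vsubmxK y) mul_block_col col_mxEu mxE mul_scalar_mx !mxE.
by congr (_ + _); apply: eq_bigr => j _; rewrite !mxE.
Qed.

Lemma coef_bot z V (y : 'cV[C R]_(m1 + m2)) j :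
  bot (('i : C R) *: (z *: @Jmat R m1 m2 + @Jmat R m1 m2 *m Vmat V) *m y) j =
  - ('i * z * bot y j) - \sum_i 'i * Num.conj (V i j) * top y i.
Proof.
rewrite coef_block /bot -{1}(vsubmxK y) mul_block_col col_mxEd addrC.
rewrite mulNmx mul_scalar_mx mulNmx !mxE; congr (_ - _).
by apply: eq_bigr => i _; rewrite !mxE.
Qed.

Definition topN (y : R -> 'cV[C R]_(m1 + m2)) t := \sum_i nsq (top (y t) i).
Definition botN (y : R -> 'cV[C R]_(m1 + m2)) t := \sum_j nsq (bot (y t) j).
(** One term drives both energies with the same sign, because the part of the coefficient free of
    [z] is Hermitian. *)
Definition crossN v (y : R -> 'cV[C R]_(m1 + m2)) t : R :=
  \sum_i \sum_j 2 * complex.Re (Num.conj (top (y t) i) * ('i * v t i j * bot (y t) j)).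

Section Vector.
Variables (v : R -> 'M[C R]_(m1, m2)) (z : C R) (u : R -> 'M[C R]_(m1 + m2)).
Hypothesis fu : fund_sol v z u.
Variable a : 'cV[C R]_(m1 + m2).
Let y t := u t *m a.

Lemma fund_cwithin x i j : cwithin x (fun t => u t i j).
Proof.
have [_ [cu _]] := fu.
have sub : (`[0, x]%classic : set R) `<=` `[0, +oo[%classic.
  by move=> t; rewrite /= !in_itv/= andbT => /andP[].
have c := continuous_subspaceW sub (cu i j).
split=> t.
  apply: (@continuous_comp (subspace `[0, x]) (C R) R (fun t => u t i j) (@complex.Re R)).
    exact: c.
  exact: continuous_Re.
apply: (@continuous_comp (subspace `[0, x]) (C R) R (fun t => u t i j) (@complex.Im R)).
  exact: c.
exact: continuous_Im.
Qed.

Lemma cwithin_sum (I : Type) (r : seq I) x (F : I -> R -> C R) :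
  (forall i, cwithin x (F i)) -> cwithin x (fun t => \sum_(i <- r) F i t).
Proof.
move=> h; split.
  have -> : (fun t => complex.Re (\sum_(i <- r) F i t)) =
      (fun t => \sum_(i <- r) complex.Re (F i t)) by apply/funext => t; exact: Re_sum.
  by apply: within_bigsum => i; exact: (h i).1.
have -> : (fun t => complex.Im (\sum_(i <- r) F i t)) =
    (fun t => \sum_(i <- r) complex.Im (F i t)) by apply/funext => t; exact: Im_sum.
by apply: within_bigsum => i; exact: (h i).2.
Qed.

Lemma cwithinM x (g h : R -> C R) : cwithin x g -> cwithin x h -> cwithin x (fun t => g t * h t).
Proof.
move=> [g1 g2] [h1 h2]; split.
  have -> : (fun t => complex.Re (g t * h t)) = (fun t => complex.Re (g t) * complex.Re (h t) -
      complex.Im (g t) * complex.Im (h t)) by apply/funext => t; exact: ReM.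
  by move=> t; apply: cvgB; apply: cvgM; [exact: g1|exact: h1|exact: g2|exact: h2].
have -> : (fun t => complex.Im (g t * h t)) = (fun t => complex.Re (g t) * complex.Im (h t) +
    complex.Im (g t) * complex.Re (h t)) by apply/funext => t; exact: ImM.
by move=> t; apply: cvgD; apply: cvgM; [exact: g1|exact: h2|exact: g2|exact: h1].
Qed.

Lemma cwithin_cst x (k : C R) : cwithin x (fun=> k).
Proof. by split=> t; exact: cvg_cst. Qed.

Lemma vector_cwithin x i : cwithin x (fun t => y t i 0).
Proof.
have -> : (fun t => y t i 0) = (fun t => \sum_k u t i k * a k 0).
  by apply/funext => t; rewrite /y mxE.
apply: cwithin_sum => k; apply: cwithinM; [exact: fund_cwithin | exact: cwithin_cst].
Qed.

Lemma vector_deriv (t : R) i : 0 < t -> has_cderiv (fun t => y t i 0) t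
  ((('i : C R) *: (z *: @Jmat R m1 m2 + @Jmat R m1 m2 *m Vmat (v t)) *m y t) i 0).
Proof.
move=> t0; have [_ [_ Du]] := fu.
have -> : (fun t => y t i 0) = (fun t => \sum_k u t i k * a k 0).
  by apply/funext => s; rewrite /y mxE.
rewrite /y mulmxA mxE; apply: has_cderiv_sum => k.
have := has_cderivM (Du t t0 i k) (has_cderiv_cst (a k 0) t).
by rewrite mulr0 addr0.
Qed.

Lemma topN_cont x : {within `[0, x], continuous (topN y)}.
Proof. by apply: within_nsq_sum => i; exact: vector_cwithin. Qed.

Lemma botN_cont x : {within `[0, x], continuous (botN y)}.
Proof. by apply: within_nsq_sum => i; exact: vector_cwithin. Qed.

Lemma topN_deriv (t : R) : 0 < t ->
  is_derive t 1 (topN y) (- (2 * complex.Im z) * topN y t + crossN v y t).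
Proof.
move=> t0.
have := is_derive_nsq_sum (fun i => vector_deriv (lshift m2 i) t0).
move=> h; apply: (is_derive_eq h); rewrite /topN /crossN mulr_sumr -big_split/=; apply: eq_bigr => i _.
have e := coef_top z (v t) (y t) i; rewrite /top in e *; rewrite e mulrDr ReD mulrDr; congr (_ + _).
  by rewrite /nsq !ReIm; ring.
by rewrite mulr_sumr Re_sum mulr_sumr.
Qed.

Lemma botN_deriv (t : R) : 0 < t ->
  is_derive t 1 (botN y) (2 * complex.Im z * botN y t + crossN v y t).
Proof.
move=> t0.
have := is_derive_nsq_sum (fun j => vector_deriv (rshift m1 j) t0).
move=> h; apply: (is_derive_eq h); rewrite /botN /crossN mulr_sumr exchange_big -big_split/=.
apply: eq_bigr => j _.
have e := coef_bot z (v t) (y t) j; rewrite /bot /top in e *; rewrite e mulrDr ReD mulrDr; congr (_ + _).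
  by rewrite /nsq !ReIm; ring.
rewrite mulrN ReN mulr_sumr Re_sum mulrN mulr_sumr -sumrN.
by apply: eq_bigr => i _; rewrite !ReIm; ring.
Qed.

(** Young inequality with weight [be * k] for each pair of entries; the sums cost [m2] and [m1]
    copies, both rounded up to [m1 + m2]. *)
Lemma crossN_le (t be k : R) : 0 < be -> (forall i j, nsq (v t i j) <= be ^+ 2) -> 0 < k ->
  `|crossN v y t| <= be * (m1 + m2)%:R * (k * topN y t + botN y t / k).
Proof.
move=> be0 hv k0.
have hk : 0 < be * k by rewrite mulr_gt0.
have term i j : `|2 * complex.Re (Num.conj (top (y t) i) * ('i * v t i j * bot (y t) j))| <=
    be * k * nsq (top (y t) i) + be / k * nsq (bot (y t) j).
  rewrite normrM (ger0_norm (ler0n R 2)); apply: (le_trans (Re_mulC_le _ _ hk)).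
  rewrite nsq_conj lerD2l !nsqM.
  have -> : nsq ('i : C R) = 1 by rewrite /nsq !ReIm; ring.
  rewrite mul1r ler_pdivrMr//.
  have -> : be / k * nsq (bot (y t) j) * (be * k) = be ^+ 2 * nsq (bot (y t) j).
    by field; rewrite gt_eqF.
  by rewrite ler_wpM2r ?nsq_ge0.
have top0 : 0 <= topN y t by apply: sumr_ge0 => i _; exact: nsq_ge0.
have bot0 : 0 <= botN y t by apply: sumr_ge0 => i _; exact: nsq_ge0.
apply: (@le_trans _ _ (m2%:R * (be * k * topN y t) + m1%:R * (be / k * botN y t))).
  apply: (@le_trans _ _ (\sum_i \sum_j (be * k * nsq (top (y t) i) + be / k * nsq (bot (y t) j)))).
    apply: (le_trans (ler_norm_sum _ _ _)); apply: ler_sum => i _.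
    by apply: (le_trans (ler_norm_sum _ _ _)); apply: ler_sum => j _.
  have gen (n1 : 'I_m1 -> R) (n2 : 'I_m2 -> R) (p q : R) : \sum_i \sum_j (p * n1 i + q * n2 j) =
      m2%:R * (p * \sum_i n1 i) + m1%:R * (q * \sum_j n2 j).
    have e i : \sum_j (p * n1 i + q * n2 j) = m2%:R * (p * n1 i) + q * \sum_j n2 j.
      by rewrite big_split/= sumr_const card_ord mulr_natl -mulr_sumr.
    under eq_bigr => i _ do rewrite e.
    by rewrite big_split/= sumr_const card_ord -!mulr_sumr (mulr_natl (q * _) m1).
  by rewrite (gen (fun i => nsq (top (y t) i)) (fun j => nsq (bot (y t) j))).
rewrite natrD.
have p1 : 0 <= be * m1%:R * (k * topN y t) by rewrite !mulr_ge0 ?ler0n ?(ltW be0) ?(ltW k0).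
have p2 : 0 <= be * m2%:R * (botN y t / k) by rewrite !mulr_ge0 ?invr_ge0 ?ler0n ?(ltW be0) ?(ltW k0).
lra.
Qed.

(** The cross terms cancel in the difference, whose derivative is [2 * Im z] times the total
    energy. *)
Lemma gap_mono : 0 < complex.Im z -> forall x x', 0 <= x -> x <= x' ->
  botN y x - topN y x <= botN y x' - topN y x'.
Proof.
move=> eta0 x x' x0 xx'.
have sub : `[x, x']%classic `<=` `[0, x']%classic by apply: subset_itv; rewrite bnd_simp.
have := @derive_ge0_le R (botN y - topN y) (fun t => 2 * complex.Im z * botN y t + crossN v y t -
  (- (2 * complex.Im z) * topN y t + crossN v y t)) x x' xx'.
rewrite !fctE; apply.
- move=> t; apply: cvgB; apply: (continuous_subspaceW sub).
    exact: botN_cont.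
  exact: topN_cont.
- move=> t xt _; have t0 := le_lt_trans x0 xt.
  have := topN_deriv t0; have := botN_deriv t0 => ? ?; exact: is_deriveB.
move=> t _ _.
have top0 : 0 <= complex.Im z * topN y t.
  by rewrite mulr_ge0 ?(ltW eta0)//; apply: sumr_ge0 => i _; exact: nsq_ge0.
have bot0 : 0 <= complex.Im z * botN y t.
  by rewrite mulr_ge0 ?(ltW eta0)//; apply: sumr_ge0 => i _; exact: nsq_ge0.
lra.
Qed.

End Vector.

Definition vn n (y : 'cV[C R]_n) : R := \sum_i nsq (y i 0).

Lemma vn_ge0 n (y : 'cV[C R]_n) : 0 <= vn y.
Proof. by apply: sumr_ge0 => i _; exact: nsq_ge0. Qed.

Lemma vn_mul n p (A : 'M[C R]_(n, p)) (y : 'cV[C R]_p) :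
  vn (A *m y) <= p%:R * vn y * \sum_i \sum_j nsq (A i j).
Proof.
rewrite /vn mulr_sumr; apply: ler_sum => i _; rewrite mxE.
apply: (le_trans (nsq_sum _)); rewrite card_ord -mulrA ler_wpM2l ?ler0n//.
rewrite mulr_sumr; apply: ler_sum => j _; rewrite nsqM mulrC ler_wpM2r ?nsq_ge0//.
by rewrite (bigD1 j)//= lerDl; apply: sumr_ge0 => k _; exact: nsq_ge0.
Qed.

Lemma vn_split (y : R -> 'cV[C R]_(m1 + m2)) t : vn (y t) = topN y t + botN y t.
Proof. by rewrite /vn big_split_ord. Qed.

(* If [botN > topN] somewhere, the gap stays bounded below by a positive
   constant, which is incompatible with square integrability. *)
Lemma weyl_contractive v z u (phi : 'M[C R]_(m2, m1)) : 0 < complex.Im z ->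
  fund_sol v z u ->
  (forall i j, L2_pos (fun x => (u x *m col_mx 1%:M phi) i j)) ->
  forall (a : 'cV[C R]_m1) x, 0 <= x ->
  botN (fun t => u t *m (col_mx 1%:M phi *m a)) x <=
  topN (fun t => u t *m (col_mx 1%:M phi *m a)) x.
Proof.
move=> eta0 fu L2 a x x0; set y := fun t => _.
rewrite leNgt; apply/negP => gap; pose d := botN y x - topN y x.
have d0 : 0 < d by rewrite subr_gt0.
have top0 t : 0 <= topN y t by apply: sumr_ge0 => i _; exact: nsq_ge0.
pose A := m1%:R * vn a + 1.
have A0 : 0 < A by rewrite ltr_wpDl// mulr_ge0 ?ler0n ?vn_ge0.
(* Square integrability is given entrywise, hence for [S], and Cauchy-Schwarz bounds the energy of
   the vector solution by [A * S t]. *)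
pose S t := \sum_i \sum_j nsq ((u t *m col_mx 1%:M phi) i j).
have S_ge t : x <= t -> d / A <= S t.
  move=> xt; have h1 := gap_mono fu (col_mx 1%:M phi *m a) eta0 x0 xt.
  have h2 : topN y t + botN y t <= A * S t.
    rewrite -vn_split /y mulmxA; apply: (le_trans (vn_mul _ _)).
    rewrite ler_wpM2r ?lerDl//; apply: sumr_ge0 => i _; apply: sumr_ge0 => j _; exact: nsq_ge0.
  rewrite ler_pdivrMr// mulrC; apply: le_trans h2.
  apply: (le_trans h1); rewrite -/y addrC lerD2r.
  by apply: le_trans (top0 t); rewrite oppr_le0.
have iS : (@lebesgue_measure R).-integrable `]0, +oo[ (fun t => (S t)%:E).
  have -> : (fun t => (S t)%:E) = (fun t => \sum_i \sum_j
      ((cabs ((u t *m col_mx 1%:M phi) i j)) ^+ 2)%:E)%E.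
    apply/funext => t; rewrite /S -sumEFin; apply: eq_bigr => i _.
    by rewrite -sumEFin; apply: eq_bigr => j _; rewrite cabs_sqr.
  apply: integrable_sum => // i _; apply: integrable_sum => // j _; exact: L2.
have {}iS : (@lebesgue_measure R).-integrable `]x, +oo[ (fun t => (S t)%:E).
  apply: integrableS iS => //.
  by move=> t /=; rewrite !in_itv/= !andbT; exact: le_lt_trans.
suff : (+oo <= \int[lebesgue_measure]_(t in `]x, +oo[) (S t)%:E)%E.
  by rewrite leNgt integrable_lty.
apply: (@le_trans _ _ (\int[lebesgue_measure]_(t in `]x, +oo[) (cst (d / A)%:E) t)%E).
  rewrite integral_cst//= lebesgue_measure_itv/= ltry.
  by rewrite addye// gt0_muley// lte_fin divr_gt0.
apply: ge0_le_integral => //.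
- by move=> t _; rewrite lee_fin divr_ge0 ?ltW.
- by have /integrableP[] := iS.
by move=> t /=; rewrite in_itv/= andbT => xt; rewrite lee_fin S_ge// ltW.
Qed.

End DiracSystem.

(** * The transfer matrix *)

Section Transfer.
Context {R : realType} (m1 m2 : nat).
Local Notation m := (m1 + m2)%N.
Implicit Types (V Vt : 'M[C R]_(m1, m2)) (v vt : R -> 'M[C R]_(m1, m2)) (z : C R).

Definition sgJ : 'rV[C R]_m := row_mx (const_mx 1) (const_mx (-1)).

Lemma JmatE : @Jmat R m1 m2 = diag_mx sgJ.
Proof. by rewrite diag_mx_row !diag_const_mx /Jmat raddfN. Qed.

Lemma sgJl i : sgJ 0 (lshift m2 i) = 1. Proof. by rewrite row_mxEl mxE. Qed.
Lemma sgJr j : sgJ 0 (rshift m1 j) = -1. Proof. by rewrite row_mxEr mxE. Qed.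

Lemma sgJ2 i : sgJ 0 i * sgJ 0 i = 1.
Proof. by case: (split_ordP i) => k ->; rewrite ?sgJl ?sgJr ?mulrNN ?mulr1. Qed.

Definition Gmat V : 'M[C R]_m :=
  block_mx 0 ('i *: V) (- ('i *: map_mx Num.conj V^T)) 0.

Definition Bmat z V : 'M[C R]_m := ('i : C R) *: (z *: @Jmat R m1 m2 + @Jmat R m1 m2 *m Vmat V).

Lemma BmatE z V : Bmat z V = ('i * z) *: diag_mx sgJ + Gmat V.
Proof.
rewrite -JmatE /Bmat coef_block /Jmat /Gmat scale_block_mx add_block_mx !addr0 !scaler0 !add0r.
by rewrite scalerN !scale_scalar_mx !mulr1.
Qed.

Lemma Gmat_ll V i j : Gmat V (lshift m2 i) (lshift m2 j) = 0.
Proof. by rewrite block_mxEul mxE. Qed.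
Lemma Gmat_rr V i j : Gmat V (rshift m1 i) (rshift m1 j) = 0.
Proof. by rewrite block_mxEdr mxE. Qed.
Lemma Gmat_lr V i j : Gmat V (lshift m2 i) (rshift m1 j) = 'i * V i j.
Proof. by rewrite block_mxEur mxE. Qed.
Lemma Gmat_rl V i j : Gmat V (rshift m1 j) (lshift m2 i) = - ('i * Num.conj (V i j)).
Proof. by rewrite block_mxEdl !mxE. Qed.

Definition GmatE := (Gmat_ll, Gmat_rr, Gmat_lr, Gmat_rl).

Lemma nsq_i : nsq ('i : C R) = 1. Proof. by rewrite /nsq !ReIm; ring. Qed.

Lemma nsq_Gmat V (be : R) i j : (forall i j, nsq (V i j) <= be ^+ 2) ->
  nsq (Gmat V i j) <= be ^+ 2.
Proof.
move=> hV; case: (split_ordP i) => k ->; case: (split_ordP j) => l ->; rewrite GmatE.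
- by rewrite nsq0 sqr_ge0.
- by rewrite nsqM nsq_i mul1r.
- by rewrite nsqN nsqM nsq_i mul1r nsq_conj.
- by rewrite nsq0 sqr_ge0.
Qed.

(* [i J V] is Hermitian and anticommutes with [J]. *)
Lemma sgJ_Gmat V i j : sgJ 0 i * Num.conj (Gmat V i j) = - (sgJ 0 j * Gmat V j i).
Proof.
case: (split_ordP i) => k ->; case: (split_ordP j) => l ->; rewrite !GmatE ?sgJl ?sgJr.
- by apply: ReIm_inj; rewrite !ReIm; ring.
- by apply: ReIm_inj; rewrite !ReIm; ring.
- by apply: ReIm_inj; rewrite !ReIm; ring.
- by apply: ReIm_inj; rewrite !ReIm; ring.
Qed.

Lemma Gmat_sgJ_eq V i j : sgJ 0 i = sgJ 0 j -> Gmat V i j = 0.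
Proof.
have n1 : (1 : C R) = -1 -> False.
  by move/eqP; rewrite eq_sym -subr_eq0 -opprD oppr_eq0 -(natrD _ 1 1) pnatr_eq0.
case: (split_ordP i) => k ->; case: (split_ordP j) => l ->; rewrite GmatE ?sgJl ?sgJr //.
by move=> h; case: (n1 (esym h)).
Qed.

Lemma ccontinuous_Gmat (V : R -> 'M[C R]_(m1, m2)) i j :
  (forall i j, ccontinuous (fun t => V t i j)) -> ccontinuous (fun t => Gmat (V t) i j).
Proof.
move=> cV; case: (split_ordP i) => k ->; case: (split_ordP j) => l ->.
- by under eq_fun do rewrite GmatE; exact: ccontinuous_cst.
- under eq_fun do rewrite GmatE.
  by apply: ccontinuousM => //; exact: ccontinuous_cst.
- under eq_fun do rewrite GmatE -mulNr.
  apply: ccontinuousM; first exact: ccontinuous_cst.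
  exact: ccontinuous_conj.
- by under eq_fun do rewrite GmatE; exact: ccontinuous_cst.
Qed.

Definition lamD (i : 'I_m) : C R := 'i * sgJ 0 i.
Definition bD (v : R -> 'M[C R]_(m1, m2)) (i k : 'I_m) (t : R) : C R := Gmat (v t) i k.

Lemma rhs_dirac v z t (Y : 'M[C R]_m) i j :
  rhs lamD (bD v) z t (fun k => Y k j) i = (Bmat z (v t) *m Y) i j.
Proof.
rewrite /rhs BmatE mulmxDl -scalemxAl mul_diag_mx [RHS]mxE [X in _ = X + _]mxE.
rewrite [X in _ = _ * X + _]mxE [X in _ = _ + X]mxE /lamD /bD; congr (_ + _).
by ring.
Qed.

Lemma Re_lamD i : complex.Re (lamD i) = 0.
Proof. by rewrite /lamD; case: (split_ordP i) => k ->; rewrite ?sgJl ?sgJr !ReIm; ring. Qed.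

Lemma lamD_le i : nsq (lamD i) <= 4.
Proof.
rewrite /lamD nsqM nsq_i mul1r; case: (split_ordP i) => k ->;
  by rewrite ?sgJl ?sgJr /nsq !ReIm; lra.
Qed.

Definition lamT (p : 'I_m * 'I_m) : C R := 'i * (sgJ 0 p.1 - sgJ 0 p.2).
(** The equation $E'=\widetilde B E-EB$ read entrywise: left multiplication couples entries of one
    column, right multiplication entries of one row. *)
Definition bT (v vt : R -> 'M[C R]_(m1, m2)) (p q : 'I_m * 'I_m) (t : R) : C R :=
  (if p.2 == q.2 then Gmat (vt t) p.1 q.1 else 0) -
  (if p.1 == q.1 then Gmat (v t) q.2 p.2 else 0).

Lemma rhs_entries v vt z t (y : 'I_m * 'I_m -> C R) i j :
  rhs lamT (bT v vt) z t y (i, j) = z * lamT (i, j) * y (i, j) +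
    (\sum_k Gmat (vt t) i k * y (k, j) - \sum_l y (i, l) * Gmat (v t) l j).
Proof.
rewrite /rhs; congr (_ + _).
have -> : \sum_q bT v vt (i, j) q t * y q = \sum_k \sum_l bT v vt (i, j) (k, l) t * y (k, l).
  by rewrite pair_bigA; apply: eq_bigr => -[].
rewrite /bT /=.
have e k : \sum_l ((if j == l then Gmat (vt t) i k else 0) -
    (if i == k then Gmat (v t) l j else 0)) * y (k, l) =
    Gmat (vt t) i k * y (k, j) - \sum_l (if i == k then Gmat (v t) l j * y (k, l) else 0).
  under eq_bigr => l _ do rewrite mulrBl.
  rewrite sumrB; congr (_ - _).
    rewrite (bigD1 j)//= eqxx big1 ?addr0// => l lj.
    by rewrite eq_sym (negbTE lj) mul0r.
  by apply: eq_bigr => l _; case: ifP => _; rewrite ?mul0r.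
rewrite (eq_bigr _ (fun k _ => e k)) sumrB; congr (_ - _).
rewrite (bigD1 i)//= eqxx [X in _ + X]big1 ?addr0 => [|k ki].
  by apply: eq_bigr => l _; rewrite mulrC.
by rewrite big1// => l _; rewrite eq_sym (negbTE ki).
Qed.

Lemma rhs_transfer v vt z t (y : 'I_m * 'I_m -> C R) i j :
  rhs lamT (bT v vt) z t y (i, j) =
  (Bmat z (vt t) *m (\matrix_(i, j) y (i, j)) - (\matrix_(i, j) y (i, j)) *m Bmat z (v t)) i j.
Proof.
rewrite rhs_entries !BmatE mulmxDl mulmxDr -scalemxAl -scalemxAr mul_diag_mx mul_mx_diag.
rewrite [RHS]mxE [X in _ = X + _]mxE [X in _ = _ + X]mxE [X in _ = _ - X]mxE.
rewrite [X in _ = X + _ - _]mxE [X in _ = _ * X + _ - _]mxE [X in _ = _ * (_ * X) + _ - _]mxE.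
rewrite [X in _ = _ - (X + _)]mxE [X in _ = _ - (_ * X + _)]mxE [X in _ = _ - (_ * (X * _) + _)]mxE.
rewrite [X in _ = _ + X - _]mxE [X in _ = _ - (_ + X)]mxE /lamT [fst _]/= [snd _]/=.
have -> : \sum_k Gmat (vt t) i k * (\matrix_(i, j) y (i, j)) k j = \sum_k Gmat (vt t) i k * y (k, j).
  by apply: eq_bigr => k _; rewrite mxE.
have -> : \sum_k (\matrix_(i, j) y (i, j)) i k * Gmat (v t) k j = \sum_l y (i, l) * Gmat (v t) l j.
  by apply: eq_bigr => k _; rewrite mxE.
by ring.
Qed.

Lemma Re_lamT p : complex.Re (lamT p) = 0.
Proof.
rewrite /lamT; case: p => i j /=; case: (split_ordP i) => k ->; case: (split_ordP j) => l ->;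
  by rewrite ?sgJl ?sgJr !ReIm; ring.
Qed.

Lemma lamT_le p : nsq (lamT p) <= 4.
Proof.
rewrite /lamT nsqM nsq_i mul1r; case: p => i j /=.
case: (split_ordP i) => k ->; case: (split_ordP j) => l ->;
  by rewrite ?sgJl ?sgJr /nsq !ReIm; lra.
Qed.

Lemma bT_le v vt (be : R) p q t : (forall t i j, nsq (v t i j) <= be ^+ 2) ->
  (forall t i j, nsq (vt t i j) <= be ^+ 2) -> nsq (bT v vt p q t) <= (2 * be) ^+ 2.
Proof.
move=> hv hvt; have b2 := sqr_ge0 be.
apply: (le_trans (nsqB_le _ _)); rewrite exprMn.
have h1 : nsq (if p.2 == q.2 then Gmat (vt t) p.1 q.1 else 0) <= be ^+ 2.
  by case: ifP => _; rewrite ?nsq0//; exact: nsq_Gmat.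
have h2 : nsq (if p.1 == q.1 then Gmat (v t) q.2 p.2 else 0) <= be ^+ 2.
  by case: ifP => _; rewrite ?nsq0//; exact: nsq_Gmat.
have -> : (2 : R) ^+ 2 = 4 by ring.
by lra.
Qed.

Lemma ccontinuous_bT v vt p q : (forall i j, ccontinuous (fun t => v t i j)) ->
  (forall i j, ccontinuous (fun t => vt t i j)) -> ccontinuous (bT v vt p q).
Proof.
move=> cv cvt; rewrite /bT.
have h1 : ccontinuous (fun t => if p.2 == q.2 then Gmat (vt t) p.1 q.1 else 0).
  by case: (p.2 == q.2); [exact: ccontinuous_Gmat | exact: ccontinuous_cst].
have h2 : ccontinuous (fun t => if p.1 == q.1 then Gmat (v t) q.2 p.2 else 0).
  by case: (p.1 == q.1); [exact: ccontinuous_Gmat | exact: ccontinuous_cst].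
apply: ccontinuousD h1 _.
have -> : (fun t => - (if p.1 == q.1 then Gmat (v t) q.2 p.2 else 0)) =
    (fun t => (-1) * (if p.1 == q.1 then Gmat (v t) q.2 p.2 else 0)).
  by apply/funext => t; rewrite mulN1r.
exact: ccontinuousM (ccontinuous_cst _) h2.
Qed.

(** By [sgJ_Gmat], conjugation turns each coefficient into the transposed one with signs that cancel
    in pairs. Left and right multiplication trade places, hence the exchange of [V] and [Vt]. *)
Lemma conj_transfer_rhs V Vt z k l (y : 'I_m * 'I_m -> C R) :
  sgJ 0 k * sgJ 0 l * Num.conj (z * lamT (l, k) * y (l, k) +
    (\sum_q Gmat V l q * y (q, k) - \sum_q y (l, q) * Gmat Vt q k)) =
  Num.conj z * lamT (k, l) * (sgJ 0 k * sgJ 0 l * Num.conj (y (l, k))) +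
    (\sum_q Gmat Vt k q * (sgJ 0 q * sgJ 0 l * Num.conj (y (l, q))) -
     \sum_q sgJ 0 k * sgJ 0 q * Num.conj (y (q, k)) * Gmat V q l).
Proof.
rewrite conjD conjM conjM conjD conjN !conj_sum mulrDr.
have -> : Num.conj (lamT (l, k)) = lamT (k, l).
  rewrite /lamT /=; case: (split_ordP k) => k' ->; case: (split_ordP l) => l' ->;
  by rewrite ?sgJl ?sgJr; apply: ReIm_inj; rewrite !ReIm; ring.
congr (_ + _); first by ring.
rewrite mulrBr addrC; congr (_ + _).
  rewrite -mulrN -sumrN mulr_sumr; apply: eq_bigr => q _; rewrite conjM.
  have -> : Num.conj (Gmat Vt q k) = - (sgJ 0 q * (sgJ 0 k * Gmat Vt k q)).
    by rewrite -mulrN -sgJ_Gmat mulrA sgJ2 mul1r.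
  rewrite [LHS](_ : _ = (sgJ 0 k * sgJ 0 k) * (sgJ 0 l * Num.conj (y (l, q)) *
    (sgJ 0 q * Gmat Vt k q))); last by ring.
  by rewrite sgJ2; ring.
rewrite -sumrN mulr_sumr; apply: eq_bigr => q _; rewrite conjM.
rewrite [LHS](_ : _ = sgJ 0 k * Num.conj (y (q, k)) * (sgJ 0 l * Num.conj (Gmat V l q))).
  by rewrite sgJ_Gmat; ring.
by ring.
Qed.

Definition id_data (p : 'I_m * 'I_m) : C R := (p.1 == p.2)%:R.

Definition transfer_sol v vt (E : C R -> 'I_m * 'I_m -> R -> C R) :=
  [/\ forall z p, E z p 0 = id_data p,
      forall z p t, 0 <= t -> has_cderiv (E z p) t (rhs lamT (bT v vt) z t (E z ^~ t) p) &
      forall p x, 0 <= x -> holo2 (fun z => E z p x)].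

Section Bounded.
Variables (v vt : R -> 'M[C R]_(m1, m2)) (be : R).
Hypothesis be0 : 0 < be.
Hypothesis v_le : forall t i j, nsq (v t i j) <= be ^+ 2.
Hypothesis vt_le : forall t i j, nsq (vt t i j) <= be ^+ 2.
Hypothesis cv : forall i j, ccontinuous (fun t => v t i j).
Hypothesis cvt : forall i j, ccontinuous (fun t => vt t i j).

Let be2 : 0 < 2 * be. Proof. by rewrite mulr_gt0. Qed.

Lemma transfer_exists : exists E, transfer_sol v vt E.
Proof.
exact: (entire_system Re_lamT lamT_le be2 (fun p q t => bT_le p q t v_le vt_le)
  (fun p q => ccontinuous_bT p q cv cvt) id_data).
Qed.

(** The rate depends on [z] through [|Im z|] only, so this yields both the exponential type and the
    bound on the real axis. *)
Lemma transfer_growth E z p x : transfer_sol v vt E -> 0 <= x ->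
  nsq (E z p x) <= (\sum_q nsq (id_data q)) * expR (rate ('I_m * 'I_m)%type (2 * be) z * x).
Proof.
move=> [E0 DE _] x0.
have := @system_growth R _ lamT (bT v vt) (2 * be) Re_lamT lamT_le be2
  (fun p q t => bT_le p q t v_le vt_le) z (E z) x x0
  (fun p => has_cderiv_cwithin x (DE z p)) (fun p t t0 _ => DE z p t (ltW t0)).
under [X in _ <= X * _]eq_bigr => q _ do rewrite E0.
apply: le_trans; rewrite (bigD1 p)//= lerDl; apply: sumr_ge0 => q _; exact: nsq_ge0.
Qed.

(* [E(t, conj z) = J E'(t, z)^* J], where [E'] is the transfer matrix with the
   roles of the two potentials exchanged. *)
Lemma transfer_conj E E' z i j x : transfer_sol v vt E -> transfer_sol vt v E' -> 0 <= x ->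
  E (Num.conj z) (i, j) x = sgJ 0 i * sgJ 0 j * Num.conj (E' z (j, i) x).
Proof.
move=> [E0 DE _] [E0' DE' _] x0.
pose w (p : 'I_m * 'I_m) t := sgJ 0 p.1 * sgJ 0 p.2 * Num.conj (E' z (p.2, p.1) t).
have Dw p t : 0 <= t -> has_cderiv (w p) t (rhs lamT (bT v vt) (Num.conj z) t (w ^~ t) p).
  case: p => k l t0.
  have h := has_cderivZ (sgJ 0 k * sgJ 0 l) (has_cderiv_conj (DE' z (l, k) t t0)).
  apply: (has_cderiv_eq _ h).
  have e1 := rhs_entries vt v z t (E' z ^~ t) l k.
  have e2 := rhs_entries v vt (Num.conj z) t (w ^~ t) k l.
  have e3 := conj_transfer_rhs (v t) (vt t) z k l (E' z ^~ t).
  apply: etrans (etrans _ e3) (esym e2).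
  exact: (congr1 (fun X => sgJ 0 k * sgJ 0 l * Num.conj X) e1).
have := @system_unique R _ lamT (bT v vt) (2 * be) Re_lamT lamT_le be2
  (fun p q t => bT_le p q t v_le vt_le) (Num.conj z) (E (Num.conj z)) w x x0
  (fun p => has_cderiv_cwithin x (DE (Num.conj z) p)) (fun p => has_cderiv_cwithin x (Dw p)) _
  (fun p t t0 _ => DE (Num.conj z) p t (ltW t0)) (fun p t t0 _ => Dw p t (ltW t0)) (i, j).
apply=> -[k l]; rewrite E0 /w /= E0' /id_data /= eq_sym.
have [->|_] := eqVneq l k; last by rewrite conjC0 mulr0.
by rewrite conjC1 mulr1 sgJ2.
Qed.

(** The product [E u] satisfies $(\widetilde B E-EB)u+EBu=\widetilde B Eu$ and starts at the
    identity, so uniqueness applies column by column. The fundamental solutions may belong to [v0]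
    and [vt0], which need to agree with the bounded potentials on [(0, x)] only. *)
Lemma transfer_fund E z x u ut (v0 vt0 : R -> 'M[C R]_(m1, m2)) : transfer_sol v vt E ->
  0 <= x -> (forall t, 0 < t -> t < x -> v0 t = v t) ->
  (forall t, 0 < t -> t < x -> vt0 t = vt t) ->
  fund_sol v0 z u -> fund_sol vt0 z ut ->
  (\matrix_(i, j) E z (i, j) x) *m u x = ut x.
Proof.
move=> [E0 DE _] x0 ev evt fu fut; apply/matrixP => i j.
pose U k t := \sum_l E z (k, l) t * u t l j.
have bD_le p q t : nsq (bD vt p q t) <= be ^+ 2 by exact: nsq_Gmat.
have := @system_unique R _ lamD (bD vt) be Re_lamD lamD_le be0 bD_le z U (fun k t => ut t k j) x x0.
rewrite !mxE; under eq_bigr => k _ do rewrite mxE.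
apply.
- move=> k; apply: cwithin_sum => l; apply: cwithinM.
    exact: has_cderiv_cwithin x (DE z (k, l)).
  exact: fund_cwithin fu x l j.
- by move=> k; exact: fund_cwithin fut x k j.
- move=> k; rewrite /U; have [-> _] := fu; have [-> _] := fut.
  rewrite (bigD1 k)//= big1 => [|l lk]; first by rewrite E0 /id_data /= eqxx mul1r addr0.
  by rewrite E0 /id_data /= eq_sym (negbTE lk) mul0r.
- move=> k t t0 tx.
  have Du l : has_cderiv (fun s => u s l j) t ((Bmat z (v t) *m u t) l j).
    have [_ [_ /(_ t t0 l j) h]] := fu; rewrite (ev _ t0 tx) in h; exact: h.
  have h := has_cderiv_sum (index_enum _) (fun l => has_cderivM (DE z (k, l) t (ltW t0)) (Du l)).
  apply: (has_cderiv_eq _ h).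
  pose Em : 'M[C R]_m := \matrix_(i, j) E z (i, j) t.
  have -> : U ^~ t = (fun k => (Em *m u t) k j).
    apply/funext => l; rewrite mxE; by apply: eq_bigr => q _; rewrite mxE.
  rewrite rhs_dirac.
  under eq_bigr => l _ do rewrite rhs_transfer.
  rewrite -/Em big_split/=.
  have -> : \sum_l (Bmat z (vt t) *m Em - Em *m Bmat z (v t)) k l * u t l j =
      ((Bmat z (vt t) *m Em - Em *m Bmat z (v t)) *m u t) k j by rewrite [RHS]mxE.
  have -> : \sum_l E z (k, l) t * (Bmat z (v t) *m u t) l j = (Em *m (Bmat z (v t) *m u t)) k j.
    by rewrite [RHS]mxE; apply: eq_bigr => l _; rewrite [Em k l]mxE.
  have -> : Bmat z (vt t) *m (Em *m u t) =
     (Bmat z (vt t) *m Em - Em *m Bmat z (v t)) *m u t + Em *m (Bmat z (v t) *m u t).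
    by rewrite mulmxBl !mulmxA subrK.
  by rewrite [RHS]mxE.
- move=> k t t0 tx; have [_ [_ /(_ t t0 k j) h]] := fut; rewrite (evt _ t0 tx) in h.
  by apply: (has_cderiv_eq _ h); rewrite rhs_dirac.
Qed.

End Bounded.
End Transfer.

(** * Boundedness of the transfer matrix along the ray *)

Section RayBound.
Context {R : realType} (m1 m2 : nat).
Local Notation m := (m1 + m2)%N.

Section OneSystem.
Variables (v : R -> 'M[C R]_(m1, m2)) (z : C R) (u : R -> 'M[C R]_m) (be x : R).
Hypotheses (eta0 : 0 < complex.Im z) (fu : fund_sol v z u) (be0 : 0 < be) (x0 : 0 <= x).
Hypothesis v_le : forall t, 0 < t -> t < x -> forall i j, nsq (v t i j) <= be ^+ 2.
Let M := be * m%:R.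
Let eta := complex.Im z.

Let M0 : 0 <= M. Proof. by rewrite mulr_ge0 ?ler0n ?ltW. Qed.
Let topN_ge0 (y : R -> 'cV[C R]_m) t : 0 <= topN y t.
Proof. by apply: sumr_ge0 => i _; exact: nsq_ge0. Qed.
Let botN_ge0 (y : R -> 'cV[C R]_m) t : 0 <= botN y t.
Proof. by apply: sumr_ge0 => i _; exact: nsq_ge0. Qed.

Let cross_le a (t : R) : 0 < t -> t < x -> forall k, 0 < k ->
  `|crossN v (fun t => u t *m a) t| <=
  M * (k * topN (fun t => u t *m a) t + botN (fun t => u t *m a) t / k).
Proof. by move=> t0 tx k k0; apply: crossN_le => //; exact: v_le. Qed.

Lemma vec_lower a : vn a * expR (- (2 * eta + 2 * M) * x) <= vn (u x *m a).
Proof.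
have := energy_lower eta0 M0 x0 (@topN_cont _ _ _ _ _ _ fu a x) (@botN_cont _ _ _ _ _ _ fu a x)
  (topN_ge0 _) (botN_ge0 _) (fun t t0 _ => topN_deriv fu a t0)
  (fun t t0 _ => botN_deriv fu a t0) (cross_le a).
rewrite -!vn_split.
by have [-> _] := fu; rewrite mul1mx.
Qed.

(** The kernel is trivial, because [vec_lower] bounds the image of a vector below by a positive
    multiple of its norm. *)
Lemma fund_sol_unit : u x \in unitmx.
Proof.
rewrite -unitmx_tr -row_free_unit; apply: inj_row_free => w hw.
have h : u x *m w^T = 0 by rewrite -[u x]trmxK -trmx_mul hw trmx0.
have := vec_lower w^T; rewrite h.
have -> : vn (0 : 'cV[C R]_m) = 0 by rewrite /vn big1// => i _; rewrite mxE nsq0.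
rewrite pmulr_lle0 ?expR_gt0// => le0.
have w0 : vn w^T = 0 by apply/eqP; rewrite eq_le le0 vn_ge0.
apply/rowP => i; rewrite mxE; apply: nsq_eq0; move/eqP: w0.
rewrite /vn psumr_eq0 => [/allP/(_ i)|k _]; last exact: nsq_ge0.
by rewrite mem_index_enum => /(_ isT) /eqP; rewrite mxE.
Qed.

(** The condition [M <= eta / 2] is the cone condition for [kap = 1 / 4], whence the 16. This narrow
    cone is transversal to the one containing the Weyl solutions. *)
Lemma growing_vec (b : 'cV[C R]_m2) : M <= eta / 2 ->
  let y t := u t *m col_mx 0 b in
  [/\ topN y x <= botN y x / 16, vn b * expR ((2 * eta - 2 * M) * x) <= botN y x &
      botN y x <= vn b * expR ((2 * eta + 2 * M) * x)].
Proof.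
move=> Me y.
have y0E : y 0 = col_mx 0 b by rewrite /y; have [-> _] := fu; rewrite mul1mx.
have top0 : topN y 0 = 0.
  by rewrite /topN big1// => i _; rewrite y0E /top col_mxEu mxE nsq0.
have bot0 : botN y 0 = vn b.
  by rewrite /botN /vn; apply: eq_bigr => i _; rewrite y0E /bot col_mxEd.
have Me2 : M <= 2 * eta by apply: (le_trans Me); have := eta0; rewrite -/eta; lra.
have [g1 g2] := growing_energy M0 x0 (@topN_cont _ _ _ _ _ _ fu (col_mx 0 b) x)
  (@botN_cont _ _ _ _ _ _ fu (col_mx 0 b) x)
  (topN_ge0 _) (botN_ge0 _) (fun t t0 _ => topN_deriv fu (col_mx 0 b) t0)
  (fun t t0 _ => botN_deriv fu (col_mx 0 b) t0) (cross_le (col_mx 0 b)) Me2 top0.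
rewrite -/eta -/y bot0 in g1 g2; split => //.
have k0 : (0 : R) < 4^-1 by rewrite invr_gt0.
have k1 : (4^-1 : R) <= 1 by rewrite invf_le1// ler1n.
have Mk : M <= 2 * eta * 4^-1 by apply: (le_trans Me); lra.
have := growing_cone M0 (@topN_cont _ _ _ _ _ _ fu (col_mx 0 b) x)
  (@botN_cont _ _ _ _ _ _ fu (col_mx 0 b) x)
  (topN_ge0 _) (botN_ge0 _) (fun t t0 _ => topN_deriv fu (col_mx 0 b) t0)
  (fun t t0 _ => botN_deriv fu (col_mx 0 b) t0) (cross_le (col_mx 0 b)) k0 k1 Mk top0 x0 (lexx x).
rewrite -/y => h; apply: (le_trans h).
by rewrite le_eqVlt; apply/orP; left; apply/eqP; field.
Qed.

Lemma decaying_vec (phi : 'M[C R]_(m2, m1)) (a : 'cV[C R]_m1) :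
  (forall i j, L2_pos (fun x => (u x *m col_mx 1%:M phi) i j)) ->
  let y t := u t *m (col_mx 1%:M phi *m a) in
  [/\ botN y x <= topN y x, vn a * expR (- (2 * eta + 2 * M) * x) <= topN y x &
      topN y x <= vn a * expR ((- (2 * eta) + 2 * M) * x)].
Proof.
move=> L2 y.
have y0E : y 0 = col_mx a (phi *m a).
  by rewrite /y; have [-> _] := fu; rewrite mul1mx mul_col_mx mul1mx.
have top0 : topN y 0 = vn a.
  by rewrite /topN /vn; apply: eq_bigr => i _; rewrite y0E /top col_mxEu.
have con t : 0 <= t -> botN y t <= topN y t by exact: (weyl_contractive eta0 fu L2).
have [g1 g2] := decaying_energy M0 x0 (@topN_cont _ _ _ _ _ _ fu (col_mx 1%:M phi *m a) x)
  (fun t t0 _ => topN_deriv fu (col_mx 1%:M phi *m a) t0)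
  (cross_le (col_mx 1%:M phi *m a)) con.
by rewrite -/eta -/y top0 in g1 g2; split => //; exact: con.
Qed.

End OneSystem.

Lemma vnD n (y w : 'cV[C R]_n) : vn (y + w) <= 2 * vn y + 2 * vn w.
Proof.
rewrite /vn !mulr_sumr -big_split/=; apply: ler_sum => i _; rewrite mxE; exact: nsqD_le.
Qed.

(** Triangle inequality for each block. Constant paths appear so that [topN] and [botN] can be
    applied to single vectors. *)
Lemma topN_bound (y w e : 'cV[C R]_m) : e = y + w ->
  topN (fun=> y) 0 <= 2 * vn e + 2 * topN (fun=> w) 0 /\
  botN (fun=> w) 0 <= 2 * vn e + 2 * botN (fun=> y) 0.
Proof.
move=> ->; split.
  have : topN (fun=> y) 0 <= 2 * topN (fun=> y + w) 0 + 2 * topN (fun=> w) 0.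
    rewrite /topN !mulr_sumr -big_split/=; apply: ler_sum => i _; rewrite /top.
    have -> : y (lshift m2 i) 0 = (y + w) (lshift m2 i) 0 - w (lshift m2 i) 0.
      by rewrite mxE addrK.
    exact: nsqB_le.
  move=> h; apply: (le_trans h); rewrite lerD2r ler_pM2l//.
  rewrite (vn_split (fun=> y + w) 0) lerDl; apply: sumr_ge0 => i _; exact: nsq_ge0.
have : botN (fun=> w) 0 <= 2 * botN (fun=> y + w) 0 + 2 * botN (fun=> y) 0.
  rewrite /botN !mulr_sumr -big_split/=; apply: ler_sum => i _; rewrite /bot.
  have -> : w (rshift m1 i) 0 = (y + w) (rshift m1 i) 0 - y (rshift m1 i) 0.
    by rewrite mxE addrC addKr.
  exact: nsqB_le.
move=> h; apply: (le_trans h); rewrite lerD2r ler_pM2l//.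
rewrite (vn_split (fun=> y + w) 0) lerDr; apply: sumr_ge0 => i _; exact: nsq_ge0.
Qed.

(** Column [j] of [E] is [E e] for a basis vector [e]. Writing [e] as [u x *m g] and splitting [g]
    into a Weyl part [a] and a growing part [b], transversality of the two cones bounds both pieces
    of [e] at [x], hence [a] and [b] at 0. For the second system the same [g] has Weyl part [a] and
    growing part [d + b]. *)
Lemma ray_bound (v vt : R -> 'M[C R]_(m1, m2)) z (u ut : R -> 'M[C R]_m)
    (phi phit : 'M[C R]_(m2, m1)) (be x K : R) (E : 'M[C R]_m) :
  0 < complex.Im z -> fund_sol v z u -> fund_sol vt z ut -> 0 < be -> 0 <= x ->
  (forall t, 0 < t -> t < x -> forall i j, nsq (v t i j) <= be ^+ 2) ->
  (forall t, 0 < t -> t < x -> forall i j, nsq (vt t i j) <= be ^+ 2) ->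
  (forall i j, L2_pos (fun x => (u x *m col_mx 1%:M phi) i j)) ->
  (forall i j, L2_pos (fun x => (ut x *m col_mx 1%:M phit) i j)) ->
  be * m%:R <= complex.Im z / 2 ->
  (forall i j, nsq (phi i j - phit i j) <= K * expR (- (4 * x * complex.Im z))) ->
  E *m u x = ut x ->
  forall i j, nsq (E i j) <=
    expR (4 * (be * m%:R) * x) * (12 + 8 * (3 * ((m1 * (m2 * m1))%:R * `|K|) + 8)).
Proof.
move=> eta0 fu fut be0 x0 v_le vt_le L2 L2t Me hphi EU i j.
set M := be * m%:R in Me *; set eta := complex.Im z in eta0 Me hphi *.
pose e : 'cV[C R]_m := delta_mx j 0.
have vne : vn e = 1.
  rewrite /vn (bigD1 j)//= big1 => [|k kj].
    by rewrite mxE !eqxx addr0 /nsq !ReIm; ring.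
  by rewrite mxE (negbTE kj) nsq0.
pose g := invmx (u x) *m e.
have ug : u x *m g = e by rewrite mulKVmx// (fund_sol_unit eta0 fu be0 x0 v_le).
pose a := usubmx g; pose b := dsubmx g - phi *m a.
have gE : g = col_mx 1%:M phi *m a + col_mx 0 b.
  by rewrite mul_col_mx mul1mx add_col_mx addr0 /b addrC subrK vsubmxK.
pose d := (phi - phit) *m a.
have gEt : g = col_mx 1%:M phit *m a + col_mx 0 (d + b).
  rewrite gE !mul_col_mx !mul1mx !add_col_mx !addr0 /d mulmxBl; congr (col_mx _ _).
  by rewrite [RHS]addrA [X in _ = X + _]subrKC.
have [y1 y2 y3] := decaying_vec eta0 fu be0 x0 v_le a L2.
have [w1 w2 w3] := growing_vec eta0 fu be0 x0 v_le b Me.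
have [yt1 yt2 yt3] := decaying_vec eta0 fut be0 x0 vt_le a L2t.
have [wt1 wt2 wt3] := growing_vec eta0 fut be0 x0 vt_le (d + b) Me.
rewrite -/M -/eta in y2 y3 w2 w3 yt2 yt3 wt2 wt3.
pose Y := u x *m (col_mx 1%:M phi *m a); pose W := u x *m col_mx 0 b.
have eYW : e = Y + W by rewrite -ug gE mulmxDr.
have [tb bb] := topN_bound eYW; rewrite vne in tb bb.
set A := topN _ x in y1 y2 y3; set B := botN _ x in w1 w2 w3.
(* From [A <= 2 + B / 8] and [B <= 2 + 2 * A]; the 1/16 of the narrow cone is what lets this loop
   close. *)
have A3 : A <= 3.
  rewrite -/(topN (fun t => u t *m (col_mx 1%:M phi *m a)) x) -/A in tb.
  rewrite -/(botN (fun t => u t *m col_mx 0 b) x) -/B in bb.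
  have tb' : A <= 2 * 1 + 2 * (B / 16) by apply: (le_trans tb); rewrite lerD2l ler_pM2l.
  have bb' : B <= 2 * 1 + 2 * A by apply: (le_trans bb); rewrite lerD2l ler_pM2l.
  by move: tb' bb'; clear; lra.
have B8 : B <= 8.
  have bb' : B <= 2 * 1 + 2 * A by apply: (le_trans bb); rewrite lerD2l ler_pM2l.
  by move: bb' A3; clear; lra.
(* Ratio of the upper to the lower exponential bound, the same for decaying and growing
   solutions. *)
set F := expR (4 * M * x).
have F0 : 0 < F by exact: expR_gt0.
have aF : vn a * expR ((- (2 * eta) + 2 * M) * x) <= 3 * F.
  have -> : expR ((- (2 * eta) + 2 * M) * x) = expR (- (2 * eta + 2 * M) * x) * F.
    by rewrite /F -expRD; congr expR; ring.
  by rewrite mulrA ler_pM2r//; exact: le_trans A3.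
have bF : vn b * expR ((2 * eta + 2 * M) * x) <= 8 * F.
  have -> : expR ((2 * eta + 2 * M) * x) = expR ((2 * eta - 2 * M) * x) * F.
    by rewrite /F -expRD; congr expR; ring.
  by rewrite mulrA ler_pM2r//; exact: le_trans B8.
(* Here the assumed decay acts: [exp(-4 x eta)] turns the growth factor on [d] into the decay factor
   on [a], already controlled by [aF]. *)
have dF : vn d * expR ((2 * eta + 2 * M) * x) <= 3 * ((m1 * (m2 * m1))%:R * `|K|) * F.
  have vd : vn d <= (m1 * (m2 * m1))%:R * `|K| * vn a * expR (- (4 * x * eta)).
    apply: (le_trans (vn_mul _ _)).
    have : \sum_k \sum_l nsq ((phi - phit) k l) <= (m2 * m1)%:R * (`|K| * expR (- (4 * x * eta))).
      apply: (@le_trans _ _ (\sum_(k < m2) \sum_(l < m1) `|K| * expR (- (4 * x * eta)))).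
        apply: ler_sum => k _; apply: ler_sum => l _; rewrite !mxE; apply: (le_trans (hphi k l)).
        by rewrite ler_wpM2r ?expR_ge0// ler_norm.
      under eq_bigr => k _ do rewrite sumr_const card_ord.
      by rewrite sumr_const card_ord -mulrnA [(m1 * m2)%N]mulnC [X in _ <= X]mulr_natl.
    move=> h; apply: (le_trans (ler_wpM2l _ h)); first by rewrite mulr_ge0 ?ler0n ?vn_ge0.
    by rewrite [(m1 * (m2 * m1))%:R]natrM le_eqVlt; apply/orP; left; apply/eqP; ring.
  apply: (le_trans (ler_wpM2r (expR_ge0 _) vd)).
  have -> : (m1 * (m2 * m1))%:R * `|K| * vn a * expR (- (4 * x * eta)) * expR ((2 * eta + 2 * M) * x) =
      (m1 * (m2 * m1))%:R * `|K| * (vn a * expR ((- (2 * eta) + 2 * M) * x)).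
    rewrite -!mulrA -expRD; do 3!congr (_ * _); congr expR; ring.
  have kk : 0 <= (m1 * (m2 * m1))%:R * `|K| by rewrite mulr_ge0 ?ler0n.
  apply: (le_trans (ler_wpM2l kk aF)).
  by rewrite le_eqVlt; apply/orP; left; apply/eqP; ring.
have Ee : E *m e = ut x *m (col_mx 1%:M phit *m a) + ut x *m col_mx 0 (d + b).
  by rewrite -mulmxDr -gEt -EU -mulmxA ug.
apply: (@le_trans _ _ (vn (E *m e))).
  rewrite /vn (bigD1 i)//= -colE mxE lerDl.
  by apply: sumr_ge0 => k _; exact: nsq_ge0.
rewrite Ee; apply: (le_trans (vnD _ _)).
rewrite (vn_split (fun t => ut t *m (col_mx 1%:M phit *m a)) x).
rewrite (vn_split (fun t => ut t *m col_mx 0 (d + b)) x).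
set At := topN _ x in yt1 yt2 yt3 *; set Bt := botN _ x in wt1 wt2 wt3 *.
set At' := botN _ x in yt1 *; set Bt' := topN _ x in wt1 *.
have vdb : vn (d + b) * expR ((2 * eta + 2 * M) * x) <=
    2 * (3 * ((m1 * (m2 * m1))%:R * `|K|) * F) + 2 * (8 * F).
  apply: (le_trans (ler_wpM2r (expR_ge0 _) (vnD _ _))).
  rewrite [X in X <= _](_ : _ = 2 * (vn d * expR ((2 * eta + 2 * M) * x)) +
    2 * (vn b * expR ((2 * eta + 2 * M) * x))); last by ring.
  by apply: lerD; rewrite ler_pM2l.
have Bt0 : 0 <= Bt by apply: sumr_ge0 => k _; exact: nsq_ge0.
have H1 := le_trans yt3 aF; have H2 := le_trans wt3 vdb.
by move: H1 H2 yt1 wt1 Bt0; clear; lra.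
Qed.

End RayBound.

(** * Uniqueness of the potential *)

Section Final.
Context {R : realType}.

(** Composing the extension with the projection of the line onto [[0, T]] keeps continuity and gives
    boundedness by compactness. *)
Lemma clamp_real (f : R -> R) (T : R) : 0 < T -> C1_pos_real f ->
  exists h : R -> R, exists B : R, [/\ continuous h, forall t, `|h t| <= B &
    forall t, 0 <= t -> t <= T -> h t = f t].
Proof.
move=> T0 [g [dg [_ gf]]].
have cg : continuous g.
  by move=> t; apply: differentiable_continuous; apply/derivable1_diffP.
pose cl t : R := Num.max 0 (Num.min T t).
have cl0 t : 0 <= cl t by rewrite le_max lexx.
have clT t : cl t <= T by rewrite ge_max (ltW T0) ge_min lexx.
have ccl : continuous cl.
  move=> t; apply: continuous_max; first exact: cst_continuous.
  by apply: continuous_min; [exact: cst_continuous | move=> ?; exact: cvg_id].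
have cg' : {within `[0, T], continuous (fun t => `|g t|)}.
  by apply: continuous_subspaceT => t; apply: cvg_norm; exact: cg.
have [c _ hc] := EVT_max (ltW T0) cg'.
exists (fun t => g (cl t)), `|g c|; split.
- by move=> t; apply: (@continuous_comp _ _ _ cl g); [exact: ccl | exact: cg].
- by move=> t; apply: hc; rewrite in_itv/= cl0 clT.
move=> t t0 tT; have -> : cl t = t by rewrite /cl (min_idPr tT) (max_idPr t0).
exact: gf.
Qed.

Lemma clamp_potential m1 m2 (v : R -> 'M[C R]_(m1, m2)) (T : R) : 0 < T -> C1_pos_mx v ->
  exists (w : R -> 'M[C R]_(m1, m2)) (be : R), [/\ 0 < be,
    forall t i j, nsq (w t i j) <= be ^+ 2,
    forall i j, ccontinuous (fun t => w t i j) &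
    forall t, 0 <= t -> t <= T -> w t = v t].
Proof.
move=> T0 hv.
pose hR i j := cid (clamp_real T0 (hv i j).1); pose hI i j := cid (clamp_real T0 (hv i j).2).
pose bR i j := projT1 (cid (projT2 (hR i j))); pose bI i j := projT1 (cid (projT2 (hI i j))).
have pR i j := projT2 (cid (projT2 (hR i j))); have pI i j := projT2 (cid (projT2 (hI i j))).
pose w t : 'M[C R]_(m1, m2) :=
  \matrix_(i, j) (Complex (projT1 (hR i j) t) (projT1 (hI i j) t) : C R).
pose be := 1 + \sum_i \sum_j (bR i j + bI i j).
have b0 i j : 0 <= bR i j + bI i j.
  have [_ r _] := pR i j; have [_ s _] := pI i j.
  by rewrite addr_ge0// ?(le_trans _ (r 0))// (le_trans _ (s 0)).
exists w, be; split.
- by rewrite ltr_wpDr// sumr_ge0// => i _; rewrite sumr_ge0.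
- move=> t i j; have [_ r _] := pR i j; have [_ s _] := pI i j.
  have bb : bR i j + bI i j <= be.
    apply: (@le_trans _ _ (\sum_j (bR i j + bI i j))).
      by rewrite (bigD1 j)//= lerDl sumr_ge0.
    apply: (@le_trans _ _ (\sum_i \sum_j (bR i j + bI i j))); last by rewrite lerDr.
    by rewrite (bigD1 i)//= lerDl; apply: sumr_ge0 => k _; exact: sumr_ge0.
  rewrite /nsq mxE /=; have := r t; have := s t; rewrite -/(bR i j) -/(bI i j).
  set a := projT1 (hR i j) t; set c := projT1 (hI i j) t => s1 r1.
  have n1 := normr_ge0 a; have n2 := normr_ge0 c.
  rewrite -(@real_normK _ a) ?num_real// -(@real_normK _ c) ?num_real//.
  apply: (@le_trans _ _ ((`|a| + `|c|) ^+ 2)).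
    by rewrite sqrrD addrAC lerDl mulrn_wge0// mulr_ge0.
  have be_ge0 : 0 <= be := le_trans (b0 i j) bb.
  rewrite ler_pXn2r ?nnegrE ?(addr_ge0 n1 n2)//.
  by apply: le_trans bb; exact: lerD.
- move=> i j; have [r _ _] := pR i j; have [s _ _] := pI i j.
  by split; under eq_fun do rewrite mxE.
- move=> t t0 tT; apply/matrixP => i j; rewrite mxE.
  have [_ _ r] := pR i j; have [_ _ s] := pI i j; rewrite r// s//.
  by case: (v t i j).
Qed.

Lemma has_cderiv_unique (g h : R -> C R) (a b x : R) dg dh : a < x -> x < b ->
  (forall t, a < t -> t < b -> g t = h t) -> has_cderiv g x dg -> has_cderiv h x dh -> dg = dh.
Proof.
move=> ax xb gh [g1 g2] [h1 h2].
have near_ab : \forall t \near x, a < t /\ t < b.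
  exists (Num.min (x - a) (b - x)) => /=; first by rewrite lt_min !subr_gt0 ax xb.
  move=> t /=; rewrite lt_min !ltr_norml => /andP[/andP[? ?] /andP[? ?]].
  by split; lra.
have e1 : \near x, complex.Re (g x) = complex.Re (h x).
  by apply: filterS near_ab => t [? ?]; rewrite gh.
have e2 : \near x, complex.Im (g x) = complex.Im (h x).
  by apply: filterS near_ab => t [? ?]; rewrite gh.
apply: ReIm_inj.
  by rewrite -(derive_val (is_derive := g1)) -(derive_val (is_derive := h1)); exact: near_eq_derive.
by rewrite -(derive_val (is_derive := g2)) -(derive_val (is_derive := h2)); exact: near_eq_derive.
Qed.

Lemma has_cderiv0_cst (g : R -> C R) (b x : R) : 0 <= x -> x < b ->
  (forall t, 0 <= t -> exists d, has_cderiv g t d) ->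
  (forall t, 0 < t -> t < b -> has_cderiv g t 0) -> g x = g 0.
Proof.
move=> x0 xb cg Dg.
have pos (f : R -> R) : (forall t, 0 <= t -> {for t, continuous f}) ->
    (forall t, 0 < t -> t < b -> is_derive t 1 f 0) -> f 0 <= f x.
  move=> cf Df; apply: (@derive_ge0_le R f (fun=> 0) 0 x x0) => //.
    exact: continuous_within_pos.
  by move=> t t0 tx; apply: Df => //; exact: lt_trans xb.
have eqf (f : R -> R) : (forall t, 0 <= t -> {for t, continuous f}) ->
    (forall t, 0 < t -> t < b -> is_derive t 1 f 0) -> f x = f 0.
  move=> cf Df; apply/eqP; rewrite eq_le pos// andbT -lerN2.
  apply: (pos (fun t => - f t)) => [t t0|t t0 tb].
    by apply: cvgN; exact: cf.
  by rewrite -oppr0; have := Df t t0 tb => ?; exact: is_deriveN.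
apply: ReIm_inj.
  apply: (eqf (fun t => complex.Re (g t))) => [t t0|t t0 tb].
    by have [d [h _]] := cg t t0; exact: is_derive_continuous h.
  by have [] := Dg t t0 tb.
apply: (eqf (fun t => complex.Im (g t))) => [t t0|t t0 tb].
  by have [d [_ h]] := cg t t0; exact: is_derive_continuous h.
by have [] := Dg t t0 tb.
Qed.

Section Borg.
Variables (m1 m2 : nat).
Local Notation m := (m1 + m2)%N.
Local Notation sg := (@sgJ R m1 m2 0).

(* The bound on the ray, the trivial bound on the real axis and the
   exponential type feed the Phragmen-Lindelof principle in both sectors. *)
Lemma transfer_upper_bounded (v vt w wt : R -> 'M[C R]_(m1, m2))
    (phi phit : C R -> 'M[C R]_(m2, m1)) (T c be x : R) E p :
  weyl_function v phi -> weyl_function vt phit ->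
  (forall eps : R, 0 < eps ->
     exists K : R, exists t0 : R, forall t : R, t0 <= t -> forall i j,
         cabs (phi (ray_pt c t) i j - phit (ray_pt c t) i j)
           <= K * expR (- 2 * (T - eps) * complex.Im (ray_pt c t))) ->
  0 < be -> (forall t i j, nsq (w t i j) <= be ^+ 2) ->
  (forall t i j, nsq (wt t i j) <= be ^+ 2) ->
  (forall t, 0 <= t -> t <= T -> w t = v t) ->
  (forall t, 0 <= t -> t <= T -> wt t = vt t) ->
  transfer_sol w wt E -> 0 <= x -> x < T ->
  exists B : R, forall z, 0 <= complex.Im z -> nsq (E z p x) <= B.
Proof.
move=> [_ hphi] [_ hphit] hray be0 w_le wt_le wv wtvt hE x0 xT.
(* With [eps = T - x] the rate [2 * (T - eps)] equals [2 * x], and squaring produces the [4 * x] of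
   [ray_bound]. *)
have [K [t0 hK]] := hray (T - x) ltac:(lra).
pose M := be * m%:R.
have M0 : 0 <= M by rewrite mulr_ge0 ?ler0n ?ltW.
(* Beyond [t1] the imaginary part is positive, the decay hypothesis is available, and [M] is at most
   half of [Im z]. *)
pose t1 := Num.max 1 (Num.max t0 (2 * M)).
pose B1 := expR (4 * (be * m%:R) * x) * (12 + 8 * (3 * ((m1 * (m2 * m1))%:R * `|K ^+ 2|) + 8)).
have vE t : 0 < t -> t < x -> v t = w t by move=> ? ?; rewrite wv//; lra.
have vtE t : 0 < t -> t < x -> vt t = wt t by move=> ? ?; rewrite wtvt//; lra.
have ray t : t1 <= t -> nsq (E (ray_pt c t) p x) <= B1.
  rewrite !ge_max => /andP[t11 /andP[t10 tM]].
  have eta0 : 0 < complex.Im (ray_pt c t) by rewrite /=; lra.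
  have [u [fu L2]] := hphi _ eta0; have [ut [fut L2t]] := hphit _ eta0.
  pose Em : 'M[C R]_m := \matrix_(i, j) E (ray_pt c t) (i, j) x.
  have EU : Em *m u x = ut x by exact: (transfer_fund be0 wt_le hE x0 vE vtE fu fut).
  have := @ray_bound R m1 m2 v vt (ray_pt c t) u ut (phi (ray_pt c t)) (phit (ray_pt c t))
    be x (K ^+ 2) Em eta0 fu fut be0 x0 _ _ L2 L2t _ _ EU p.1 p.2.
  rewrite mxE -surjective_pairing; apply.
  - by move=> s s0 sx i j; rewrite vE.
  - by move=> s s0 sx i j; rewrite vtE.
  - by rewrite /=; move: tM; rewrite /M; lra.
  move=> i j; rewrite -cabs_sqr; have h := hK t t10 i j.
  have c0 : 0 <= cabs (phi (ray_pt c t) i j - phit (ray_pt c t) i j) by exact: sqrtr_ge0.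
  apply: (@le_trans _ _ ((K * expR (- 2 * (T - (T - x)) * complex.Im (ray_pt c t))) ^+ 2)).
    by rewrite ler_pXn2r ?nnegrE//; exact: le_trans h.
  rewrite exprMn [expR _ ^+ 2]expr2 -expRD /=.
  by rewrite le_eqVlt; apply/orP; left; apply/eqP; congr (_ * expR _); ring.
pose N0 := \sum_q nsq (@id_data R m1 m2 q).
have N00 : 0 <= N0 by apply: sumr_ge0 => q _; exact: nsq_ge0.
pose k := 2 * (2 * be) * #|{: 'I_m * 'I_m}|%:R.
pose G := N0 * expR (k * x).
have G0 : 0 <= G by rewrite mulr_ge0 ?expR_ge0.
have growth X Y : 0 <= Y -> nsq (E (Complex X Y) p x) <= G * expR (4 * x * Y).
  move=> Y0; have := transfer_growth be0 w_le wt_le (Complex X Y) p hE x0.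
  rewrite -/N0 /rate /= (ger0_norm Y0) -/k /G -mulrA -expRD.
  by have -> : (4 * Y + k) * x = k * x + 4 * x * Y by ring.
(* The second entry covers the part of the ray below [t1] and also dominates [G], the bound on the
   real axis. *)
pose B := Num.max B1 (G * expR (4 * x * t1)).
have t1_ge0 : 0 <= t1 by apply: (le_trans ler01); rewrite le_max lexx.
have GB : G <= B.
  rewrite le_max; apply/orP; right; rewrite ler_peMr// -expR0 ler_expR.
  by rewrite !mulr_ge0.
have growthB X Y : 0 <= Y -> nsq (E (Complex X Y) p x) <= B * expR (4 * x * Y).
  move=> Y0; apply: (le_trans (growth X Y Y0)); rewrite ler_wpM2r ?expR_ge0//.
have rayB Y : 0 <= Y -> nsq (E (Complex (c * Y) Y) p x) <= B.
  move=> Y0; rewrite le_max; have [Yt|Yt] := leP t1 Y; apply/orP; [left|right].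
    exact: ray.
  apply: (le_trans (growth _ _ Y0)); rewrite ler_wpM2l// ler_expR.
  by rewrite ler_wpM2l ?mulr_ge0// ltW.
have a0 : 0 <= 4 * x by rewrite mulr_ge0.
have [_ _ hol] := hE; have hf := hol p x x0.
exists B => z Im0.
have -> : z = Complex (complex.Re z) (complex.Im z) by case: (z).
have [XY|XY] := leP (c * complex.Im z) (complex.Re z).
  apply: (@phragmen_lindelof R _ c 1 (4 * x) B (mulr1 1) hf a0 growthB _ _ _ Im0).
    by move=> Y Y0; rewrite mul1r; exact: rayB.
  by rewrite mul1r.
(* The left sector is the mirror image of the right one: orientation -1 and slope [- c] describe the
   same ray. *)
apply: (@phragmen_lindelof R _ (- c) (-1) (4 * x) B _ hf a0 growthB _ _ _ Im0).
- by rewrite mulrNN mulr1.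
- by move=> Y Y0; have -> : -1 * (- c * Y) = c * Y by [ring]; exact: rayB.
- by rewrite mulNr mulN1r lerN2 ltW.
Qed.

(* If the transfer matrix does not depend on [z], comparing its equations for
   two values of [z] shows that it commutes with [J]; then it is constant. *)
Lemma transfer_const_potential (w wt : R -> 'M[C R]_(m1, m2)) (T : R) E :
  transfer_sol w wt E ->
  (forall z p x, 0 <= x -> x < T -> E z p x = E 0 p x) ->
  forall x, 0 < x -> x < T -> w x = wt x.
Proof.
move=> [E0 DE _] cst.
(* Subtracting the equations at [z = 1] and [z = 0] leaves [lamT (i, j) * E = 0], and [lamT] is
   nonzero outside the diagonal blocks. *)
have off i j x : sg i != sg j -> 0 < x -> x < T -> E 0 (i, j) x = 0.
  move=> ij x0 xT.
  have h := has_cderiv_unique x0 xT (fun t t0 tT => cst 1 (i, j) t (ltW t0) tT)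
    (DE 1 (i, j) x (ltW x0)) (DE 0 (i, j) x (ltW x0)).
  rewrite !rhs_entries in h.
  have e p : E 1 p x = E 0 p x by apply: cst => //; exact: ltW.
  have s1 : \sum_k Gmat (wt x) i k * E 1 (k, j) x = \sum_k Gmat (wt x) i k * E 0 (k, j) x.
    by apply: eq_bigr => k _; rewrite e.
  have s2 : \sum_l E 1 (i, l) x * Gmat (w x) l j = \sum_l E 0 (i, l) x * Gmat (w x) l j.
    by apply: eq_bigr => k _; rewrite e.
  rewrite s1 s2 e mul1r !mul0r in h; move/addIr/eqP: h.
  rewrite /lamT /= !mulf_eq0 subr_eq0 (negbTE ij) orbF => /orP[|/eqP//].
  by rewrite (negbTE (neq0Ci _)).
(* At [z = 0] a diagonal-block entry is driven only by products of [Gmat] with entries outside the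
   diagonal blocks, which vanish. *)
have diag i j x : sg i = sg j -> 0 <= x -> x < T ->
    E 0 (i, j) x = (i == j)%:R.
  move=> ij x0 xT; rewrite (@has_cderiv0_cst _ T x x0 xT) ?E0//.
    by move=> t t0; eexists; exact: DE.
  move=> t t0 tT; have := DE 0 (i, j) t (ltW t0); apply: has_cderiv_eq.
  rewrite rhs_entries !mul0r add0r !big1 ?subrr// => k _.
    have [kj|kj] := eqVneq (sg k) (sg j).
      by rewrite Gmat_sgJ_eq ?mulr0.
    by rewrite off ?mul0r// ij eq_sym.
  have [ik|ik] := eqVneq (sg i) (sg k).
    by rewrite Gmat_sgJ_eq ?mul0r.
  by rewrite off ?mulr0// eq_sym -ij.
have Eid i j x : 0 < x -> x < T -> E 0 (i, j) x = (i == j)%:R.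
  move=> x0 xT; have [ij|ij] := eqVneq (sg i) (sg j).
    by apply: diag => //; exact: ltW.
  by rewrite off//; have [eij|//] := eqVneq i j; rewrite eij eqxx in ij.
move=> x x0 xT; apply/matrixP => i j.
pose i' : 'I_m := lshift m2 i; pose j' : 'I_m := rshift m1 j.
(* An upper right entry of the identity is constantly 0; its equation then says that the
   corresponding entries of the two [Gmat] coincide. *)
have h := has_cderiv_unique x0 xT (fun t t0 tT => Eid i' j' t t0 tT)
  (DE 0 (i', j') x (ltW x0)) (has_cderiv_cst _ x).
rewrite rhs_entries !mul0r add0r in h.
have pick (F G : 'I_m -> C R) k : (forall l, F l = (l == k)%:R) -> \sum_l F l * G l = G k.
  move=> hF; rewrite (bigD1 k)//= hF eqxx mul1r big1 ?addr0// => l lk.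
  by rewrite hF (negbTE lk) mul0r.
have s1 : \sum_k Gmat (wt x) i' k * E 0 (k, j') x = Gmat (wt x) i' j'.
  rewrite -(pick (fun k => E 0 (k, j') x) (Gmat (wt x) i') j') => [|l]; last exact: Eid.
  by apply: eq_bigr => k _; exact: mulrC.
have s2 : \sum_l E 0 (i', l) x * Gmat (w x) l j' = Gmat (w x) i' j'.
  apply: (pick (fun l => E 0 (i', l) x) (fun l => Gmat (w x) l j') i') => l.
  by rewrite Eid// eq_sym.
have {}h := etrans (esym s1) (etrans (subr0_eq h) s2).
have := etrans (esym (Gmat_lr (wt x) i j)) (etrans h (Gmat_lr (w x) i j)).
by move=> /(mulfI (neq0Ci _)) ->.
Qed.

(** Every point of [[0, T]] is a limit of interior points: [y] moves [x] slightly towards the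
    middle, and continuity of [f - g] at [x] concludes. *)
Lemma eq_at_ends (f g : R -> R) (T : R) : 0 < T -> continuous f -> continuous g ->
  (forall x, 0 < x -> x < T -> f x = g x) -> forall x, 0 <= x -> x <= T -> f x = g x.
Proof.
move=> T0 cf cg fg x x0 xT; apply/eqP; rewrite -subr_eq0 -normr_le0.
apply/ler_addgt0Pr => e e0; rewrite add0r.
have ch : {for x, continuous (fun t => f t - g t)} by apply: cvgB; [exact: cf | exact: cg].
have /cvgrPdist_le/(_ e e0)[d /= d0 hd] := ch.
pose r := Num.min (d / 2) (T / 2).
have r0 : 0 < r by rewrite lt_min !divr_gt0.
have rd : r <= d / 2 by rewrite ge_min lexx.
have rT : r <= T / 2 by rewrite ge_min lexx orbT.
pose y := if x <= T / 2 then x + r / 2 else x - r / 2.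
have [y0 yT xy] : [/\ 0 < y, y < T & `|x - y| < d].
  rewrite /y; have [xh|xh] := leP x (T / 2); split; try lra.
    by rewrite opprD addNKr normrN gtr0_norm ?divr_gt0//; lra.
  by rewrite opprB subrKC gtr0_norm ?divr_gt0//; lra.
by have := hd y xy; rewrite (fg y y0 yT) subrr subr0.
Qed.

End Borg.
End Final.

Theorem theorem6p5 (R : realType) (m1 m2 : nat) (T c : R)
  (v vt : R -> 'M[C R]_(m1, m2)) (phi phit : C R -> 'M[C R]_(m2, m1)) :
  0 < T ->
  C1_pos_mx v -> C1_pos_mx vt ->
  weyl_function v phi -> weyl_function vt phit ->
  (forall eps : R, 0 < eps ->
     exists K : R, exists t0 : R, forall t : R, t0 <= t ->
       forall i j,
         cabs (phi (ray_pt c t) i j - phit (ray_pt c t) i j)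
           <= K * expR (- 2 * (T - eps) * complex.Im (ray_pt c t))) ->
  forall x : R, 0 <= x <= T -> v x = vt x.
Proof.
move=> T0 Cv Cvt hphi hphit hray x /andP[x0 xT].
have [w [b1 [b10 w_le cw wv]]] := clamp_potential T0 Cv.
have [wt [b2 [b20 wt_le cwt wtvt]]] := clamp_potential T0 Cvt.
pose be := b1 + b2; have be0 : 0 < be by exact: addr_gt0.
have {}w_le t i j : nsq (w t i j) <= be ^+ 2.
  apply: (le_trans (w_le t i j)); rewrite ler_pXn2r ?nnegrE ?(ltW b10) ?(ltW be0)//.
  by rewrite lerDl ltW.
have {}wt_le t i j : nsq (wt t i j) <= be ^+ 2.
  apply: (le_trans (wt_le t i j)); rewrite ler_pXn2r ?nnegrE ?(ltW b20) ?(ltW be0)//.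
  by rewrite lerDr ltW.
have [E hE] := transfer_exists be0 w_le wt_le cw cwt.
have [E' hE'] := transfer_exists be0 wt_le w_le cwt cw.
have hray' : forall eps : R, 0 < eps ->
    exists K : R, exists t0 : R, forall t : R, t0 <= t -> forall i j,
      cabs (phit (ray_pt c t) i j - phi (ray_pt c t) i j)
        <= K * expR (- 2 * (T - eps) * complex.Im (ray_pt c t)).
  move=> eps e0; have [K [t0 h]] := hray eps e0; exists K, t0 => t ht i j.
  have -> : cabs (phit (ray_pt c t) i j - phi (ray_pt c t) i j) =
      cabs (phi (ray_pt c t) i j - phit (ray_pt c t) i j).
    by rewrite /cabs -/(nsq _) -opprB nsqN.
  exact: h.
have const z p y : 0 <= y -> y < T -> E z p y = E 0 p y.
  move=> y0 yT; have [_ _ hol] := hE.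
  have [B1 h1] := transfer_upper_bounded p hphi hphit hray be0 w_le wt_le wv wtvt hE y0 yT.
  (* The adjoint in [transfer_conj] transposes entries, hence the swapped index. *)
  have [B2 h2] := transfer_upper_bounded (p.2, p.1) hphit hphi hray' be0 wt_le w_le wtvt wv hE' y0 yT.
  apply: (@liouville R (fun z => E z p y) (Num.max B1 B2) (hol p y y0)) => z'.
  rewrite le_max; have [Im0|Im0] := leP 0 (complex.Im z'); first by rewrite h1.
  apply/orP; right; case: p {h1} h2 => i j h2.
  rewrite -[z']conjCK (transfer_conj be0 w_le wt_le (Num.conj z') i j hE hE' y0) !nsqM nsq_conj.
  have s1 k : nsq (@sgJ R m1 m2 0 k) = 1.
    have n1 : nsq (1 : C R) = 1 by rewrite /nsq !ReIm; ring.
    by case: (split_ordP k) => l ->; rewrite ?sgJl ?sgJr ?nsqN n1.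
  by rewrite !s1 !mul1r; apply: h2; rewrite Im_conj oppr_ge0 ltW.
have inner := transfer_const_potential hE const.
rewrite -wv// -wtvt//; apply/matrixP => i j.
have [cwR cwI] := cw i j; have [cwtR cwtI] := cwt i j.
apply: ReIm_inj.
  by apply: (eq_at_ends T0 cwR cwtR) => // y y0 yT; rewrite inner.
by apply: (eq_at_ends T0 cwI cwtI) => // y y0 yT; rewrite inner.
Qed.
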